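(* Let $\mu,\nu\in\mathcal P_2(\mathbb R^d)$ with $\mu$ dominated by $\nu$ in convex order, and let $m\in\mathsf{MT}(\mu,\nu)$. Let $(X,Y)\sim m$, let $W$ be a Brownian motion in $\mathbb R^d$ independent of $(X,Y)$, and set $R_s=s(Y-X)+W_s$ and $Z_s=\mathbb E[Y\mid X,(R_r)_{0\le r\le s}]$ for $s\ge0$. For $\sigma>0$ let $M^\sigma=(M^\sigma_t)_{t\in[0,1]}$ be the Föllmer martingale associated with the coupling $m$ and the reference volatility $\sigma$, and consider the deterministic time change $$\tau_\sigma(s):=\frac{\sigma^2s}{1+\sigma^2s},\qquad s\ge0.$$ Then $Z=(Z_s)_{s\ge0}$ is a continuous Markov martingale, and for every $\sigma>0$, $$(M^\sigma_{\tau_\sigma(s)})_{s\ge0}\stackrel{d}{=}(Z_s)_{s\ge0}.$$ In particular, the law of the time-changed process $(M^\sigma_{\tau_\sigma(s)})_{s\ge0}$ does not depend on $\sigma$.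
   Context: $\mathcal P_2(\mathbb R^d)$: Borel probability measures with finite second moment. Convex order: $\int\phi\,d\mu\le\int\phi\,d\nu$ for all convex $\phi:\mathbb R^d\to\mathbb R$. $\mathsf{MT}(\mu,\nu)$: martingale couplings, i.e. probability measures $m(dx,dy)=\mu(dx)m_x(dy)$ with marginals $\mu,\nu$ and $\int y\,m_x(dy)=x$ for $\mu$-a.e. $x$. Föllmer martingale with reference volatility $\sigma>0$: let $B$ be a standard Brownian motion in $\mathbb R^d$. For each $x$, the Föllmer process from $\delta_x$ to $m_x$ relative to the reference process $\sigma B$ is the process $(\widetilde X^\sigma_t)_{t\in[0,1]}$ with $\widetilde X^\sigma_0=x$, $\widetilde X^\sigma_1\sim m_x$, which conditionally on $\widetilde X^\sigma_1=y$ is a Brownian bridge from $x$ to $y$ with volatility $\sigma$ (i.e. $x+\sigma B$ conditioned to end at $y$); when $m_x$ is absolutely continuous with respect to the law of $x+\sigma B_1$, its law has density $\frac{dm_x}{d\mathrm{Law}(x+\sigma B_1)}(\omega_1)$ with respect to the law of $x+\sigma B$. The corresponding Doob martingale is $M^\sigma_t=\mathbb E[\widetilde X^\sigma_1\mid(\widetilde X^\sigma_u)_{0\le u\le t}]$. The Föllmer martingale $M^\sigma$ associated with $m$ and $\sigma$ is obtained by mixing these fiberwise Doob martingales over $x\sim\mu$: its law is the $\mu(dx)$-mixture of the laws of the Doob martingales for $(\delta_x,m_x)$.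
   Formalization: The Markov property is stated for the pair (X, Z), i.e. for Z together with its initial value Z_0 = X, since Z alone need not be Markov (e.g. X = ±1 fair, Y − X = ±2 an independent fair sign). *)

(* Defs.v *)
From HB Require Import structures.
From mathcomp Require Import all_boot all_order all_algebra.
From mathcomp Require Import all_classical all_reals all_analysis.

Set Implicit Arguments.
Unset Strict Implicit.
Unset Printing Implicit Defensive.

Import Order.TTheory GRing.Theory Num.Theory.
Import numFieldNormedType.Exports.

Local Open Scope classical_set_scope.
Local Open Scope ring_scope.

(* R^d is 'rV[R]_d with its Borel sigma-algebra. *)
HB.instance Definition _ (R : realType) (d : nat) :=
  @isMeasurable.Build (sigma_display (@open 'rV[R]_d)) 'rV[R]_d
    <<s @open 'rV[R]_d >>
    (@sigma_algebra0 _ setT (@open 'rV[R]_d))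
    (@sigma_algebraC _ (@open 'rV[R]_d))
    (@sigma_algebra_bigcup _ setT (@open 'rV[R]_d)).

Section sub_sigma_algebras.
Context {I T : Type} {disp : measure_display} {S : measurableType disp}.

Definition rv_events (V : T -> S) : set (set T) :=
  preimage_set_system setT V measurable.

Definition sigma_rv (V : T -> S) : set (set T) := <<s rv_events V >>.

Definition sigma_process (D : set I) (V : I -> T -> S) : set (set T) :=
  <<s \bigcup_(i in D) rv_events (V i) >>.

End sub_sigma_algebras.

(* A path is a total function of time; [paths d D] carries the product
   (cylinder) sigma-algebra generated by the coordinates in D only. *)
Definition paths {R : realType} (d : nat) (D : set R) : Type :=
  g_sigma_algebraType (\bigcup_(t in D)
    rv_events (fun w : R -> 'rV[R]_d => w t)).
HB.instance Definition _ (R : realType) (d : nat) (D : set R) :=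
  Measurable.on (@paths R d D).

Section probability_notions.
Context {R : realType} {disp : measure_display} {T : measurableType disp}.
Variable P : probability T R.

Definition indep (F G : set (set T)) : Prop :=
  forall A B, F A -> G B -> (P (A `&` B) = P A * P B)%E.

Definition is_condexp (G : set (set T)) (f g : T -> R) : Prop :=
  [/\ P.-integrable setT (EFin \o f),
      (forall B : set R, measurable B -> G (g @^-1` B)),
      P.-integrable setT (EFin \o g) &
      forall A, G A ->
        (\int[P]_(w in A) (g w)%:E = \int[P]_(w in A) (f w)%:E)%E].

Definition is_condexp_vec (d : nat) (G : set (set T)) (f g : T -> 'rV[R]_d) :
    Prop :=
  (forall B : set 'rV[R]_d, measurable B -> G (g @^-1` B)) /\
  forall i, is_condexp G (fun w => f w ord0 i) (fun w => g w ord0 i).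

Definition martingale (d : nat) (F : R -> set (set T))
    (Z : R -> T -> 'rV[R]_d) : Prop :=
  forall s t : R, 0 <= s -> s <= t -> is_condexp_vec (F s) (Z t) (Z s).

(* The Markov property relative to a filtration F: P(V_t \in B | F_s) and
   P(V_t \in B | V_s) have a common version. *)
Definition markov_process {disp' : measure_display} {S : measurableType disp'}
    (F : R -> set (set T)) (V : R -> T -> S) : Prop :=
  (forall s : R, 0 <= s -> sigma_rv (V s) `<=` F s) /\
  forall s t : R, 0 <= s -> s <= t -> forall B : set S, measurable B ->
    exists g : T -> R,
      is_condexp (sigma_rv (V s)) \1_(V t @^-1` B) g /\
      is_condexp (F s) \1_(V t @^-1` B) g.

Definition has_continuous_modification (d : nat) (Z : R -> T -> 'rV[R]_d) :
    Prop :=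
  exists Z' : R -> T -> 'rV[R]_d,
    [/\ (forall s : R, 0 <= s -> measurable_fun setT (Z' s)),
        (forall s : R, 0 <= s -> {ae P, forall w, Z' s w = Z s w}) &
        forall w, {within `[0, +oo[, continuous (fun s => Z' s w)}].

(* The last clause says that W_t - W_s has law N(0, (t - s) I_d): its
   coordinates are independent with law N(0, t - s). *)
Definition brownian_motion (d : nat) (W : R -> T -> 'rV[R]_d) : Prop :=
  [/\ (forall t : R, 0 <= t -> measurable_fun setT (W t)),
      {ae P, forall w, W 0 w = 0},
      {ae P, forall w, {within `[0, +oo[, continuous (fun t => W t w)}},
      (forall s t : R, 0 <= s -> s < t ->
        indep (sigma_process `[0, s] W) (sigma_rv (fun w => W t w - W s w))) &
      forall s t : R, 0 <= s -> s < t ->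
        forall B : 'I_d -> set R, (forall i, measurable (B i)) ->
        P [set w | forall i, B i ((W t w - W s w) ord0 i)] =
        (\prod_(i < d) normal_prob 0 (Num.sqrt (t - s)) (B i))%E].

End probability_notions.

Definition path_law {R : realType} {disp : measure_display}
    {T : measurableType disp} (P : probability T R) (d : nat)
    (V : R -> T -> 'rV[R]_d) (A : set (R -> 'rV[R]_d)) : \bar R :=
  P [set w | A (fun t => V t w)].

Definition same_law {R : realType} (d : nat) (D : set R)
    {d1 : measure_display} {T1 : measurableType d1} (P1 : probability T1 R)
    (V1 : R -> T1 -> 'rV[R]_d)
    {d2 : measure_display} {T2 : measurableType d2} (P2 : probability T2 R)
    (V2 : R -> T2 -> 'rV[R]_d) : Prop :=
  forall A : set (paths d D), measurable A ->
    path_law P1 V1 A = path_law P2 V2 A.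

Section couplings.
Context {R : realType} {d : nat}.
Implicit Types mu nu : probability 'rV[R]_d R.

Definition finite_second_moment mu : Prop :=
  (\int[mu]_x (\sum_(i < d) (x ord0 i) ^+ 2)%:E < +oo)%E.

Definition convex_order mu nu : Prop :=
  forall phi : 'rV[R]_d -> R^o, convex_function setT phi ->
    (\int[mu]_x (phi x : R)%:E <= \int[nu]_x (phi x : R)%:E)%E.

(* k is a disintegration m(dx, dy) = mu(dx) k_x(dy) of m. *)
Definition martingale_coupling mu nu
    (m : probability ('rV[R]_d * 'rV[R]_d)%type R)
    (k : R.-pker 'rV[R]_d ~> 'rV[R]_d) : Prop :=
  [/\ (forall A, measurable A -> m (A `*` setT) = mu A),
      (forall B, measurable B -> m (setT `*` B) = nu B),
      (forall A B, measurable A -> measurable B ->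
        m (A `*` B) = (\int[mu]_(x in A) k x B)%E) &
      {ae mu, forall x, forall i,
        (k x).-integrable setT (fun y => (y ord0 i)%:E) /\
        (\int[k x]_y (y ord0 i)%:E = (x ord0 i)%:E)%E}].

End couplings.

Section foellmer.
Context {R : realType} {d : nat}.
(* the reference Brownian motion *)
Context {d0 : measure_display} {T0 : measurableType d0}.
Variables (P0 : probability T0 R) (B : R -> T0 -> 'rV[R]_d).

Definition brownian_bridge (sigma : R) (x y : 'rV[R]_d) (t : R) (w : T0) :
    'rV[R]_d :=
  x + t *: (y - x) + sigma *: (B t w - t *: B 1 w).

Definition foellmer_process (sigma : R) (x : 'rV[R]_d)
    (rho : {measure set 'rV[R]_d -> \bar R})
    {d1 : measure_display} {T1 : measurableType d1} (P1 : probability T1 R)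
    (V : R -> T1 -> 'rV[R]_d) : Prop :=
  [/\ (forall t : R, 0 <= t <= 1 -> measurable_fun setT (V t)),
      {ae P1, forall w, {within `[0, 1], continuous (fun t => V t w)}},
      {ae P1, forall w, V 0 w = x},
      (forall C, measurable C -> P1 (V 1 @^-1` C) = rho C) &
      forall (A : set (paths d `[0, 1])) (C : set 'rV[R]_d),
        measurable A -> measurable C ->
        P1 ([set w | A (fun t => V t w)] `&` V 1 @^-1` C) =
        (\int[rho]_(y in C) path_law P0 (brownian_bridge sigma x y) A)%E].

Definition doob_martingale
    {d1 : measure_display} {T1 : measurableType d1} (P1 : probability T1 R)
    (V M : R -> T1 -> 'rV[R]_d) : Prop :=
  forall t : R, 0 <= t <= 1 ->
    is_condexp_vec P1 (sigma_process `[0, t] V) (V 1) (M t).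

Definition is_foellmer_doob_law (sigma : R) (x : 'rV[R]_d)
    (rho : {measure set 'rV[R]_d -> \bar R})
    (Q : set (R -> 'rV[R]_d) -> \bar R) : Prop :=
  exists (d1 : measure_display) (T1 : measurableType d1)
    (P1 : probability T1 R) (V M : R -> T1 -> 'rV[R]_d),
    [/\ foellmer_process sigma x rho P1 V, doob_martingale P1 V M &
        forall A : set (paths d `[0, 1]), measurable A ->
          Q A = path_law P1 M A].

(* The fiberwise laws q_x exist only for mu-almost every x, because k_x is
   only guaranteed to be integrable for mu-almost every x. *)
Definition foellmer_martingale (sigma : R) (mu : probability 'rV[R]_d R)
    (k : R.-pker 'rV[R]_d ~> 'rV[R]_d)
    {d1 : measure_display} {T1 : measurableType d1} (P1 : probability T1 R)
    (M : R -> T1 -> 'rV[R]_d) : Prop :=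
  (forall t : R, 0 <= t <= 1 -> measurable_fun setT (M t)) /\
  exists q : R.-pker 'rV[R]_d ~> (paths d (`[0, 1] : set R)),
    {ae mu, forall x, is_foellmer_doob_law sigma x (k x) (q x)} /\
    forall A : set (paths d `[0, 1]), measurable A ->
      path_law P1 M A = (\int[mu]_x q x A)%E.

End foellmer.

Section observation.
Context {R : realType} {d : nat} {disp : measure_display}
  {T : measurableType disp}.
Variables (X Y : T -> 'rV[R]_d) (W : R -> T -> 'rV[R]_d).

Definition observation (s : R) (w : T) : 'rV[R]_d :=
  s *: (Y w - X w) + W s w.

Definition observation_filtration (s : R) : set (set T) :=
  <<s rv_events X `|` \bigcup_(r in `[0, s]) rv_events (observation r) >>.

End observation.

Definition tau {R : realType} (sigma s : R) : R :=
  sigma ^+ 2 * s / (1 + sigma ^+ 2 * s).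

(* Main.v *)
(* Given X = x, the posterior law of Y after observing (R_r)_{r <= s} has by the
   Cameron-Martin formula a density proportional to
   exp(<y - x, R_s> - s |y - x|^2 / 2) with respect to k_x, so Z_s = b_s(X, R_s)
   for an explicit posterior mean b_s.
   Time change: for a Brownian bridge from x to y with volatility sigma, the
   process (U_t - x) / (sigma^2 (1 - t)) at t = tau_sigma(s) is s (y - x) plus a
   Brownian motion. Hence the Foellmer process from x to k_x generates the same
   observation model, its Doob martingale at tau_sigma(s) is b_s(x, R_s), and its
   law does not involve sigma.
   Markov property: r |-> b_s(x, r) need not be injective, but b_s(x, r) =
   b_s(x, r') forces <r - r', y - x> to be k_x-a.e. constant, so that r and r'
   give the same posterior and the same transition probabilities; these are
   therefore functions of (X, Z_s).
   Continuity: for s > 0 it is dominated convergence; at s = 0 the weights are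
   dominated by C (1 + |y - x|), because |R_s|^2 exp(d |R_s|^2 / s) is a.s.
   bounded near 0, by Doob's maximal inequality and Borel-Cantelli, and k_x has a
   finite second moment for mu-a.e. x. *)
From HB Require Import structures.
Require Import Defs.
From mathcomp Require Import all_boot all_order all_algebra.
From mathcomp Require Import all_classical all_reals all_analysis.
From mathcomp Require finmap.
From mathcomp Require Import measurable_realfun.
From mathcomp Require Import ring lra.

Set Implicit Arguments.
Unset Strict Implicit.
Unset Printing Implicit Defensive.

Import Order.TTheory GRing.Theory Num.Theory.
Import numFieldNormedType.Exports.

Local Open Scope classical_set_scope.
Local Open Scope ring_scope.

(** * Borel sets of row vectors and of path spaces *)

(** Everything about posteriors starts from one identity, [hmodel]: the joint law of initial point,
    terminal point and observation path is the mixture, over [mu] and the fibres of [k], of drifted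
    Wiener measure. It is established for the observation model and, with a Dirac mass as initial
    law, for a single Foellmer fibre; conditional expectations and laws are then derived once for
    both. Laws live on cylinder sigma-algebras, which do not see continuity, so Wiener measure is
    handled through independent Gaussian increments alone. For the rescaled bridge these come from
    one fact: if x and y are independent, centred Gaussian of variances a and c, then x + y and c x
    - a y are independent. The obstacle in the Markov property is measurability: equal means giving
    equal transition probabilities does not by itself produce a Borel function of the mean. For s >
    0 such a function is built by hand from continuity of both in the observation. Transition
    probabilities of a merely Borel event are continuous because Gaussian smoothing makes the
    weights of the event and of its complement lower semicontinuous, while their sum is
    continuous. *)

Section borel_rV.
Context {R : realType} {d : nat}.
Local Notation V := 'rV[R]_d.

Lemma open_measurable_rV (U : set V) : open U -> measurable U.
Proof. exact: sub_sigma_algebra. Qed.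

Lemma measurable_coord (i : 'I_d) : measurable_fun [set: V] (fun x : V => x ord0 i).
Proof.
apply: (measurability _ (RGenOpens.measurableE R)) => //.
move=> _ [_ [a [b ->]] <-]; rewrite setTI; apply: open_measurable_rV.
apply: open_comp; last exact: interval_open.
by move=> x _; exact: coord_continuous.
Qed.

(** An open set is a union of cubes with rational centres and half-width 1/(n+1), and there are only
    countably many of these. *)
Lemma measurable_rV {disp} {T : measurableType disp} (f : T -> V) :
  (forall i, measurable_fun setT (fun w => f w ord0 i)) -> measurable_fun setT f.
Proof.
move=> mf; apply: (measurability (@open V)) => //.
move=> _ [U oU <-]; rewrite setTI.
pose r (n : nat) (q : 'rV[rat]_d) : V := \row_j ratr (q ord0 j).
pose box (q : 'rV[rat]_d) (n : nat) : set V :=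
  [set x | forall i, `|x ord0 i - ratr (q ord0 i)| < n.+1%:R^-1].
have mbox q n : measurable (f @^-1` box q n).
  rewrite (_ : _ @^-1` _ = \bigcap_(i in [set: 'I_d])
      ((fun w => f w ord0 i) @^-1` ball (ratr (q ord0 i) : R) n.+1%:R^-1)).
    apply: fin_bigcap_measurable => // i _.
    rewrite -[X in measurable X]setTI; apply: mf => //.
    exact: measurable_ball.
  apply/seteqP; split => w /= h; first by move=> i _; rewrite /= /ball/= distrC.
  by move=> i; have := h i I; rewrite /= /ball/= distrC.
pose G (q : 'rV[rat]_d) (n : nat) := if pselect (box q n `<=` U) then box q n else set0.
have mG q n : measurable (f @^-1` G q n).
  by rewrite /G; case: pselect => h; [exact: mbox|rewrite preimage_set0].
suff -> : f @^-1` U = \bigcup_n \bigcup_(m : nat)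
   f @^-1` (if unpickle m is Some q then G q n else set0).
  apply: bigcupT_measurable => n; apply: bigcupT_measurable => m.
  by case: unpickle => [q|]; [exact: mG|rewrite preimage_set0].
apply/seteqP; split => [w /= Ufw|w [n _ [m _]]] /=; last first.
  by case: unpickle => [q|//]; rewrite /G; case: pselect => [h /h|].
have : nbhs (f w) U by exact: open_nbhs_nbhs.
move=> /nbhs_ballP[e /= e0 eU].
have [n ne] : exists n, (n.+1%:R^-1 : R) *+ 2 < e.
  have e20 : 0 < e / 2 by rewrite divr_gt0.
  have [n] := near_infty_natSinv_lt (PosNum e20).
  move=> _ /(_ n (leqnn _)) /=; rewrite ltr_pdivlMr// => h; exists n.
  by rewrite -[_ *+ 2]mulr_natr.
have /choice[q hq] : forall i, exists q : rat, `|f w ord0 i - ratr q| < n.+1%:R^-1.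
  move=> i; have /(rat_in_itvoo)[q] :
    f w ord0 i - n.+1%:R^-1 < f w ord0 i + n.+1%:R^-1 :> R.
    by rewrite ltrD2l -subr_gt0 opprK addr_gt0// invr_gt0.
  rewrite in_itv /= => /andP[q1 q2]; exists q.
  by rewrite distrC ltr_distl q1 q2.
exists n => //; exists (pickle (\row_j q j)) => //=; rewrite pickleK /G.
have bw : box (\row_j q j) n (f w) by move=> i; rewrite mxE.
case: pselect => // -[]; move=> y yb; apply: eU; split => // i j.
rewrite (ord1 i); rewrite /ball/=.
rewrite (le_lt_trans (ler_distD (ratr ((\row_j q j) ord0 j)) _ _))//.
apply: le_lt_trans ne; rewrite mulr2n; apply: lerD; apply: ltW; first exact: bw.
by rewrite distrC; exact: yb.
Qed.

End borel_rV.

Lemma measure_eq_pi {R : realType} {disp} {T : measurableType disp}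
    (G : set (set T)) (m1 m2 : {measure set T -> \bar R}) :
  measurable `<=` <<s G >> -> G `<=` measurable -> setI_closed G -> G setT ->
  (m1 setT < +oo)%E -> (forall A, G A -> m1 A = m2 A) ->
  forall A, measurable A -> m1 A = m2 A.
Proof.
move=> sG Gm GI GT m1T m12 A mA.
apply: (g_sigma_algebra_measure_unique G Gm (fun=> setT)) => //.
  by apply/seteqP; split => // x _; exists 0%N.
exact: sG.
Qed.

Section boxes.
Context {R : realType} {d : nat}.
Local Notation V := 'rV[R]_d.

Definition box (B : 'I_d -> set R) : set V := [set x | forall i, B i (x ord0 i)].

Lemma measurable_box B : (forall i, measurable (B i)) -> measurable (box B).
Proof.
move=> mB; rewrite (_ : box B = \bigcap_(i in [set: 'I_d])
    ((fun x : V => x ord0 i) @^-1` B i)).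
  apply: fin_bigcap_measurable => // i _.
  by rewrite -[X in measurable X]setTI; exact: measurable_coord.
by apply/seteqP; split => x h i => [_|]; exact: h.
Qed.

Definition boxes := [set box B | B in [set B : 'I_d -> set R | forall i, measurable (B i)]].

Lemma boxes_pi : [/\ (measurable : set (set V)) `<=` <<s boxes >>,
  boxes `<=` measurable, setI_closed boxes & boxes setT].
Proof.
split.
(* The identity out of the sigma-algebra generated by the boxes has measurable coordinates, hence is
   Borel; this says that boxes generate. *)
- move=> A mA; have : measurable_fun [set: g_sigma_algebraType boxes] (id : V -> V).
    apply: measurable_rV => i _ B mB; rewrite setTI; apply: sub_sigma_algebra.
    exists (fun j => if j == i then B else setT); first by move=> j /=; case: ifP.
    apply/seteqP; split => x /= => [/(_ i)|Bx j]; first by rewrite eqxx.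
    by case: eqP => // ->.
  by move=> /(_ measurableT _ mA); rewrite setTI.
- by move=> _ [B mB <-]; exact: measurable_box.
- move=> _ _ [B mB <-] [C mC <-]; exists (fun i => B i `&` C i).
    by move=> i; exact: measurableI.
  apply/seteqP; split => x /=; first by move=> h; split => i; have [] := h i.
  by move=> [h1 h2] i; split; [exact: h1|exact: h2].
- by exists (fun=> setT) => //; apply/seteqP; split.
Qed.

Lemma measure_eq_box (m1 m2 : {measure set V -> \bar R}) :
  (m1 setT < +oo)%E ->
  (forall B, (forall i, measurable (B i)) -> m1 (box B) = m2 (box B)) ->
  forall A, measurable A -> m1 A = m2 A.
Proof.
have [G1 G2 G3 G4] := boxes_pi.
move=> m1T m12; apply: (@measure_eq_pi _ _ _ boxes) => //.
by move=> _ [B mB <-]; exact: m12.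
Qed.

End boxes.

Section rv_measurability.
Context {R : realType} {d : nat} {disp : measure_display} {T : measurableType disp}.
Local Notation V := 'rV[R]_d.

Lemma measurable_coordT (f : T -> V) i :
  measurable_fun setT f -> measurable_fun setT (fun w => f w ord0 i).
Proof. by move=> mf; exact: (measurableT_comp (measurable_coord i)). Qed.

Lemma measurable_rVD (f g : T -> V) : measurable_fun setT f ->
  measurable_fun setT g -> measurable_fun setT (fun w => f w + g w).
Proof.
move=> mf mg; apply: measurable_rV => i.
under eq_fun do rewrite mxE.
by apply: measurable_funD; exact: measurable_coordT.
Qed.

Lemma measurable_rVN (f : T -> V) : measurable_fun setT f ->
  measurable_fun setT (fun w => - f w).
Proof.
move=> mf; apply: measurable_rV => i.
under eq_fun do rewrite mxE.
by apply: measurable_funN; exact: measurable_coordT.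
Qed.

Lemma measurable_rVB (f g : T -> V) : measurable_fun setT f ->
  measurable_fun setT g -> measurable_fun setT (fun w => f w - g w).
Proof. by move=> mf mg; apply: measurable_rVD => //; exact: measurable_rVN. Qed.

Lemma measurable_rVZ (a : T -> R) (f : T -> V) : measurable_fun setT a ->
  measurable_fun setT f -> measurable_fun setT (fun w => a w *: f w).
Proof.
move=> ma mf; apply: measurable_rV => i.
under eq_fun do rewrite mxE.
by apply: measurable_funM => //; exact: measurable_coordT.
Qed.

End rv_measurability.

Section paths_measurability.
Context {R : realType} {d : nat}.
Local Notation V := 'rV[R]_d.

Lemma measurable_eval (D : set R) (t : R) : D t ->
  measurable_fun [set: paths d D] (fun w : paths d D => w t : V).
Proof.
move=> Dt _ B mB; apply: sub_sigma_algebra; exists t => //; exists B => //.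
Qed.

Lemma measurable_paths {disp} {T : measurableType disp} (D : set R)
    (F : T -> paths d D) :
  (forall t, D t -> measurable_fun setT (fun w => F w t : V)) ->
  measurable_fun setT F.
Proof.
move=> mF; apply: (@measurability _ _ T (paths d D) setT F (\bigcup_(t in D)
  rv_events (fun w : R -> 'rV[R]_d => w t))) => //.
move=> _ [_ [t Dt [B mB <-]] <-]; rewrite setTI setTI -[X in _ X]setTI; exact: (mF t Dt measurableT B mB).
Qed.

(** Good sets argument. [C] is an abstract sigma-algebra on a bare type, so that it applies to
    filtrations and also to a class of events decided by the starting point. *)
Lemma paths_preimage {T : Type} (D : set R) (F : R -> T -> V) (C : set (set T)) :
  sigma_algebra setT C ->
  (forall t B, D t -> measurable B -> C (F t @^-1` B)) ->
  forall A : set (paths d D), measurable A -> C [set w | A (fun t => F t w)].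
Proof.
move=> sC FC A mA.
pose Ph w : R -> V := fun t => F t w.
suff : image_set_system setT Ph C A by rewrite /image_set_system /= setTI.
suff /(_ A mA) : (measurable : set (set (paths d D))) `<=` image_set_system setT Ph C by [].
apply: smallest_sub; first exact: sigma_algebra_image.
move=> _ [t Dt [B mB <-]]; rewrite /image_set_system /= !setTI; exact: FC.
Qed.

(** Turns an event of a filtration into a measurable set of paths, the form in which independence
    and integrals are handled below. *)
Lemma sigma_processP {T : Type} (D : set R) (F : R -> T -> V) (A : set T) :
  sigma_process D F A <->
  exists2 A' : set (paths d D), measurable A' & A = [set w | A' (fun t => F t w)].
Proof.
split; last first.
  move=> [A' mA' ->]; apply: paths_preimage mA'; first exact: smallest_sigma_algebra.
  move=> t B Dt mB; apply: sub_sigma_algebra; exists t => //; exists B => //.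
  by rewrite setTI.
pose Ph w : paths d D := fun t => F t w.
suff : sigma_process D F `<=` preimage_set_system setT Ph measurable.
  by move=> /[apply] -[A' mA' <-]; exists A' => //; rewrite setTI.
apply: smallest_sub.
  by apply: sigma_algebra_preimage; exact: sigma_algebra_measurable.
move=> _ [t Dt [B mB <-]]; exists ((fun w : paths d D => w t) @^-1` B).
  by rewrite -[X in measurable X]setTI; exact: measurable_eval.
by [].
Qed.

Lemma sigma_rvP {T : Type} {disp} {S : measurableType disp} (F : T -> S) (A : set T) :
  sigma_rv F A <-> exists2 B, measurable B & A = F @^-1` B.
Proof.
split; last first.
  move=> [B mB ->]; apply: sub_sigma_algebra; exists B => //.
  by rewrite setTI.
suff : sigma_rv F `<=` preimage_set_system setT F measurable.
  by move=> /[apply] -[B mB <-]; exists B => //; rewrite setTI.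
apply: smallest_sub => //.
by apply: sigma_algebra_preimage; exact: sigma_algebra_measurable.
Qed.

Lemma measurable_paths_sub (D D' : set R) : D' `<=` D ->
  measurable_fun [set: paths d D] (fun w : paths d D => (w : paths d D')).
Proof.
move=> DD; apply: measurable_paths => t D't; apply: measurable_eval.
exact: DD.
Qed.

End paths_measurability.

(** * Laws, densities and mixtures *)

Section monotone_class.
Local Open Scope ereal_scope.
Context {R : realType} {disp} {S : measurableType disp}.
Import finmap.
Import HBNNSimple.

(** The standard machine: a nonnegative measurable function is an increasing limit of simple
    functions, each a finite combination of indicators with nonnegative coefficients. *)
Lemma ge0_measurable_ind (Q : (S -> \bar R) -> Prop) :
  (forall A, measurable A -> Q (fun x => (\1_A x)%:E)) ->
  (forall (c : R) f, (0 <= c)%R -> measurable_fun setT f -> (forall x, 0 <= f x) ->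
    Q f -> Q (fun x => c%:E * f x)) ->
  (forall f g, measurable_fun setT f -> (forall x, 0 <= f x) ->
    measurable_fun setT g -> (forall x, 0 <= g x) ->
    Q f -> Q g -> Q (fun x => f x + g x)) ->
  (forall f_ : (S -> \bar R)^nat, (forall n, measurable_fun setT (f_ n)) ->
    (forall n x, 0 <= f_ n x) -> (forall x, nondecreasing_seq (f_ ^~ x)) ->
    (forall n, Q (f_ n)) -> Q (fun x => limn (f_ ^~ x))) ->
  forall f, measurable_fun setT f -> (forall x, 0 <= f x) -> Q f.
Proof.
move=> Q1 Qc QD Ql f mf f0.
pose f_ := nnsfun_approx measurableT mf.
have fE : f = fun x => limn (fun n => (f_ n x)%:E).
  by apply/funext => x; apply/esym/cvg_lim => //; exact: cvg_nnsfun_approx.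
rewrite fE; apply: (Ql (fun n x => (f_ n x)%:E)).
- by move=> n; apply/measurable_EFinP.
- by move=> n x; rewrite lee_fin.
- by move=> x m n mn; rewrite lee_fin; exact/lefP/nd_nnsfun_approx.
move=> n.
have -> : (fun x => (f_ n x)%:E) =
    (fun x => \sum_(y <- fset_set (range (f_ n))) (y%:E * (\1_(f_ n @^-1` [set y]) x)%:E)).
  apply/funext => x; rewrite {1}fimfunE fsbig_finite//= -sumEFin.
  by apply: eq_bigr => y _; rewrite EFinM.
have h0 y : y \in (fset_set (range (f_ n)) : seq R) -> (0 <= y)%R.
  move=> ys; have : y \in fset_set (range (f_ n)) by [].
  by rewrite in_fset_set// => /set_mem[x _ <-].
have mi y : measurable (f_ n @^-1` [set y]) by [].
elim: (enum_fset _) h0 => [|y s ih] h0.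
  under eq_fun do rewrite big_nil.
  have := Q1 set0 measurable0; congr (Q _); apply/funext => x.
  by rewrite indic0.
under eq_fun do rewrite big_cons.
have mterm z : measurable_fun setT (fun x => z%:E * (\1_(f_ n @^-1` [set z]) x)%:E).
  by apply: measurable_funeM; apply/measurable_EFinP; exact: measurable_indic.
have pterm z x : (0 <= z)%R -> 0 <= z%:E * (\1_(f_ n @^-1` [set z]) x)%:E.
  by move=> z0; rewrite mule_ge0// lee_fin.
apply: QD.
- exact: mterm.
- by move=> x; apply: pterm; apply: h0; rewrite mem_head.
- by apply: emeasurable_sum => z; exact: mterm.
- move=> x; rewrite big_seq; apply: sume_ge0 => z zs; apply: pterm.
  by apply: h0; rewrite in_cons zs orbT.
- apply: Qc; [by apply: h0; rewrite mem_head| |by move=> x; rewrite lee_fin|exact: Q1].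
  by apply/measurable_EFinP; exact: measurable_indic.
- by apply: ih => z zs; apply: h0; rewrite in_cons zs orbT.
Qed.

End monotone_class.

Section mixture.
Local Open Scope ereal_scope.
Context {R : realType} {d1 d2} {X : measurableType d1} {Z : measurableType d2}.
Variables (mu : {measure set X -> \bar R}) (eta : X -> {measure set Z -> \bar R}).
Hypothesis meta : forall A, measurable A -> measurable_fun setT (eta ^~ A).

(** The measurability proof is carried in the term so that the measure structure can be inferred
    from it; [mdens] and [law] follow the same pattern. *)
Definition mixture of (forall A, measurable A -> measurable_fun setT (eta ^~ A)) :=
  fun A : set Z => \int[mu]_x eta x A.

Let mixture0 : mixture meta set0 = 0.
Proof. by rewrite /mixture integral0_eq// => x _; rewrite measure0. Qed.

Let mixture_ge0 A : 0 <= mixture meta A.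
Proof. exact: integral_ge0. Qed.

Let mixture_sigma_additive : semi_sigma_additive (mixture meta).
Proof.
move=> F mF tF mUF; rewrite /mixture.
have -> : \int[mu]_x eta x (\bigcup_n F n) = \sum_(n <oo) \int[mu]_x eta x (F n).
  rewrite -integral_nneseries//; last by move=> n; exact: meta.
  apply: eq_integral => x _; apply/esym/cvg_lim => //.
  exact: measure_semi_sigma_additive.
by apply: is_cvg_ereal_nneg_natsum_cond => n _ _; exact: integral_ge0.
Qed.

HB.instance Definition _ := isMeasure.Build _ _ _ (mixture meta)
  mixture0 mixture_ge0 mixture_sigma_additive.

Lemma integral_mixture (f : Z -> \bar R) :
  measurable_fun setT f -> (forall z, 0 <= f z) ->
  \int[mixture meta]_z f z = \int[mu]_x \int[eta x]_z f z.
Proof.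
move: f; apply: ge0_measurable_ind => [A mA|c f c0 mf f0 fE|f g mf f0 mg g0 fE gE|f_ mf f0 nd fE].
- rewrite integral_indic//= setIT; apply: eq_integral => x _.
  by rewrite integral_indic//= setIT.
- rewrite (ge0_integralZl_EFin _ measurableT (fun x _ => f0 x) mf c0).
  rewrite fE -(ge0_integralZl_EFin _ measurableT) //.
  + by apply: eq_integral => x _; rewrite (ge0_integralZl_EFin _ measurableT).
  + by move=> x _; exact: integral_ge0.
  + exact: measurable_fun_integral_kernel.
- rewrite (ge0_integralD _ measurableT (fun x _ => f0 x) mf (fun x _ => g0 x) mg).
  rewrite fE gE -(ge0_integralD _ measurableT).
  + by apply: eq_integral => x _; rewrite (ge0_integralD _ measurableT).
  + by move=> x _; exact: integral_ge0.
  + exact: measurable_fun_integral_kernel.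
  + by move=> x _; exact: integral_ge0.
  + exact: measurable_fun_integral_kernel.
- rewrite monotone_convergence//.
  under eq_fun do rewrite fE.
  rewrite -monotone_convergence//.
  + by apply: eq_integral => x _; rewrite monotone_convergence// => z _; exact: nd.
  + by move=> n; exact: measurable_fun_integral_kernel.
  + by move=> n x _; exact: integral_ge0.
  + move=> x _ m n mn; apply: ge0_le_integral => // z _; exact: nd.
Qed.

End mixture.

Section density.
Local Open Scope ereal_scope.
Context {R : realType} {disp} {S : measurableType disp}.
Variables (P : {measure set S -> \bar R}) (g : S -> R).
Hypotheses (mg : measurable_fun setT g) (g0 : forall x, (0 <= g x)%R).

Definition mdens of measurable_fun setT g & (forall x, (0 <= g x)%R) :=
  fun A : set S => \int[P]_(x in A) (g x)%:E.

Let mdens0 : mdens mg g0 set0 = 0.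
Proof. by rewrite /mdens integral_set0. Qed.

Let mdens_ge0 A : 0 <= mdens mg g0 A.
Proof. by apply: integral_ge0 => x _; rewrite lee_fin. Qed.

Let mdens_sigma_additive : semi_sigma_additive (mdens mg g0).
Proof.
move=> F mF tF mUF; rewrite /mdens ge0_integral_bigcup//; last 2 first.
- by apply: measurable_funTS; exact/measurable_EFinP.
- by move=> x _; rewrite lee_fin.
by apply: is_cvg_ereal_nneg_natsum_cond => n _ _; apply: integral_ge0 => x _; rewrite lee_fin.
Qed.

HB.instance Definition _ := isMeasure.Build _ _ _ (mdens mg g0)
  mdens0 mdens_ge0 mdens_sigma_additive.

Lemma integral_mdens (f : S -> \bar R) :
  measurable_fun setT f -> (forall z, 0 <= f z) ->
  \int[mdens mg g0]_z f z = \int[P]_x (f x * (g x)%:E).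
Proof.
have mgE : measurable_fun setT (EFin \o g) by exact/measurable_EFinP.
move: f; apply: ge0_measurable_ind => [A mA|c f c0 mf f0 fE|f h mf f0 mh h0 fE hE|f_ mf f0 nd fE].
- rewrite integral_indic//= setIT /mdens integral_mkcond; apply: eq_integral => x _.
  by rewrite epatch_indic/= muleC.
- rewrite ge0_integralZl_EFin// fE -ge0_integralZl_EFin//.
  + by apply: eq_integral => x _; rewrite muleA.
  + by move=> x _; rewrite mule_ge0// lee_fin.
  + exact: emeasurable_funM.
- rewrite ge0_integralD// fE hE -ge0_integralD//.
  + by apply: eq_integral => x _; rewrite ge0_muleDl.
  + by move=> x _; rewrite mule_ge0// lee_fin.
  + exact: emeasurable_funM.
  + by move=> x _; rewrite mule_ge0// lee_fin.
  + exact: emeasurable_funM.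
- rewrite monotone_convergence//.
  under eq_fun do rewrite fE.
  rewrite -monotone_convergence//.
  + apply: eq_integral => x _; apply/cvg_lim => //; apply: cvgeZr => //.
    by apply: ereal_nondecreasing_is_cvgn; exact: nd.
  + by move=> n; exact: emeasurable_funM.
  + by move=> n x _; rewrite mule_ge0// lee_fin.
  + by move=> x _ m n mn; rewrite lee_wpmul2r// ?lee_fin//; exact: nd.
Qed.

End density.

Section law.
Local Open Scope ereal_scope.
Context {R : realType} {d1 d2} {T : measurableType d1} {S : measurableType d2}.

Section measure.
Variables (P : {measure set T -> \bar R}) (F : T -> S).
Hypothesis mF : measurable_fun setT F.

Definition law of measurable_fun setT F := fun A : set S => P (F @^-1` A).

Let law0 : law mF set0 = 0.
Proof. by rewrite /law preimage_set0 measure0. Qed.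

Let law_ge0 A : 0 <= law mF A.
Proof. exact: measure_ge0. Qed.

Let law_sigma_additive : semi_sigma_additive (law mF).
Proof.
have mpre B : measurable B -> measurable (F @^-1` B).
  by move=> mB; rewrite -[X in measurable X]setTI; exact: mF.
move=> A mA tA mUA; rewrite /law preimage_bigcup.
apply: measure_semi_sigma_additive => //.
- by move=> n; exact: mpre.
- apply/trivIsetP => i j _ _ ij; rewrite -preimage_setI.
  by move/trivIsetP : tA => /(_ i j Logic.I Logic.I ij) ->; rewrite preimage_set0.
- by rewrite -preimage_bigcup; exact: mpre.
Qed.

HB.instance Definition _ := isMeasure.Build _ _ _ (law mF)
  law0 law_ge0 law_sigma_additive.

Lemma integral_law (f : S -> \bar R) : measurable_fun setT f ->
  (forall z, 0 <= f z) -> \int[law mF]_z f z = \int[P]_w f (F w).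
Proof.
move=> mf f0; pose pF := mfun_Sub (mem_set mF).
transitivity (\int[pushforward P pF]_z f z).
  exact: eq_measure_integral.
by rewrite ge0_integral_pushforward ?preimage_setT.
Qed.

End measure.

Section probability.
Variables (P : probability T R) (F : T -> S).
Hypothesis mF : measurable_fun setT F.

Let lawT : law P mF setT = 1.
Proof. by rewrite /law preimage_setT; exact: probability_setT. Qed.

HB.instance Definition _ := Measure_isProbability.Build _ _ _ (law P mF) lawT.

End probability.

End law.

Section law_pair.
Local Open Scope ereal_scope.
Context {R : realType} {d d1 d2} {T : measurableType d} {S1 : measurableType d1}
  {S2 : measurableType d2}.

(** Independence on rectangles identifies the joint law with the product measure, and Tonelli
    applies. *)
Lemma integral_law_pair (P : {measure set T -> \bar R})
    (m1 : {sigma_finite_measure set S1 -> \bar R})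
    (m2 : {sigma_finite_measure set S2 -> \bar R}) (F : T -> S1) (G : T -> S2) :
  measurable_fun setT F -> measurable_fun setT G ->
  (forall A B, measurable A -> measurable B ->
    P (F @^-1` A `&` G @^-1` B) = m1 A * m2 B) ->
  forall f : S1 * S2 -> \bar R, measurable_fun setT f -> (forall z, 0 <= f z) ->
  \int[P]_w f (F w, G w) = \int[m1]_x \int[m2]_y f (x, y).
Proof.
move=> mF mG PFG f mf f0.
have mFG : measurable_fun setT (fun w => (F w, G w)) by exact: measurable_fun_pair.
rewrite -(integral_law P mFG mf f0).
rewrite -fubini_tonelli1//; apply: eq_measure_integral => A mA _.
by apply/esym; apply: product_measure_unique => //.
Qed.

End law_pair.

(* The canonical measurable structures on [R] and [measurableTypeR R] have the
   same measurable sets but are not interchangeable for unification. *)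
Lemma measurable_idR (R : realType) : @measurable_fun _ _ (measurableTypeR R) R setT id.
Proof. by move=> _ A mA; rewrite setTI. Qed.

(** * Gaussian measures *)

Section lebesgue.
Context {R : realType}.

Definition leb_def : set R -> \bar R := law (@lebesgue_measure R) (@measurable_idR R).

HB.instance Definition _ := Measure.on leb_def.

Let leb_sigma_finite : sigma_finite setT leb_def.
Proof.
have [F TF mF] := @sigma_finiteT _ _ _ (@lebesgue_measure R).
by exists F.
Qed.

HB.instance Definition _ := Measure_isSigmaFinite.Build _ _ _ leb_def leb_sigma_finite.

End lebesgue.

HB.lock Definition leb (R : realType) : {sigma_finite_measure set R -> \bar R} := @leb_def R.

(** Parametrized by the variance, whereas [normal_prob] takes the standard deviation. *)
HB.lock Definition gN (R : realType) (s : R) : probability R R :=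
  law (normal_prob 0 (Num.sqrt s)) (@measurable_idR R).

Section gauss1.
Local Open Scope ereal_scope.
Context {R : realType}.
Local Notation leb := (leb R).

Lemma lebE A : leb A = lebesgue_measure A.
Proof. by rewrite unlock. Qed.

Lemma gNE (s : R) A : gN s A = normal_prob 0 (Num.sqrt s) A.
Proof. by rewrite unlock. Qed.

Lemma integral_leb (f : R -> \bar R) : measurable_fun setT f -> (forall x, 0 <= f x) ->
  \int[leb]_x f x = \int[lebesgue_measure]_x f x.
Proof.
move=> mf f0; rewrite unlock; exact: (integral_law _ (@measurable_idR R)).
Qed.

(** Lebesgue measure is characterized by its values on half-open intervals, and [a] times its image
    under x -> a x + b has the same values. *)
Lemma integral_affine (a b : R) (f : R -> \bar R) : (0 < a)%R ->
  measurable_fun setT f -> (forall x, 0 <= f x) ->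
  \int[leb]_x f x = a%:E * \int[leb]_x f (a * x + b)%R.
Proof.
move=> a0 mf f0.
pose h : R -> R := fun x => (a * x + b)%R.
have mh : measurable_fun setT h.
  by apply: measurable_funD => //; apply: measurable_funM.
have mh' : @measurable_fun _ _ R (measurableTypeR R) setT h by exact: mh.
pose an : {nonneg R} := NngNum (ltW a0).
have hE (A : set R) : measurable A -> mscale an (law leb mh') A = leb A.
  move=> mA; apply/esym; apply: (etrans (lebE _)).
  apply: (lebesgue_measure_unique (mu := mscale an (law leb mh'))) => //= _ [[u v]] _ <-.
  rewrite /mscale /= /law lebE /=.
  have -> : h @^-1` `]u, v] = `]((u - b) / a)%R, ((v - b) / a)%R]%classic.
    apply/seteqP; split => x /=; rewrite !in_itv/= ltr_pdivrMr// ler_pdivlMr// /h;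
    by rewrite ltrBlDr lerBrDr [(x * a)%R]mulrC.
  rewrite !lebesgue_measure_itv/= !lte_fin ltr_pM2r ?invr_gt0// ltrD2r.
  case: ifPn => _; last by rewrite mule0.
  rewrite -EFinB -EFinM; congr EFin; field; exact: lt0r_neq0.
transitivity (\int[mscale an (law leb mh)]_x f x).
  by apply: eq_measure_integral => A mA _; exact/esym/hE.
rewrite (ge0_integral_mscale _ measurableT)// integral_law//.
Qed.

Definition gpdf (s x : R) : R := normal_peak (Num.sqrt s) * expR (- (x ^+ 2) / (s *+ 2)).

Lemma gpdfE s : (0 < s)%R -> normal_pdf 0 (Num.sqrt s) = gpdf s.
Proof.
move=> s0; have ss : (Num.sqrt s != 0)%R by rewrite gt_eqF// sqrtr_gt0.
apply/funext => x; rewrite normal_pdfE// /normal_fun subr0 sqr_sqrtr//.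
exact: ltW.
Qed.

Lemma gpdf_ge0 s x : (0 <= gpdf s x)%R.
Proof. by rewrite mulr_ge0 ?normal_peak_ge0 ?expR_ge0. Qed.

Lemma measurable_gpdf s : measurable_fun setT (gpdf s).
Proof.
apply: measurable_funM => //; apply: measurableT_comp => //.
apply: measurable_funM => //; apply: measurable_funN.
exact: measurable_funX.
Qed.

Lemma integral_gN s (f : R -> \bar R) : (0 < s)%R ->
  measurable_fun setT f -> (forall x, 0 <= f x) ->
  \int[gN s]_x f x = \int[leb]_x (f x * (gpdf s x)%:E).
Proof.
move=> s0 mf f0.
rewrite -(integral_mdens _ (measurable_gpdf s) (gpdf_ge0 s) mf f0).
apply: eq_measure_integral => A mA _.
apply: (etrans (gNE _ _)).
rewrite /normal_prob gpdfE// /= /mdens [LHS]integral_mkcond [RHS]integral_mkcond.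
rewrite [RHS]integral_leb//; last by move=> z; apply: erestrict_ge0 => x _; rewrite /= lee_fin gpdf_ge0.
apply/(measurable_restrictT _ mA).
by apply: measurable_funTS; apply/measurable_EFinP; exact: measurable_gpdf.
Qed.

(** One-dimensional Cameron-Martin formula: after a translation of Lebesgue measure, the exponential
    is the ratio of the two Gaussian densities. *)
Lemma gN_shift s v (f : R -> \bar R) : (0 < s)%R ->
  measurable_fun setT f -> (forall x, 0 <= f x) ->
  \int[gN s]_x f (x + v)%R =
  \int[gN s]_x (f x * (expR (x * v / s - v ^+ 2 / (s *+ 2)))%:E).
Proof.
move=> s0 mf f0.
have mfv : measurable_fun setT (fun x : R => f (x + v)%R).
  by apply: measurableT_comp => //; apply: measurable_funD.
have me : measurable_fun setT (fun x : R => (expR (x * v / s - v ^+ 2 / (s *+ 2)))%:E).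
  apply/measurable_EFinP; apply: measurableT_comp => //.
  by apply: measurable_funB => //; apply: measurable_funM => //; apply: measurable_funM.
rewrite (integral_gN s0 mfv) // integral_gN//; last 2 first.
- exact: emeasurable_funM.
- by move=> x; rewrite mule_ge0// lee_fin expR_ge0.
rewrite [RHS](integral_affine v ltr01).
- rewrite mul1e; apply: eq_integral => x _; rewrite mul1r -muleA -EFinM; congr (_ * _%:E).
  rewrite /gpdf mulrCA -expRD; congr (_ * expR _)%R.
  field; exact: lt0r_neq0.
- apply: emeasurable_funM; first exact: emeasurable_funM.
  by apply/measurable_EFinP; exact: measurable_gpdf.
- move=> x; rewrite mule_ge0// ?lee_fin ?gpdf_ge0// mule_ge0// lee_fin expR_ge0//.
Qed.

Lemma gN_scale s (a : R) (f : R -> \bar R) : (0 < s)%R -> (0 < a)%R ->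
  measurable_fun setT f -> (forall x, 0 <= f x) ->
  \int[gN s]_x f (a * x)%R = \int[gN (a ^+ 2 * s)]_x f x.
Proof.
move=> s0 a0 mf f0.
have as0 : (0 < a ^+ 2 * s)%R by rewrite mulr_gt0// exprn_gt0.
have mfa : measurable_fun setT (fun x : R => f (a * x)%R).
  by apply: measurableT_comp => //; apply: measurable_funM.
rewrite [LHS](integral_gN s0 mfa) // [RHS](integral_gN as0 mf f0).
rewrite [RHS](integral_affine 0 a0); last 2 first.
- by apply: emeasurable_funM => //; apply/measurable_EFinP; exact: measurable_gpdf.
- by move=> x; rewrite mule_ge0// lee_fin gpdf_ge0.
rewrite -ge0_integralZl_EFin//; last 3 first.
- by move=> x _; rewrite mule_ge0// lee_fin gpdf_ge0.
- under eq_fun do rewrite addr0.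
  apply: emeasurable_funM; first by apply: measurableT_comp => //; apply: measurable_funM.
  by apply/measurable_EFinP; apply: measurableT_comp; [exact: measurable_gpdf|apply: measurable_funM].
- exact: ltW.
apply: eq_integral => x _; rewrite addr0 muleCA -EFinM; congr (_ * _%:E).
rewrite /gpdf mulrA; congr (_ * expR _)%R.
  rewrite /normal_peak !sqr_sqrtr; [|exact: ltW..].
  have -> : (a ^+ 2 * s * pi *+ 2 = a ^+ 2 * (s * pi *+ 2))%R by ring.
  rewrite sqrtrM ?sqr_ge0// sqrtr_sqr gtr0_norm//.
  rewrite invfM mulrA divff ?mul1r// lt0r_neq0//.
by field; rewrite !lt0r_neq0.
Qed.

(** Gaussian regression: if independent centred variables of variances a and c have sum u, the first
    has conditional mean a u / (a + c) and conditional variance a c / (a + c); [x] is its deviation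
    from that mean. *)
Lemma gpdfM a c x u : (0 < a)%R -> (0 < c)%R ->
  (gpdf c (u - (x + a / (a + c) * u)) * gpdf a (x + a / (a + c) * u) =
   gpdf (a + c) u * gpdf (a * c / (a + c)) x)%R.
Proof.
move=> a0 c0; have ac0 : (0 < a + c)%R by rewrite addr_gt0.
have pE : (normal_peak (Num.sqrt c) * normal_peak (Num.sqrt a) =
    normal_peak (Num.sqrt (a + c)) * normal_peak (Num.sqrt (a * c / (a + c))) :> R)%R.
  have := ltW a0; have := ltW c0; have := ltW ac0 => ac0' c0' a0'.
  have e0 : (0 <= a * c / (a + c))%R by rewrite divr_ge0 ?mulr_ge0.
  rewrite /normal_peak !sqr_sqrtr// -!invfM -!sqrtrM; last 2 first.
  - by rewrite mulrn_wge0// mulr_ge0 ?pi_ge0 ?ltW.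
  - by rewrite mulrn_wge0// mulr_ge0 ?pi_ge0 ?ltW.
  by congr (Num.sqrt _)^-1%R; field; exact: lt0r_neq0.
rewrite /gpdf mulrACA [RHS]mulrACA -!expRD pE; congr (_ * expR _)%R.
by field; rewrite !lt0r_neq0.
Qed.

(** The combination c x - a y is uncorrelated with x + y, since c a - a c = 0, and k (c x - a y) has
    variance k^2 a c (a + c). The proof works on densities: substitute u = x + y, exchange the
    integrals, and centre x at its regression on u. *)
Lemma gN_rotation a c k (f g : R -> \bar R) : (0 < a)%R -> (0 < c)%R -> (0 < k)%R ->
  measurable_fun setT f -> (forall x, 0 <= f x) ->
  measurable_fun setT g -> (forall x, 0 <= g x) ->
  \int[gN a]_x \int[gN c]_y (f (x + y)%R * g (k * (c * x - a * y))%R) =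
  (\int[gN (a + c)]_x f x) * \int[gN (k ^+ 2 * (a * c * (a + c)))]_x g x.
Proof.
move=> a0 c0 k0 mf f0 mg g0; have ac0 : (0 < a + c)%R by rewrite addr_gt0.
pose e := (a * c / (a + c))%R.
have e0 : (0 < e)%R by rewrite divr_gt0// mulr_gt0.
have ka0 : (0 < k * (a + c))%R by rewrite mulr_gt0.
have mgp s : measurable_fun setT (fun x => (gpdf s x)%:E).
  by apply/measurable_EFinP; exact: measurable_gpdf.
have fg0 (h : R -> \bar R) s : (forall x, 0 <= h x) -> forall x, 0 <= h x * (gpdf s x)%:E.
  by move=> h0 x; rewrite mule_ge0// lee_fin gpdf_ge0.
have mxy : measurable_fun setT (fun z : R * R => z.1 + z.2)%R by exact: measurable_funD.
have mcxy : measurable_fun setT (fun z : R * R => k * (c * z.1 - a * z.2))%R.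
  by apply: measurable_funM => //; apply: measurable_funB; apply: measurable_funM.
have mF : measurable_fun setT
    (fun z : R * R => f (z.1 + z.2)%R * g (k * (c * z.1 - a * z.2))%R).
  by apply: emeasurable_funM; apply: measurableT_comp.
have F0 x y : 0 <= f (x + y)%R * g (k * (c * x - a * y))%R by rewrite mule_ge0.
have mFx x : measurable_fun setT
    (fun y : R => f (x + y)%R * g (k * (c * x - a * y))%R).
  exact: (measurableT_comp mF (measurable_fun_pair (measurable_cst x) (@measurable_id _ _ _))).
rewrite [LHS]integral_gN//; last 2 first.
- have := @measurable_fun_fubini_tonelli_F _ _ _ _ _ (gN c) _ mF.
  by apply; case.
- by move=> x; exact: integral_ge0.
pose H x u := f u * g (k * ((a + c) * x - a * u))%R * (gpdf c (u - x))%:E * (gpdf a x)%:E.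
have mH : measurable_fun setT (fun z : R * R => H z.1 z.2).
  apply: emeasurable_funM; last exact: (measurableT_comp (mgp a)).
  apply: emeasurable_funM; last first.
    by apply: (measurableT_comp (mgp c)); exact: measurable_funB.
  apply: emeasurable_funM; first exact: measurableT_comp.
  apply: measurableT_comp => //; apply: measurable_funM => //.
  by apply: measurable_funB; apply: measurable_funM.
have H0 x u : 0 <= H x u.
  by rewrite /H !mule_ge0// lee_fin gpdf_ge0.
have mHx x : measurable_fun setT (H x).
  exact: (measurableT_comp mH (measurable_fun_pair (measurable_cst x) (@measurable_id _ _ _))).
transitivity (\int[leb]_x \int[leb]_u H x u).
  apply: eq_integral => x _; rewrite (integral_gN c0 (mFx x))//.
  transitivity (\int[leb]_y (f (x + y)%R * g (k * (c * x - a * y))%R *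
      (gpdf c y)%:E * (gpdf a x)%:E)).
    apply/esym/ge0_integralZr.
    - exact: measurableT.
    - exact: (emeasurable_funM (mFx x) (mgp c)).
    - by move=> y _; exact: (fg0 (fun y => f (x + y)%R * g (k * (c * x - a * y))%R) c (F0 x)).
    - by rewrite lee_fin gpdf_ge0.
  rewrite [RHS](integral_affine x ltr01 (mHx x) (H0 x)) mul1e.
  apply: eq_integral => y _; rewrite /H mul1r addrK [(y + x)%R]addrC.
  by congr (_ * g _ * _ * _); ring.
have HE : \int[leb]_x \int[leb]_u H x u = \int[leb]_u \int[leb]_x H x u.
  by apply: (@fubini_tonelli _ _ _ _ _ leb leb _ mH); case.
rewrite HE.
transitivity (\int[leb]_u (f u * (gpdf (a + c) u)%:E *
    \int[gN (k ^+ 2 * (a * c * (a + c)))]_x g x)); last first.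
  rewrite [in RHS](integral_gN ac0 mf f0).
  apply: ge0_integralZr.
  - exact: measurableT.
  - exact: (emeasurable_funM mf (mgp _)).
  - by move=> x _; exact: fg0.
  - exact: integral_ge0.
apply: eq_integral => u _.
(* Given u, the combination k (c x - a y) is k (a + c) times the regression residual, whose variance
   is [e]. *)
have -> : (k ^+ 2 * (a * c * (a + c)) = (k * (a + c)) ^+ 2 * e)%R.
  by rewrite /e; field; exact: lt0r_neq0.
rewrite -(gN_scale e0 ka0 mg g0).
have mgk : measurable_fun setT (fun x : R => g (k * (a + c) * x)%R).
  by apply: measurableT_comp => //; apply: measurable_funM.
rewrite [in RHS](integral_gN e0 mgk (fun x => g0 _)).
transitivity (\int[leb]_x (f u * (gpdf (a + c) u)%:E *
    (g (k * (a + c) * x)%R * (gpdf e x)%:E))); last first.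
  apply: ge0_integralZl.
  - exact: measurableT.
  - exact: (emeasurable_funM mgk (mgp e)).
  - by move=> x _; exact: (fg0 (fun x => g (k * (a + c) * x)%R)).
  - exact: fg0.
have mHu : measurable_fun setT (fun x => H x u).
  exact: (measurableT_comp mH (measurable_fun_pair (@measurable_id _ _ _) (measurable_cst u))).
rewrite [LHS](integral_affine (a / (a + c) * u) ltr01 mHu (H0^~ u)) mul1e.
apply: eq_integral => x _; rewrite mul1r.
have E1 : (gpdf c (u - (x + a / (a + c) * u)) * gpdf a (x + a / (a + c) * u) =
    gpdf (a + c) u * gpdf e x)%R by exact: gpdfM.
have E2 : (k * ((a + c) * (x + a / (a + c) * u) - a * u) = k * (a + c) * x)%R.
  by field; exact: lt0r_neq0.
rewrite /H E2 -[LHS]muleA -EFinM E1 EFinM; exact: muleACA.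
Qed.

End gauss1.

Lemma measurable_preimage {d1 d2} {T : measurableType d1} {S : measurableType d2}
    (F : T -> S) (A : set S) :
  measurable_fun setT F -> measurable A -> measurable (F @^-1` A).
Proof. by move=> mF mA; rewrite -[X in measurable X]setTI; exact: mF. Qed.

(** * Independence extended from pi-systems *)

Section independence.
Local Open Scope ereal_scope.
Context {R : realType} {disp} {T : measurableType disp}.
Variable P : probability T R.

(** With [E] fixed, both sides are finite measures in [A]: the law of [F] under [P] restricted to
    [E], and the law of [F] scaled by [P E]. *)
Lemma indep_pi {d1} {S1 : measurableType d1} (G : set (set S1)) (F : T -> S1) (E : set T) :
  measurable `<=` <<s G >> -> G `<=` measurable -> setI_closed G -> G setT ->
  measurable_fun setT F -> measurable E ->
  (forall A, G A -> P (F @^-1` A `&` E) = P (F @^-1` A) * P E) ->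
  forall A, measurable A -> P (F @^-1` A `&` E) = P (F @^-1` A) * P E.
Proof.
move=> sG Gm GI GT mF mE PG A mA.
have PEf : P E \is a fin_num by exact: fin_num_measure.
pose c : {nonneg R} := NngNum (fine_ge0 (measure_ge0 P E)).
have cE : c%:num%:E = P E by rewrite fineK.
rewrite muleC -cE.
apply: (@measure_eq_pi _ _ _ G (law (mrestr P mE) mF) (mscale c (law P mF))) => //.
- by rewrite /law /= /mrestr preimage_setT setTI (le_lt_trans (probability_le1 P mE)) ?ltry.
- by move=> B GB; have := PG B GB; rewrite muleC -cE.
Qed.

End independence.

Section independent_family.
Local Open Scope ereal_scope.
Context {R : realType} {disp} {T : measurableType disp} {dS} {S : measurableType dS}.
Variables (P : probability T R) (n : nat) (h : 'I_n -> T -> S).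
Variable rho : 'I_n -> {measure set S -> \bar R}.
Hypothesis mh : forall i, measurable_fun setT (h i).
Hypothesis rho1 : forall i, rho i setT = 1.

Let mcap (Q : pred 'I_n) B : (forall i, measurable (B i)) ->
  measurable [set w | forall i, Q i -> B i (h i w)].
Proof.
move=> mB; rewrite (_ : [set w | _] = \bigcap_(i in [set i | Q i]) (h i @^-1` B i)).
  by apply: fin_bigcap_measurable => // i _; exact: measurable_preimage.
by apply/seteqP; split => w /= H i; exact: H.
Qed.

Let rho_fin i B : measurable B -> rho i B \is a fin_num.
Proof.
move=> mB; rewrite ge0_fin_numE// (@le_lt_trans _ _ 1) ?ltry// -(rho1 i).
by apply: le_measure => //; rewrite inE.
Qed.

Lemma independent_family_pi (G : set (set S)) :
  measurable `<=` <<s G >> -> G `<=` measurable -> setI_closed G -> G setT ->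
  (forall B, (forall i, G (B i)) ->
    P [set w | forall i, B i (h i w)] = \prod_(i < n) rho i (B i)) ->
  forall B, (forall i, measurable (B i)) ->
    P [set w | forall i, B i (h i w)] = \prod_(i < n) rho i (B i).
Proof.
move=> sG Gm GI GT PG B mB.
(* Coordinates below [k] already carry arbitrary measurable sets, the others sets of [G]; one
   coordinate is released at a time, the product of the other factors being a finite constant. *)
suff H k : (k <= n)%N -> forall B, (forall i, measurable (B i)) ->
    (forall i : 'I_n, (k <= i)%N -> G (B i)) ->
    P [set w | forall i, B i (h i w)] = \prod_(i < n) rho i (B i).
  by apply: (H n) => // i; rewrite leqNgt ltn_ord.
elim: k => [_ C mC GC|k ih kn C mC GC]; first by apply: PG => i; exact: GC.
pose j := Ordinal kn.
have mD := mcap (fun i => i != j) mC.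
pose D := [set w | forall i, i != j -> C i (h i w)].
pose c := \prod_(i < n | i != j) rho i (C i).
have cf : c \is a fin_num.
  by apply: (big_ind (fun x => x \is a fin_num)) => // [x y|i _]; [exact: fin_numM|exact: rho_fin].
have c0 : (0 <= fine c)%R.
  by apply: fine_ge0; apply: prode_ge0 => i _; exact: measure_ge0.
pose cn : {nonneg R} := NngNum c0.
pose Cj A := fun i => if i == j then A else C i.
have CjE A : [set w | forall i, Cj A i (h i w)] = h j @^-1` A `&` D.
  apply/seteqP; split => w /=.
    move=> H; split; first by have := H j; rewrite /Cj eqxx.
    by move=> i ij; have := H i; rewrite /Cj (negbTE ij).
  by move=> [Aj Dw] i; rewrite /Cj; case: (eqVneq i j) => [->//|/Dw].
have prodE A : \prod_(i < n) rho i (Cj A i) = rho j A * c.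
  rewrite (bigD1 j)//= /Cj eqxx; congr (_ * _).
  by apply: eq_bigr => i /negbTE ->.
have -> : C = Cj (C j) by apply/funext => i; rewrite /Cj; case: eqP => // ->.
rewrite CjE prodE muleC -[X in X * _]fineK//.
apply: (@measure_eq_pi _ _ _ G (law (mrestr P mD) (mh j)) (mscale cn (rho j))) => //.
- by rewrite /law /= /mrestr preimage_setT setTI (le_lt_trans (probability_le1 P mD)) ?ltry.
- move=> A GA; rewrite /law /= /mrestr -/D /mscale /= fineK// -CjE muleC -prodE.
  apply: ih; first exact: ltnW.
    by move=> i; rewrite /Cj; case: ifP => // _; exact: Gm.
  move=> i ki; rewrite /Cj; case: eqP => // /eqP ij; apply: GC.
  by rewrite ltn_neqAle ki andbT; apply: contra ij => /eqP kE; apply/eqP/val_inj.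
Qed.

Lemma independent_family_integral (f : 'I_n -> S -> R) :
  (forall B, (forall i, measurable (B i)) ->
    P [set w | forall i, B i (h i w)] = \prod_(i < n) rho i (B i)) ->
  (forall i, measurable_fun setT (f i)) -> (forall i x, (0 <= f i x)%R) ->
  (forall i, \int[rho i]_x (f i x)%:E < +oo) ->
  \int[P]_w (\prod_(i < n) f i (h i w))%R%:E = \prod_(i < n) \int[rho i]_x (f i x)%:E.
Proof.
move=> PB mf f0 foo.
(* The same release of coordinates, now from indicators to general functions: the other factors form
   a density [g], and the induction hypothesis identifies the resulting law of coordinate [j]. *)
suff H k : (k <= n)%N -> forall f : 'I_n -> S -> R, (forall i, measurable_fun setT (f i)) ->
  (forall i x, (0 <= f i x)%R) -> (forall i, \int[rho i]_x (f i x)%:E < +oo) ->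
  (forall i : 'I_n, (k <= i)%N -> exists2 B : set S, measurable B & f i = \1_B) ->
  \int[P]_w (\prod_(i < n) f i (h i w))%R%:E = \prod_(i < n) \int[rho i]_x (f i x)%:E.
  by apply: (H n) => // i; rewrite leqNgt ltn_ord.
elim: k {f mf f0 foo} => [_ f mf f0 foo fB|k ih kn f mf f0 foo fB].
  have /choice[B HB] : forall i, exists B : set S, measurable B /\ f i = \1_B.
    by move=> i; have [//|B mB fi] := fB i; exists B.
  have mB i : measurable (B i) by have [] := HB i.
  have fE i : f i = \1_(B i) by have [] := HB i.
  have PE : P [set w | forall i, B i (h i w)] = \int[P]_w (\prod_(i < n) f i (h i w))%R%:E.
    have mE : measurable [set w | forall i, B i (h i w)].
      have := mcap xpredT mB; congr measurable.
      by apply/seteqP; split => w /= H i; [exact: H|move=> _; exact: H].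
    rewrite -[X in P X]setIT -integral_indic//; apply: eq_integral => w _; congr EFin.
    rewrite indicE; case: (boolP (w \in _)) => [/set_mem /= H|/negP H].
      by rewrite big1// => i _; rewrite fE indicE mem_set.
    have [i Hi] : exists i, ~ B i (h i w).
      by apply/existsNP => H'; apply: H; exact/mem_set.
    by rewrite (bigD1 i)//= fE indicE memNset// mul0r.
  rewrite -PE PB//; apply: eq_bigr => i _.
  by rewrite fE integral_indic// setIT.
pose j := Ordinal kn.
pose g w := (\prod_(i < n | i != j) f i (h i w))%R.
have mg : measurable_fun setT g.
  rewrite /g; under eq_fun do rewrite big_mkcond.
  apply: measurable_prod => i _; case: (i != j) => //.
  exact: measurableT_comp.
have g0 w : (0 <= g w)%R by apply: prodr_ge0 => i _; exact: f0.
pose c := \prod_(i < n | i != j) \int[rho i]_x (f i x)%:E.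
have cf : c \is a fin_num.
  apply: (big_ind (fun x => x \is a fin_num)) => // [x y|i _]; first exact: fin_numM.
  by rewrite ge0_fin_numE//; apply: integral_ge0 => x _; rewrite lee_fin.
have c0 : (0 <= fine c)%R.
  apply: fine_ge0; apply: prode_ge0 => i _.
  by apply: integral_ge0 => x _; rewrite lee_fin.
pose cn : {nonneg R} := NngNum c0.
pose F (A : set S) := fun i => if i == j then \1_A else f i.
have prodE A w : (\prod_(i < n) F A i (h i w) = \1_A (h j w) * g w)%R.
  rewrite (bigD1 j)//= /F eqxx; congr (_ * _)%R.
  by apply: eq_bigr => i /negbTE ->.
have prodE' A : measurable A ->
    \prod_(i < n) \int[rho i]_x (F A i x)%:E = rho j A * c.
  move=> mA; rewrite (bigD1 j)//= /F eqxx integral_indic// setIT; congr (_ * _).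
  by apply: eq_bigr => i /negbTE ->.
have mE A : measurable A -> law (mdens P mg g0) (mh j) A = mscale cn (rho j) A.
  move=> mA; rewrite /law /= /mdens integral_mkcond /mscale /= fineK// muleC -prodE'//.
  rewrite -ih.
  - apply: eq_integral => w _; rewrite prodE patchE.
    have -> : (w \in h j @^-1` A) = (h j w \in A) by apply/idP/idP => /set_mem H; exact/mem_set.
    by rewrite indicE; case: ifP => _; rewrite ?mul1r ?mul0r.
  - exact: ltnW.
  - by move=> i; rewrite /F; case: ifP => // _; exact: measurable_indic.
  - by move=> i x; rewrite /F; case: ifP => // _; rewrite indicE.
  - move=> i; rewrite /F; case: ifP => // _; rewrite integral_indic// setIT.
    by rewrite -ge0_fin_numE// rho_fin.
  - move=> i ki; rewrite /F; case: eqP => [_|/eqP ij]; first by exists A.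
    apply: fB; rewrite ltn_neqAle ki andbT.
    by apply: contra ij => /eqP kE; apply/eqP/val_inj.
transitivity (\int[law (mdens P mg g0) (mh j)]_x (f j x)%:E).
  rewrite integral_law//; last 2 first.
  - exact/measurable_EFinP.
  - by move=> x; rewrite lee_fin.
  rewrite integral_mdens//; last 2 first.
  - by apply/measurable_EFinP; exact: measurableT_comp.
  - by move=> x; rewrite lee_fin.
  apply: eq_integral => w _; rewrite -EFinM; congr EFin.
  by rewrite (bigD1 j).
transitivity (\int[mscale cn (rho j)]_x (f j x)%:E).
  by apply: eq_measure_integral => A mA _; exact: mE.
rewrite ge0_integral_mscale//; last 2 first.
- exact/measurable_EFinP.
- by move=> x _; rewrite lee_fin.
by rewrite /= fineK// muleC (bigD1 j).
Qed.

End independent_family.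

Definition dot {R : realType} {d} (u v : 'rV[R]_d) : R :=
  \sum_(i < d) u ord0 i * v ord0 i.

Section dot_theory.
Context {R : realType} {d : nat}.
Implicit Types u v w : 'rV[R]_d.

Lemma dotC u v : dot u v = dot v u.
Proof. by apply: eq_bigr => i _; rewrite mulrC. Qed.

Lemma dotDl u v w : dot (u + v) w = dot u w + dot v w.
Proof. by rewrite -big_split; apply: eq_bigr => i _; rewrite mxE mulrDl. Qed.

Lemma dotZl a u v : dot (a *: u) v = a * dot u v.
Proof. by rewrite mulr_sumr; apply: eq_bigr => i _; rewrite mxE mulrA. Qed.

Lemma dotNl u v : dot (- u) v = - dot u v.
Proof. by rewrite -scaleN1r dotZl mulN1r. Qed.

Lemma dotBl u v w : dot (u - v) w = dot u w - dot v w.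
Proof. by rewrite dotDl dotNl. Qed.

Lemma dot0l u : dot 0 u = 0.
Proof. by rewrite -(scale0r 0) dotZl mul0r. Qed.

Lemma dot_ge0 u : 0 <= dot u u.
Proof. by apply: sumr_ge0 => i _; rewrite -expr2 sqr_ge0. Qed.

Lemma measurable_dot {disp} {T : measurableType disp} (f g : T -> 'rV[R]_d) :
  measurable_fun setT f -> measurable_fun setT g ->
  measurable_fun setT (fun x => dot (f x) (g x)).
Proof.
move=> mf mg; apply: measurable_sum => i.
by apply: measurable_funM; exact: measurable_coordT.
Qed.

End dot_theory.

(** * Gaussian vectors: shift and rotation *)

Section gauss_vector.
Local Open Scope ereal_scope.
Context {R : realType} {d : nat}.
Local Notation V := 'rV[R]_d.

Definition gaussian (s : R) (G : {measure set V -> \bar R}) :=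
  forall B : 'I_d -> set R, (forall i, measurable (B i)) ->
    G (box B) = \prod_(i < d) gN s (B i).

(** On boxes both measures factor over the coordinates, where [gN_shift] applies with the shifts
    [t i]. *)
Lemma gaussian_shift (s : R) (G : probability V R) (v : V) (f : V -> \bar R) :
  (0 < s)%R -> gaussian s G -> measurable_fun setT f -> (forall z, 0 <= f z) ->
  \int[G]_z f (z + s *: v)%R =
  \int[G]_z (f z * (expR (dot z v - s * dot v v / 2))%:E).
Proof.
move=> s0 gG mf f0.
pose e z := expR (dot z v - s * dot v v / 2).
have me : measurable_fun setT e.
  apply: measurableT_comp => //; apply: measurable_funB => //.
  exact: measurable_dot.
have e0 z : (0 <= e z)%R by exact: expR_ge0.
pose sh z : V := (z + s *: v)%R.
have msh : measurable_fun setT sh by exact: measurable_rVD.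
transitivity (\int[law G msh]_z f z); first by rewrite integral_law.
transitivity (\int[mdens G me e0]_z f z); last by rewrite integral_mdens.
apply: eq_measure_integral => A mA _.
apply: measure_eq_box => //.
  by rewrite /law /= preimage_setT (le_lt_trans (probability_le1 G _)) ?ltry.
move=> B mB.
pose t i := (s * v ord0 i)%R.
pose f1 i x : R := (\1_(B i) x * expR (x * t i / s - t i ^+ 2 / (s *+ 2)))%R.
have mf1 i : measurable_fun setT (f1 i).
  apply: measurable_funM; first exact: measurable_indic.
  apply: measurableT_comp => //; apply: measurable_funB => //.
  by apply: measurable_funM => //; apply: measurable_funM.
have f10 i x : (0 <= f1 i x)%R by rewrite mulr_ge0 ?expR_ge0// indicE.
have mBt i : measurable ((fun x => x + t i)%R @^-1` B i).
  by apply: measurable_preimage => //; exact: measurable_funD.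
have f1E i : \int[gN s]_x (f1 i x)%:E = gN s ((fun x => x + t i)%R @^-1` B i).
  under eq_integral do rewrite EFinM.
  rewrite -(gN_shift (t i) s0 (f := fun x => (\1_(B i) x)%:E)).
  - by rewrite -[in RHS](setIT (_ @^-1` _)) -integral_indic.
  - by apply/measurable_EFinP; exact: measurable_indic.
  - by move=> x; rewrite lee_fin indicE.
transitivity (\prod_(i < d) \int[gN s]_x (f1 i x)%:E).
  rewrite (eq_bigr _ (fun i _ => f1E i)) -gG//; congr (G _).
  apply/seteqP; split => z /= H i; have := H i; rewrite /sh !mxE //.
rewrite -(independent_family_integral (P := G) (h := fun i z => z ord0 i))//.
- rewrite /= /mdens integral_mkcond; apply: eq_integral => z _.
  rewrite patchE; case: ifPn => [/set_mem H|H].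
    congr EFin; rewrite /e mulr_sumr mulr_suml -sumrB expR_sum.
    apply: eq_bigr => i _; rewrite /f1 indicE mem_set// mul1r; congr expR.
    by rewrite /t; field; exact: lt0r_neq0.
  have [i Hi] : exists i, ~ B i (z ord0 i).
    by apply/existsNP => H'; move/negP : H; apply; exact/mem_set.
  by rewrite (bigD1 i)//= /f1 indicE memNset// !mul0r.
- by move=> i; exact: measurable_coord.
- by move=> i; exact: probability_setT.
- by move=> i; rewrite f1E (le_lt_trans (probability_le1 _ (mBt i))) ?ltry.
Qed.

End gauss_vector.

Section gauss_rotation.
Local Open Scope ereal_scope.
Context {R : realType} {d : nat} {disp} {T : measurableType disp}.
Local Notation V := 'rV[R]_d.
Variables (P : probability T R) (D F : T -> V) (a c k : R).
Hypotheses (a0 : (0 < a)%R) (c0 : (0 < c)%R) (k0 : (0 < k)%R).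
Hypotheses (mD : measurable_fun setT D) (mF : measurable_fun setT F).
Hypotheses (gD : gaussian a (law P mD)) (gF : gaussian c (law P mF)).
Hypothesis DF : forall A C : set V, measurable A -> measurable C ->
  P (D @^-1` A `&` F @^-1` C) = P (D @^-1` A) * P (F @^-1` C).

Let S w : V := (D w + F w)%R.
Let I w : V := (k *: (c *: D w - a *: F w))%R.
Let e := (k ^+ 2 * (a * c * (a + c)))%R.

Let mS : measurable_fun setT S. Proof. exact: measurable_rVD. Qed.

Let mI : measurable_fun setT I.
Proof.
by apply: measurable_rVZ => //; apply: measurable_rVB; exact: measurable_rVZ.
Qed.

Let rho := (gN a \x gN c)%E : {measure set (R * R) -> \bar R}.

Let rhoE A C : measurable A -> measurable C ->
  rho ((fun z : R * R => z.1 + z.2)%R @^-1` A `&`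
     (fun z : R * R => k * (c * z.1 - a * z.2))%R @^-1` C) =
  gN (a + c) A * gN e C.
Proof.
move=> mA mC; set Q := (X in rho X).
have mQ : measurable Q.
  apply: measurableI.
    by apply: measurable_preimage => //; exact: measurable_funD.
  apply: measurable_preimage => //; apply: measurable_funM => //.
  by apply: measurable_funB; apply: measurable_funM.
rewrite -[in LHS](setIT Q) -[LHS]integral_indic//.
rewrite [LHS]fubini_tonelli1//; last first.
  by apply/measurable_EFinP; exact: measurable_indic.
rewrite -[in RHS](setIT A) -[in RHS](setIT C) -[X in X * _]integral_indic//.
rewrite -[X in _ * X]integral_indic//.
rewrite -[RHS](@gN_rotation _ a c k (EFin \o \1_A) (EFin \o \1_C) a0 c0 k0); last 4 first.
- by apply/measurable_EFinP; exact: measurable_indic.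
- by move=> x; rewrite lee_fin indicE.
- by apply/measurable_EFinP; exact: measurable_indic.
- by move=> x; rewrite lee_fin indicE.
apply: eq_integral => x _; apply: eq_integral => y _ /=.
by rewrite -EFinM /Q indicI /= !indicE.
Qed.

(** The pairs [h i] formed by the i-th coordinates of [D] and [F] are independent over i, each with
    the product law [rho]; inside a pair the rotation is the one-dimensional one. *)
Let rotation_box A C : (forall i, measurable (A i)) -> (forall i, measurable (C i)) ->
  P (S @^-1` box A `&` I @^-1` box C) =
  (\prod_(i < d) gN (a + c) (A i)) * \prod_(i < d) gN e (C i).
Proof.
move=> mA mC; rewrite -big_split /=.
rewrite (eq_bigr _ (fun i _ => esym (rhoE (mA i) (mC i)))).
pose h (i : 'I_d) w : R * R := (D w ord0 i, F w ord0 i).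
have mh i : measurable_fun setT (h i).
  by apply: measurable_fun_pair; exact: measurable_coordT.
have rho1 : forall i : 'I_d, rho setT = 1.
  move=> i; rewrite -setXTT.
  by apply: (etrans (product_measure1E _ _ measurableT measurableT));
    rewrite -[RHS]mule1; congr (_ * _); exact: probability_setT.
rewrite -(independent_family_pi (P := P) (h := h) (rho := fun=> rho) mh rho1
  (G := [set X `*` Y | X in measurable & Y in measurable]))//.
- congr (P _); apply/seteqP; split => w /=.
    move=> [HA HC] i; split; first by have := HA i; rewrite /S mxE.
    by have := HC i; rewrite /I !mxE.
  move=> H; split => i; have [H1 H2] := H i; first by rewrite /S mxE.
  by rewrite /I !mxE.
- by rewrite measurable_prod_measurableType.
- by move=> _ [X mX [Y mY <-]]; exact: measurableX.
- move=> _ _ [X mX [Y mY <-]] [X' mX' [Y' mY' <-]].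
  exists (X `&` X'); first exact: measurableI.
  by exists (Y `&` Y'); [exact: measurableI|rewrite setXI].
- by exists setT => //; exists setT => //; rewrite setXTT.
- move=> B GB.
  have /choice[X HX] : forall i, exists X : set R * set R,
      [/\ measurable X.1, measurable X.2 & B i = X.1 `*` X.2].
    by move=> i; have [X mX [Y mY XY]] := GB i; exists (X, Y).
  have mX1 i : measurable (X i).1 by have [] := HX i.
  have mX2 i : measurable (X i).2 by have [] := HX i.
  transitivity (P (D @^-1` box (fun i => (X i).1) `&` F @^-1` box (fun i => (X i).2))).
    congr (P _); apply/seteqP; split => w /=.
      by move=> H; split => i; have := H i; have [_ _ ->] := HX i => -[].
    by move=> [H1 H2] i; have [_ _ ->] := HX i; split; [exact: H1|exact: H2].
  rewrite DF; [|exact: measurable_box..].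
  rewrite [X in X * _](gD mX1) [X in _ * X](gF mX2) -big_split.
  apply: eq_bigr => i _; have [m1 m2 ->] := HX i.
  exact/esym/product_measure1E.
- by move=> i; apply: measurableI; apply: measurable_preimage => //;
    [exact: measurable_funD|apply: measurable_funM => //;
     apply: measurable_funB; apply: measurable_funM].
Qed.

Lemma rotation_gaussian : gaussian e (law P mI).
Proof.
move=> C mC; have := rotation_box (fun=> measurableT) mC.
rewrite big1; last by move=> i _; exact: probability_setT.
rewrite mul1e => <-; congr (P _); apply/seteqP; split => w /=; last by case.
by move=> ?; split.
Qed.

Lemma rotation_indep A C : measurable A -> measurable C ->
  P (S @^-1` A `&` I @^-1` C) = P (S @^-1` A) * P (I @^-1` C).
Proof.
have gS B : (forall i, measurable (B i)) -> P (S @^-1` box B) = \prod_(i < d) gN (a + c) (B i).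
  move=> mB; have := rotation_box mB (fun=> measurableT).
  rewrite [X in _ * X]big1; last by move=> i _; exact: probability_setT.
  rewrite mule1 => <-; congr (P _); apply/seteqP; split => w /=; last by case.
  by move=> ?; split.
have [G1 G2 G3 G4] := @boxes_pi R d.
move=> mA mC.
apply: (indep_pi (G := boxes)) => //; first exact: measurable_preimage.
move=> _ [B mB <-]; rewrite setIC muleC; move: C mC.
apply: (indep_pi (G := boxes)) => //; first by apply: measurable_preimage => //; exact: measurable_box.
by move=> _ [C mC <-]; rewrite setIC rotation_box// gS// muleC; congr (_ * _); rewrite -rotation_gaussian.
Qed.

End gauss_rotation.

(** * Wiener measure *)

Section ae_measure.
Local Open Scope ereal_scope.
Context {R : realType} {disp} {T : measurableType disp}.
Variable mu : {measure set T -> \bar R}.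

Lemma ae_imp (A B : T -> Prop) : (forall w, A w -> B w) ->
  {ae mu, forall w, A w} -> {ae mu, forall w, B w}.
Proof. by move=> AB; apply: filterS. Qed.

Lemma ae_and (A B : T -> Prop) : {ae mu, forall w, A w} -> {ae mu, forall w, B w} ->
  {ae mu, forall w, A w /\ B w}.
Proof. by move=> hA hB; apply: filterS2 hA hB => w. Qed.

Lemma le_measure_ae (A B : set T) : measurable A -> measurable B ->
  {ae mu, forall w, A w -> B w} -> mu A <= mu B.
Proof.
move=> mA mB [N [mN N0 AB]].
rewrite (@le_trans _ _ (mu (B `|` N)))//.
  rewrite le_measure ?inE//; first exact: measurableU.
  move=> w Aw; have [Bw|Bw] := pselect (B w); first by left.
  by right; apply: AB => /= /(_ Aw).
by rewrite -[leRHS]adde0 -N0; exact: measureU2.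
Qed.

Lemma eq_measure_ae (A B : set T) : measurable A -> measurable B ->
  {ae mu, forall w, A w <-> B w} -> mu A = mu B.
Proof.
move=> mA mB AB; apply/eqP; rewrite eq_le; apply/andP; split.
  by apply: le_measure_ae => //; apply: filterS AB => w [].
by apply: le_measure_ae => //; apply: filterS AB => w [].
Qed.

End ae_measure.

Lemma measurable_set1_rV {R : realType} {d} (x : 'rV[R]_d) : measurable [set x].
Proof.
rewrite (_ : [set x] = box (fun i => [set x ord0 i])).
  by apply: measurable_box => i; exact: measurable_set1.
apply/seteqP; split => [_ -> i //|y yx]; apply/rowP => i; exact: yx.
Qed.

Section wiener.
Local Open Scope ereal_scope.
Context {R : realType} {d : nat}.
Local Notation V := 'rV[R]_d.

(** Brownian motion stripped of path continuity, with the independence of increments stated on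
    cylinder sets of paths. This much determines the law on the cylinder sigma-algebra and is easy
    to verify for the rescaled bridge. *)
Definition wiener {disp} {T : measurableType disp} (P : probability T R)
    (W : R -> T -> V) : Prop :=
  [/\ (forall t, (0 <= t)%R -> measurable_fun setT (W t)),
      {ae P, forall w, W 0%R w = 0%R},
      (forall s t : R, (0 <= s)%R -> (s < t)%R ->
        forall (A : set (paths d `[0%R, s])) (C : set V), measurable A -> measurable C ->
        P ([set w | A (W ^~ w)] `&` [set w | C (W t w - W s w)%R]) =
        P [set w | A (W ^~ w)] * P [set w | C (W t w - W s w)%R]) &
      forall s t : R, (0 <= s)%R -> (s < t)%R ->
        forall B : 'I_d -> set R, (forall i, measurable (B i)) ->
        P [set w | box B (W t w - W s w)%R] = \prod_(i < d) gN (t - s) (B i)].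

Lemma brownian_wiener {disp} {T : measurableType disp} (P : probability T R)
  (W : R -> T -> V) : brownian_motion P W -> wiener P W.
Proof.
move=> [mW W0 _ iW gW]; split => // [s t s0 st A C mA mC|s t s0 st B mB].
- apply: (iW s t s0 st); first by apply/sigma_processP; exists A.
  by apply/sigma_rvP; exists C.
- by rewrite gW//; apply: eq_bigr => i _; rewrite gNE.
Qed.

End wiener.

Section path_map.
Context {R : realType} {d : nat} {disp} {T : measurableType disp}.
Local Notation V := 'rV[R]_d.
Local Notation Om := (paths d (`[0%R, +oo[ : set R)).

Definition path_map (W : R -> T -> V) (w : T) : Om := W ^~ w.

Lemma measurable_path_map W : (forall t, 0 <= t -> measurable_fun setT (W t)) ->
  measurable_fun setT (path_map W).
Proof.
move=> mW; apply: measurable_paths => t; rewrite /= in_itv/= andbT => t0.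
exact: mW.
Qed.

Lemma wiener_law (P : probability T R) W (mW : measurable_fun setT (path_map W)) :
  wiener P W -> wiener (law P mW) (fun t (w : Om) => w t).
Proof.
move=> [mW' W0 iW gW]; split => //.
- by move=> t t0; apply: measurable_eval; rewrite /= in_itv/= t0.
- have [N [mN PN WN]] := W0.
  have m0 : measurable ((fun w : Om => w 0) @^-1` [set 0]).
    apply: measurable_preimage; last exact: measurable_set1_rV.
    by apply: measurable_eval; rewrite /= in_itv/= lexx.
  exists (~` ((fun w : Om => w 0) @^-1` [set 0])); split => //.
  + exact: measurableC.
  + apply/eqP; rewrite eq_le measure_ge0 andbT -PN.
    rewrite /law /= le_measure// ?inE//.
    by apply: (measurable_preimage mW); exact: measurableC.
Qed.

End path_map.

(** * Path laws are determined by their increments *)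

Section increments_unique.
Local Open Scope ereal_scope.
Context {R : realType} {d : nat}.
Local Notation V := 'rV[R]_d.
Local Notation Om := (paths d (`[0%R, +oo[ : set R)).
Variables (eta1 eta2 : {measure set Om -> \bar R}) (D : set R).
Variable kappa : R -> R -> set V -> \bar R.
Hypotheses (D0 : forall t, D t -> (0 <= t)%R) (eta12 : eta1 setT = eta2 setT).
Hypothesis eta1_fin : eta1 setT < +oo.
Hypotheses (ae1 : {ae eta1, forall w, w 0%R = 0%R}) (ae2 : {ae eta2, forall w, w 0%R = 0%R}).
Hypothesis step1 : forall s t, (0 <= s)%R -> (s < t)%R -> D t ->
  forall (A : set (paths d `[0%R, s])) (C : set V), measurable A -> measurable C ->
  eta1 ([set w : Om | A w] `&` [set w | C (w t - w s)%R]) =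
  eta1 [set w : Om | A w] * kappa s t C.
Hypothesis step2 : forall s t, (0 <= s)%R -> (s < t)%R -> D t ->
  forall (A : set (paths d `[0%R, s])) (C : set V), measurable A -> measurable C ->
  eta2 ([set w : Om | A w] `&` [set w | C (w t - w s)%R]) =
  eta2 [set w : Om | A w] * kappa s t C.

Let sub_id (E : set R) (E0 : forall t, E t -> (0 <= t)%R) :
  measurable_fun [set: Om] (fun w : Om => (w : paths d E)).
Proof.
by apply: measurable_paths_sub => t Et /=; rewrite in_itv/= andbT; exact: E0.
Qed.

Let grid (l : seq R) : set R := [set t | t \in l].

(** Induction on the last grid time: the past of the grid and the new increment factor in the same
    way under both measures, through the common kernel [kappa]. *)
Let grid_unique l : path <%R 0%R l -> (forall t, t \in l -> D t) ->
  forall A : set (paths d (grid (0%R :: l))), measurable A ->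
  eta1 [set w : Om | A w] = eta2 [set w : Om | A w].
Proof.
elim/last_ind: l => [_ _ A mA|l t ih].
  (* On the grid reduced to time 0 an event either contains or misses all paths that start at 0, so
     almost sure starting values decide its measure. *)
  pose C (B : set (R -> V)) := (forall w, w 0%R = 0%R -> B w) \/ (forall w, w 0%R = 0%R -> ~ B w).
  have : C [set w | A w].
    apply: (@paths_preimage R d (R -> V) (grid [:: 0%R]) (fun t w => w t) C _ _ A mA).
      split.
      - by right => w _ [].
      - move=> B [h|h]; first by right => w w0 [_]; apply; exact: h.
        by left => w w0; split => //; exact: h.
      - move=> F hF; have [[n hn]|h] := pselect (exists n, forall w, w 0%R = 0%R -> F n w).
          by left => w w0; exists n => //; exact: hn.
        right => w w0 [n _ Fn]; have [hn|hn] := hF n; last exact: (hn w).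
        by apply: h; exists n.
    move=> u B; rewrite /grid /= inE => /eqP -> mB.
    have [B0|B0] := pselect (B 0%R); first by left => w /= ->.
    by right => w /= ->.
  have mA' : measurable [set w : Om | A w].
    apply: (measurable_preimage (sub_id _)) => //.
    by move=> u; rewrite /grid /= inE => /eqP ->.
  case=> h.
    rewrite (@eq_measure_ae _ _ _ eta1 _ setT)//; last first.
      by apply: ae_imp ae1 => w /h.
    rewrite (@eq_measure_ae _ _ _ eta2 _ setT)//.
    by apply: ae_imp ae2 => w /h.
  rewrite (@eq_measure_ae _ _ _ eta1 _ set0)//; last first.
    by apply: ae_imp ae1 => w /h.
  rewrite (@eq_measure_ae _ _ _ eta2 _ set0) ?measure0//.
  by apply: ae_imp ae2 => w /h.
rewrite rcons_path => /andP[pl lt] lD A mA.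
set s := last 0%R l in lt.
have l0 u : u \in 0%R :: l -> (0 <= u <= s)%R.
  move=> ul; have sl : sorted <=%R (0%R :: l).
    by apply: (sub_path _ pl) => x y /ltW.
  have := sl => /(sorted_leq_nth le_trans le_refl 0%R) => hs.
  have iu : (index u (0%R :: l) < size (0%R :: l))%N by rewrite index_mem.
  apply/andP; split.
    have := hs 0%N (index u (0%R :: l)); rewrite !inE => /(_ isT iu isT).
    by rewrite nth_index.
  have := hs (index u (0%R :: l)) (size l); rewrite !inE => /(_ iu (leqnn _)).
  rewrite -ltnS => /(_ iu); rewrite nth_index//.
  by rewrite /s -nth_last /=; case: (l).
have s0 : (0 <= s)%R by have /andP[] := l0 0%R (mem_head _ _).
have Dt : D t by apply: lD; rewrite mem_rcons mem_head.
pose E := grid (0%R :: rcons l t).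
have EE u : E u -> (0 <= u)%R.
  rewrite /E /grid /= inE mem_rcons inE => /or3P[/eqP -> //|/eqP ->|ul].
    exact: (le_trans s0 (ltW lt)).
  by have /andP[] : (0 <= u <= s)%R by apply: l0; rewrite inE ul orbT.
pose E' := grid (0%R :: l).
have E'E : E' `<=` E.
  move=> u; rewrite /E' /E /grid /= !inE mem_rcons inE => /orP[->//|->].
  by rewrite !orbT.
have Es : E s.
  apply: E'E; rewrite /E' /grid /= /s; exact: mem_last.
have Et : E t by rewrite /E /grid /= inE mem_rcons mem_head orbT.
have mEE := sub_id EE.
have mI : measurable_fun [set: paths d E] (fun w : paths d E => (w t - w s)%R : V).
  by apply: measurable_rVB; exact: measurable_eval.
have mE' := measurable_paths_sub (d := d) E'E.
(* Past events together with events of the last increment; they generate because w t is the sum of w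
   t - w s and w s. *)
pose G := [set [set w : paths d E | A1 w] `&` [set w : paths d E | C (w t - w s)%R] |
  A1 in (measurable : set (set (paths d E'))) & C in (measurable : set (set V))].
apply: (@measure_eq_pi _ _ _ G (law eta1 mEE) (law eta2 mEE)) => //.
- move=> B mB; have mid : measurable_fun [set: g_sigma_algebraType G]
      (fun w => (w : paths d E)).
    have mEw u : E' u -> measurable_fun [set: g_sigma_algebraType G] (fun w => w u : V).
      move=> E'u _ C mC; rewrite setTI; apply: sub_sigma_algebra.
      exists [set w : paths d E' | C (w u)].
        by apply: (measurable_preimage (measurable_eval E'u)).
      by exists setT => //; apply/seteqP; split => w //= [].
    have mIw : measurable_fun [set: g_sigma_algebraType G] (fun w => w t - w s : V)%R.
      move=> _ C mC; rewrite setTI; apply: sub_sigma_algebra.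
      exists setT; first exact: measurableT.
      by exists C => //; apply/seteqP; split => w //= [].
    apply: measurable_paths => u; rewrite /E /grid /= inE mem_rcons inE.
    have [->|ut] := eqVneq u t; last first.
      rewrite /= => ul; apply: mEw; rewrite /E' /grid /= inE; case/orP: ul => ->//.
      by rewrite orbT.
    move=> _; rewrite (_ : (fun w => _) = (fun w => (w t - w s) + w s)%R); last first.
      by apply/funext => w; rewrite subrK.
    by apply: measurable_rVD => //; apply: mEw; exact: mem_last.
  by move: (mid measurableT B mB); rewrite setTI.
- move=> _ [A1 mA1 [C mC <-]]; apply: measurableI; last exact: measurable_preimage.
  exact: (measurable_preimage mE').
- move=> _ _ [A1 mA1 [C1 mC1 <-]] [A2 mA2 [C2 mC2 <-]].
  exists (A1 `&` A2); first exact: measurableI.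
  exists (C1 `&` C2); first exact: measurableI.
  by apply/seteqP; split => w /= [[] ? ? [] ? ?].
- exists setT; first exact: measurableT.
  by exists setT => //; apply/seteqP; split.
- move=> _ [A1 mA1 [C mC <-]].
  have mA1' : measurable ([set w | A1 w] : set (paths d `[0%R, s])).
    apply: (measurable_preimage (F := fun w : paths d `[0%R, s] => (w : paths d E'))) => //.
    by apply: measurable_paths_sub => u /l0; rewrite /= in_itv.
  rewrite /law /=; apply: (etrans (step1 s0 lt Dt mA1' mC)).
  apply/esym; apply: (etrans (step2 s0 lt Dt mA1' mC)); congr (_ * _).
  apply/esym/ih => // u ul; apply: lD; rewrite mem_rcons inE ul orbT//.
Qed.

(** Events depending on finitely many times form a generating pi-system: two increasing grids are
    merged by sorting their union. *)
Lemma increments_unique (A : set (paths d D)) : D 0%R -> measurable A ->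
  eta1 [set w : Om | A w] = eta2 [set w : Om | A w].
Proof.
move=> D00 mA.
pose G := [set B : set (paths d D) | exists l : seq R,
  [/\ path <%R 0%R l, (forall t, t \in l -> D t) &
      @measurable _ (paths d (grid (0%R :: l))) B]].
have gridD l : (forall t, t \in l -> D t) -> grid (0%R :: l) `<=` D.
  by move=> lD u; rewrite /grid /= inE => /orP[/eqP ->//|/lD].
apply: (@measure_eq_pi _ _ _ G (law eta1 (sub_id D0)) (law eta2 (sub_id D0))) => //.
- move=> B; apply: smallest_sub; first exact: smallest_sigma_algebra.
  move=> _ [t Dt [C mC <-]]; apply: sub_sigma_algebra.
  have [->|t0] := eqVneq t 0%R.
    exists [::]; split => //; rewrite setTI.
    by apply: (measurable_preimage (F := fun w : paths d (grid [:: 0%R]) => w 0%R : V)) => //;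
      apply: measurable_eval; exact: mem_head.
  exists [:: t]; split.
  + by rewrite /= andbT lt_def t0 D0.
  + by move=> u; rewrite inE => /eqP ->.
  + rewrite setTI.
    apply: (measurable_preimage (F := fun w : paths d (grid [:: 0%R; t]) => w t : V)) => //.
    by apply: measurable_eval; rewrite /grid /= !inE eqxx orbT.
- move=> B [l [pl lD mB]].
  exact: (measurable_preimage (measurable_paths_sub (d := d) (gridD _ lD))).
- move=> B1 B2 [l1 [pl1 lD1 mB1]] [l2 [pl2 lD2 mB2]].
  pose l := sort <=%R (undup (l1 ++ l2)).
  have lE u : (u \in l) = (u \in l1) || (u \in l2).
    by rewrite mem_sort mem_undup mem_cat.
  have pos l3 : path <%R 0%R l3 -> forall u : R, u \in l3 -> (0 < u)%R.
    by rewrite lt_path_sortedE => /andP[/allP h _] u /h.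
  exists l; split.
  + rewrite lt_path_sortedE; apply/andP; split.
      by apply/allP => u; rewrite lE => /orP[/(pos _ pl1)|/(pos _ pl2)].
    by rewrite sort_lt_sorted undup_uniq.
  + by move=> u; rewrite lE => /orP[/lD1|/lD2].
  + apply: measurableI.
      apply: (measurable_preimage (F := fun w : paths d (grid (0%R :: l)) =>
        (w : paths d (grid (0%R :: l1))))) => //.
      apply: measurable_paths_sub => u; rewrite /grid /= !inE lE => /orP[->//|->].
      by rewrite orbT.
    apply: (measurable_preimage (F := fun w : paths d (grid (0%R :: l)) =>
      (w : paths d (grid (0%R :: l2))))) => //.
    apply: measurable_paths_sub => u; rewrite /grid /= !inE lE => /orP[->//|->].
    by rewrite !orbT.
- by exists [::]; split => //; exact: measurableT.
- by move=> B [l [pl lD mB]]; apply: (grid_unique pl lD mB).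
Qed.

End increments_unique.

Lemma ae_law {R : realType} {d1 d2} {T : measurableType d1} {S : measurableType d2}
    (P : {measure set T -> \bar R}) (F : T -> S) (mF : measurable_fun setT F) (Q : set S) :
  measurable Q -> {ae P, forall w, Q (F w)} -> {ae law P mF, forall z, Q z}.
Proof.
move=> mQ [N [mN N0 QN]]; exists (~` Q); split => //; first exact: measurableC.
apply/eqP; rewrite eq_le measure_ge0 andbT -N0 /law le_measure// ?inE//.
by apply: measurable_preimage => //; exact: measurableC.
Qed.

Lemma law_ae {R : realType} {d1 d2} {T : measurableType d1} {S : measurableType d2}
    (P : {measure set T -> \bar R}) (F : T -> S) (mF : measurable_fun setT F) (Q : S -> Prop) :
  {ae law P mF, forall z, Q z} -> {ae P, forall w, Q (F w)}.
Proof.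
move=> [N [mN N0 QN]]; exists (F @^-1` N); split => //.
  exact: measurable_preimage.
by move=> w Qw; apply: QN.
Qed.

(** * The Cameron-Martin formula on path space *)

Section cameron_martin.
Local Open Scope ereal_scope.
Context {R : realType} {d : nat}.
Local Notation V := 'rV[R]_d.
Local Notation Om := (paths d (`[0%R, +oo[ : set R)).
Variables (gam : probability Om R).
Hypothesis hgam : wiener gam (fun t (w : Om) => w t).

Lemma measurable_evalT (t : R) : (0 <= t)%R -> measurable_fun [set: Om] (fun w : Om => w t : V).
Proof. by move=> t0; apply: measurable_eval; rewrite /= in_itv/= t0. Qed.

Lemma measurable_restr (s : R) :
  measurable_fun [set: Om] (fun w : Om => (w : paths d `[0%R, s])).
Proof.
by apply: measurable_paths_sub => u; rewrite /= !in_itv/= andbT => /andP[].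
Qed.

Lemma measurable_incr (s t : R) : (0 <= s)%R -> (0 <= t)%R ->
  measurable_fun [set: Om] (fun w : Om => (w t - w s)%R : V).
Proof. by move=> s0 t0; apply: measurable_rVB; exact: measurable_evalT. Qed.

Lemma wiener_incr_gaussian s t (s0 : (0 <= s)%R) (t0 : (0 <= t)%R) : (s < t)%R ->
  gaussian (t - s) (law gam (measurable_incr s0 t0)).
Proof. by move=> st B mB; have [_ _ _ h] := hgam; exact: h. Qed.

Lemma wiener_step s t (s0 : (0 <= s)%R) (t0 : (0 <= t)%R)
    (f : paths d `[0%R, s] * V -> \bar R) : (s < t)%R ->
  measurable_fun setT f -> (forall z, 0 <= f z) ->
  \int[gam]_w f (w, w t - w s)%R =
  \int[gam]_w \int[law gam (measurable_incr s0 t0)]_z f (w, z).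
Proof.
move=> st mf f0; have [_ _ h _] := hgam.
rewrite (@integral_law_pair _ _ _ _ _ _ _ gam (law gam (@measurable_restr s))
  (law gam (measurable_incr s0 t0)) (fun w => w : paths d `[0%R, s]) (fun w => w t - w s)%R)//.
- rewrite integral_law//.
    exact: (@measurable_fun_fubini_tonelli_F _ _ _ _ _ (law gam (measurable_incr s0 t0)) f mf f0).
  by move=> w; exact: integral_ge0.
- exact: measurable_restr.
- exact: measurable_incr.
- by move=> A C mA mC; exact: h.
Qed.

Lemma gaussian_mgf s (G : probability V R) v : (0 < s)%R -> gaussian s G ->
  \int[G]_z (expR (dot z v - s * dot v v / 2))%:E = 1.
Proof.
move=> s0 gG; have := gaussian_shift v s0 gG (f := cst 1) (measurable_cst _) (fun=> lee01).
rewrite integral_cst//= probability_setT mule1 => ->.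
by under [in RHS]eq_integral do rewrite mul1e.
Qed.

(** At r = W_s this is the density on [0, s] of Brownian motion with drift v, and hence the
    likelihood of the drift v given the observation r. *)
Definition expmart (s : R) (r v : V) : R := expR (dot r v - s * dot v v / 2).

Lemma expmart_ge0 s r v : (0 <= expmart s r v)%R. Proof. exact: expR_ge0. Qed.

Lemma expmartD s t r z v : expmart t (r + z)%R v = (expmart s r v * expmart (t - s) z v)%R.
Proof. by rewrite /expmart -expRD dotDl; congr expR; ring. Qed.

Lemma measurable_expmart {disp} {T : measurableType disp} s (r v : T -> V) :
  measurable_fun setT r -> measurable_fun setT v ->
  measurable_fun setT (fun x => expmart s (r x) (v x)).
Proof.
move=> mr mv; apply: measurableT_comp => //; apply: measurable_funB.
  exact: measurable_dot.
by apply: measurable_funM => //; apply: measurable_funM => //; exact: measurable_dot.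
Qed.

(** The martingale property in weak form: [expmartD] splits off the independent increment, whose
    exponential has mean 1 by [gaussian_mgf]. *)
Lemma wiener_expmart s t v (f : paths d `[0%R, s] -> \bar R) : (0 <= s)%R -> (s <= t)%R ->
  measurable_fun setT f -> (forall z, 0 <= f z) ->
  \int[gam]_w (f w * (expmart t (w t) v)%:E) = \int[gam]_w (f w * (expmart s (w s) v)%:E).
Proof.
move=> s0; rewrite le_eqVlt => /predU1P[->//|st] mf f0.
have t0 : (0 <= t)%R by rewrite (le_trans s0)// ltW.
have ss : `[0%R, s]%classic s by rewrite /= in_itv/= s0 lexx.
pose F (z : paths d `[0%R, s] * V) :=
  f z.1 * ((expmart s (z.1 s) v)%:E * (expmart (t - s) z.2 v)%:E).
have mF : measurable_fun setT F.
  apply: emeasurable_funM; first exact: measurableT_comp.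
  apply: emeasurable_funM; apply/measurable_EFinP; apply: measurable_expmart => //.
  by apply: (measurableT_comp (f := fun w : paths d `[0%R, s] => w s : V)) => //; exact: measurable_eval.
have F0 z : 0 <= F z by rewrite /F !mule_ge0// lee_fin expmart_ge0.
transitivity (\int[gam]_w F (w, w t - w s)%R).
  apply: eq_integral => w _; rewrite /F /= -EFinM -expmartD.
  by rewrite addrC subrK.
rewrite (wiener_step s0 t0 st mF F0); apply: eq_integral => w _; rewrite /F /=.
under eq_integral do rewrite muleA.
rewrite ge0_integralZl//.
- rewrite gaussian_mgf ?subr_gt0//; first by rewrite mule1.
  exact: wiener_incr_gaussian.
- by apply/measurable_EFinP; exact: measurable_expmart.
- by move=> z _; rewrite lee_fin expmart_ge0.
- by rewrite mule_ge0// lee_fin expmart_ge0.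
Qed.

Definition shift_path (v : V) (w : R -> V) : R -> V := fun t => (w t + t *: v)%R.

Lemma measurable_shift_path (D : set R) v :
  measurable_fun [set: paths d D] (fun w : paths d D => (shift_path v w : paths d D)).
Proof.
by apply: measurable_paths => t Dt; apply: measurable_rVD => //; exact: measurable_eval.
Qed.

Section cm.
Variables (S : R) (v : V).
Hypothesis S0 : (0 <= S)%R.

Let dens (w : Om) := expmart S (w S) v.
Let mdens1 : measurable_fun setT dens.
Proof. by apply: measurable_expmart => //; exact: measurable_evalT. Qed.
Let dens0 w : (0 <= dens w)%R. Proof. exact: expmart_ge0. Qed.

(** [eta1] is the law of the drifted path and [eta2] the exponentially tilted Wiener measure. On
    [0, S] both have the increment kernel [kappa], Gaussian with mean (t - s) v, so
    [increments_unique] identifies them. *)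
Let eta1 := law gam (@measurable_shift_path (`[0%R, +oo[) v).
Let eta2 := mdens gam mdens1 dens0.

Let mzero : measurable [set w : Om | w 0%R = 0%R].
Proof.
apply: (measurable_preimage (F := fun w : Om => w 0%R) (A := [set 0%R])).
  exact: measurable_evalT.
exact: measurable_set1_rV.
Qed.

Let kappa s t (C : set V) := gam [set w : Om | C (w t - w s + (t - s) *: v)%R].

Let step1 s t : (0 <= s)%R -> (s < t)%R -> `[0%R, S]%classic t ->
  forall (A : set (paths d `[0%R, s])) (C : set V), measurable A -> measurable C ->
  eta1 ([set w : Om | A w] `&` [set w | C (w t - w s)%R]) =
  eta1 [set w : Om | A w] * kappa s t C.
Proof.
move=> s0 st _ A C mA mC; have [_ _ h _] := hgam.
rewrite /eta1 /law /kappa.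
have mA' := measurable_preimage (@measurable_shift_path `[0%R, s] v) mA.
have mC' : measurable [set z : V | C (z + (t - s) *: v)%R].
  by apply: (measurable_preimage _ mC); exact: measurable_rVD.
rewrite -(h s t s0 st _ _ mA' mC'); congr (gam _).
apply/seteqP; split => w /= -[wA wC]; split => //.
  by move: wC; rewrite /shift_path scalerBl opprD addrACA.
by move: wC; rewrite /shift_path scalerBl opprD addrACA.
Qed.

(** The martingale property lowers the density from time [S] to [t]; it then splits at [s], and
    [gaussian_shift] converts its factor on the increment into the drift. *)
Let step2 s t : (0 <= s)%R -> (s < t)%R -> `[0%R, S]%classic t ->
  forall (A : set (paths d `[0%R, s])) (C : set V), measurable A -> measurable C ->
  eta2 ([set w : Om | A w] `&` [set w | C (w t - w s)%R]) =
  eta2 [set w : Om | A w] * kappa s t C.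
Proof.
move=> s0 st; rewrite /= in_itv/= => /andP[t0 tS] A C mA mC.
have ss : `[0%R, s]%classic s by rewrite /= in_itv/= s0 lexx.
have sS : (s <= S)%R by rewrite (le_trans _ tS)// ltW.
have mAw : measurable [set w : Om | A w] by exact: (measurable_preimage (@measurable_restr s)).
have mCw : measurable [set w : Om | C (w t - w s)%R].
  by apply: (measurable_preimage _ mC); exact: measurable_incr.
have dE (B : set Om) : measurable B ->
    eta2 B = \int[gam]_w ((\1_B w)%:E * (expmart S (w S) v)%:E).
  move=> mB; rewrite /eta2 /mdens integral_mkcond; apply: eq_integral => w _.
  by rewrite patchE indicE; case: ifP => _; rewrite ?mul1e ?mul0e.
rewrite !dE//; last exact: measurableI.
have restr_meas u : (0 <= u)%R -> (u <= t)%R -> measurable_fun [set: paths d `[0%R, t]]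
    (fun w : paths d `[0%R, t] => w u : V).
  by move=> u0 ut; apply: measurable_eval; rewrite /= in_itv/= u0.
have mst := restr_meas s s0 (ltW st).
have mtt := restr_meas t t0 (lexx t).
pose g1 (w : paths d `[0%R, t]) : \bar R :=
  (\1_([set w : paths d `[0%R, t] | A w] `&` [set w | C (w t - w s)%R]) w)%:E.
have mg1 : measurable_fun setT g1.
  apply/measurable_EFinP; apply: measurable_indic; apply: measurableI.
    apply: (measurable_preimage (F := fun w : paths d `[0%R, t] => (w : paths d `[0%R, s])) _ mA).
    apply: measurable_paths_sub => u; rewrite /= !in_itv/= => /andP[-> us].
    by rewrite (le_trans us)// ltW.
  by apply: (measurable_preimage _ mC); exact: measurable_rVB.
transitivity (\int[gam]_w (g1 w * (expmart S (w S) v)%:E)); first by apply: eq_integral.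
rewrite (wiener_expmart v t0 tS mg1); last by move=> z; rewrite lee_fin indicE.
transitivity ((\int[gam]_w ((\1_A (w : paths d `[0%R, s]))%:E * (expmart s (w s) v)%:E)) *
    kappa s t C); last first.
  rewrite -(wiener_expmart (f := fun w : paths d `[0%R, s] => (\1_A w)%:E) v s0 sS)//.
  by apply/measurable_EFinP; exact: measurable_indic.
pose F (z : paths d `[0%R, s] * V) : \bar R :=
  ((\1_A z.1)%:E * (expmart s (z.1 s) v)%:E) * ((\1_C z.2)%:E * (expmart (t - s) z.2 v)%:E).
have mP1 : measurable_fun setT (fun w : paths d `[0%R, s] => (\1_A w)%:E * (expmart s (w s) v)%:E).
  apply: emeasurable_funM; apply/measurable_EFinP; first exact: measurable_indic.
  apply: measurable_expmart => //.
  by apply: (measurable_eval (d := d) (D := `[0%R, s]%classic)).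
have mP2 : measurable_fun setT (fun z : V => (\1_C z)%:E * (expmart (t - s) z v)%:E).
  apply: emeasurable_funM; apply/measurable_EFinP; first exact: measurable_indic.
  exact: measurable_expmart.
have P10 w : 0 <= (\1_A w)%:E * (expmart s (w s) v)%:E :> \bar R.
  by rewrite mule_ge0// lee_fin// expmart_ge0.
have P20 z : 0 <= (\1_C z)%:E * (expmart (t - s) z v)%:E :> \bar R.
  by rewrite mule_ge0// lee_fin// expmart_ge0.
have mF : measurable_fun setT F.
  apply: emeasurable_funM; first exact: (measurableT_comp mP1 measurable_fst).
  exact: (measurableT_comp mP2 measurable_snd).
have F0 z : 0 <= F z by rewrite /F mule_ge0.
transitivity (\int[gam]_w F (w : paths d `[0%R, s], w t - w s)%R).
  apply: eq_integral => w _; rewrite /F /g1 /=.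
  rewrite muleACA -!EFinM -expmartD [(w s + _)%R]addrC subrK; congr EFin.
  by congr (_ * _)%R; rewrite indicI.
rewrite (wiener_step s0 t0 st mF F0).
have st0 : (0 < t - s)%R by rewrite subr_gt0.
have kE : \int[law gam (measurable_incr s0 t0)]_z ((\1_C z)%:E * (expmart (t - s) z v)%:E) =
    kappa s t C.
  rewrite -(gaussian_shift (f := fun z => (\1_C z)%:E) v st0 (wiener_incr_gaussian s0 t0 st)).
  - have mC' : measurable [set z : V | C (z + (t - s) *: v)%R].
      by apply: (measurable_preimage _ mC); exact: measurable_rVD.
    transitivity (\int[law gam (measurable_incr s0 t0)]_z
        (\1_[set z : V | C (z + (t - s) *: v)%R] z)%:E) => //.
    by rewrite integral_indic// setIT.
  - by apply/measurable_EFinP; exact: measurable_indic.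
  - by move=> z; rewrite lee_fin.
transitivity (\int[gam]_w ((\1_A (w : paths d `[0%R, s]))%:E * (expmart s (w s) v)%:E *
    kappa s t C)); last first.
  apply: ge0_integralZr.
  - exact: measurableT.
  - exact: (measurableT_comp mP1 (@measurable_restr s)).
  - by move=> w _; exact: P10.
  - exact: measure_ge0.
apply: eq_integral => w _.
transitivity ((\1_A (w : paths d `[0%R, s]))%:E * (expmart s (w s) v)%:E *
  \int[law gam (measurable_incr s0 t0)]_z ((\1_C z)%:E * (expmart (t - s) z v)%:E)).
  rewrite /F /=; apply: ge0_integralZl.
  - exact: measurableT.
  - exact: mP2.
  - by move=> z _; exact: P20.
  - exact: P10.
by rewrite kE.
Qed.

Let ae1 : {ae eta1, forall w, w 0%R = 0%R}.
Proof.
have [_ w0 _ _] := hgam.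
apply: (ae_law (@measurable_shift_path _ v) (Q := [set w : Om | w 0%R = 0%R]) mzero).
by apply: ae_imp w0 => w /=; rewrite /shift_path scale0r addr0.
Qed.

Let ae2 : {ae eta2, forall w, w 0%R = 0%R}.
Proof.
have [_ [N [mN N0 hN]] _ _] := hgam; exists N; split => //.
rewrite /eta2 /= /mdens; apply: null_set_integral => //.
by apply: measurable_funTS; exact/measurable_EFinP.
Qed.

(** The density at time [S] has the same integral as at time 0, where it equals 1 almost surely. *)
Let eta12 : eta1 setT = eta2 setT.
Proof.
rewrite /eta1 /eta2 /law preimage_setT /mdens.
have [_ w0 _ _] := hgam.
transitivity (\int[gam]_w (cst 1 w * (expmart 0 (w 0%R) v)%:E)).
  rewrite -[LHS](mul1e) -integral_cst//; apply: ge0_ae_eq_integral => //.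
  - apply: emeasurable_funM => //; apply/measurable_EFinP; apply: measurable_expmart => //.
    exact: measurable_evalT.
  - by move=> w _; rewrite mul1e lee_fin expmart_ge0.
  - apply: ae_imp w0 => w /= -> _.
    by rewrite /expmart dot0l mul0r mul0r subr0 expR0 mule1.
rewrite -(wiener_expmart (f := cst 1) v (lexx 0%R) S0)//.
by apply: eq_integral => w _; rewrite mul1e.
Qed.

Lemma cameron_martin (f : paths d `[0%R, S] -> \bar R) :
  measurable_fun setT f -> (forall z, 0 <= f z) ->
  \int[gam]_w f (shift_path v w) = \int[gam]_w (f w * (expmart S (w S) v)%:E).
Proof.
move=> mf f0.
have mfr : measurable_fun setT (fun w : Om => f w).
  exact: (measurableT_comp mf (@measurable_restr S)).
transitivity (\int[law eta1 (@measurable_restr S)]_w f w).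
  by rewrite integral_law// integral_law.
transitivity (\int[law eta2 (@measurable_restr S)]_w f w); last first.
  by rewrite integral_law// integral_mdens.
apply: eq_measure_integral => A mA _.
apply: (increments_unique (D := `[0%R, S]%classic) (kappa := kappa) (eta1 := eta1) (eta2 := eta2)) => //.
- by move=> t; rewrite /= in_itv/= => /andP[].
- have e1T : eta1 setT = 1 := probability_setT gam.
  by apply: (@le_lt_trans _ _ (eta1 setT)) => //; rewrite e1T ltry.
- by rewrite /= in_itv/= lexx.
Qed.

End cm.

End cameron_martin.

Lemma rectangles_pi {d1 d2} {S1 : measurableType d1} {S2 : measurableType d2}
    (G := [set X `*` Y | X in (measurable : set (set S1)) & Y in (measurable : set (set S2))]) :
  [/\ measurable `<=` <<s G >>, G `<=` measurable, setI_closed G & G setT].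
Proof.
split.
- by rewrite measurable_prod_measurableType.
- by move=> _ [X mX [Y mY <-]]; exact: measurableX.
- move=> _ _ [X mX [Y mY <-]] [X' mX' [Y' mY' <-]].
  exists (X `&` X'); first exact: measurableI.
  by exists (Y `&` Y'); [exact: measurableI|rewrite setXI].
- by exists setT => //; exists setT => //; rewrite setXTT.
Qed.

(** Paths are total functions, but a cylinder set over [D] cannot distinguish two of them that agree
    on [D]. *)
Lemma paths_ext {R : realType} {d} (D : set R) (A : set (paths d D)) (f g : R -> 'rV[R]_d) :
  measurable A -> (forall t, D t -> f t = g t) -> A f -> A g.
Proof.
move=> mA fg.
suff : [set B : set (R -> 'rV[R]_d) | B f <-> B g] A by move=> /= [].
move: A mA; apply: smallest_sub.
  split => //= [B [h1 h2]|F hF].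
    by split => -[_ h]; split => // ?; apply: h; [exact: h2|exact: h1].
  by split => -[n _ Fn]; exists n => //; apply/hF.
by move=> _ [t Dt [C mC <-]] /=; rewrite fg.
Qed.

Section wiener_unique.
Local Open Scope ereal_scope.
Context {R : realType} {d : nat}.
Local Notation V := 'rV[R]_d.
Local Notation Om := (paths d (`[0%R, +oo[ : set R)).

Lemma wiener_unique (g1 g2 : probability Om R) :
  wiener g1 (fun t (w : Om) => w t) -> wiener g2 (fun t (w : Om) => w t) ->
  forall A, measurable A -> g1 A = g2 A.
Proof.
move=> h1 h2 A mA.
apply: (increments_unique (D := `[0%R, +oo[%classic)
  (kappa := fun s t C => g1 [set w : Om | C (w t - w s)%R]) (eta1 := g1) (eta2 := g2)) => //.
- by move=> t; rewrite /= in_itv/= andbT.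
- by have e1 := probability_setT g1; have e2 := probability_setT g2; exact: (etrans e1 (esym e2)).
- by rewrite (le_lt_trans (probability_le1 g1 _)) ?ltry.
- by have [] := h1.
- by have [] := h2.
- by move=> s t s0 st _ B C mB mC; have [_ _ h _] := h1; exact: h.
- move=> s t s0 st; rewrite /= in_itv/= andbT => t0 B C mB mC.
  have [_ _ h _] := h2; rewrite h//; congr (_ * _).
  apply: (measure_eq_box (m1 := law g2 (measurable_incr (d := d) s0 t0))
    (m2 := law g1 (measurable_incr (d := d) s0 t0))) => //.
    apply: (@le_lt_trans _ _ 1); last exact: ltry.
    exact: (probability_le1 (law g2 (measurable_incr (d := d) s0 t0))).
  move=> Bi mBi; rewrite (wiener_incr_gaussian h1 s0 t0 st)//.
  exact: (wiener_incr_gaussian h2 s0 t0 st).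
- by rewrite /= in_itv/= lexx.
Qed.

End wiener_unique.

(** * Brownian bridges *)

Section bridge.
Local Open Scope ereal_scope.
Context {R : realType} {d : nat} {disp} {T : measurableType disp}.
Local Notation V := 'rV[R]_d.
Variables (P : probability T R) (B : R -> T -> V) (sigma : R).
Hypotheses (hB : wiener P B) (sigma0 : (0 < sigma)%R).
Local Notation tau := (tau sigma).

Lemma tau_den s : (0 <= s)%R -> (0 < 1 + sigma ^+ 2 * s)%R.
Proof. by move=> s0; rewrite ltr_wpDr// mulr_ge0// sqr_ge0. Qed.

Lemma tau_ge0 s : (0 <= s)%R -> (0 <= tau s)%R.
Proof. by move=> s0; rewrite divr_ge0 ?mulr_ge0 ?sqr_ge0// ltW// tau_den. Qed.

Lemma tau_onem s : (0 <= s)%R -> (1 - tau s = (1 + sigma ^+ 2 * s)^-1)%R.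
Proof.
by move=> s0; rewrite /Defs.tau; field; rewrite lt0r_neq0// tau_den.
Qed.

Lemma tau_lt1 s : (0 <= s)%R -> (tau s < 1)%R.
Proof. by move=> s0; rewrite -subr_gt0 tau_onem// invr_gt0 tau_den. Qed.

Lemma tau_lt s t : (0 <= s)%R -> (s < t)%R -> (tau s < tau t)%R.
Proof.
move=> s0 st; have t0 : (0 <= t)%R by rewrite (le_trans s0)// ltW.
rewrite -ltrN2 -(ltrD2l 1) !tau_onem// ltf_pV2 ?posrE ?tau_den//.
by rewrite ltrD2l ltr_pM2l// exprn_gt0.
Qed.

Lemma tau_le s t : (0 <= s)%R -> (s <= t)%R -> (tau s <= tau t)%R.
Proof.
by move=> s0; rewrite le_eqVlt => /predU1P[->//|st]; rewrite ltW// tau_lt.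
Qed.

(** What remains of (U_t - x) / (sigma^2 (1 - t)), for U a bridge from x to y and t = tau(s), once
    the drift s (y - x) is removed. *)
Definition bridge_motion (s : R) (w : T) : V :=
  ((sigma * (1 - tau s))^-1 *: (B (tau s) w - tau s *: B 1 w))%R.

Section increments.
Variables (s s' : R).
Hypotheses (s0 : (0 <= s)%R) (ss' : (s < s')%R).
Let t := tau s.
Let t' := tau s'.
Let s'0 : (0 <= s')%R. Proof. by rewrite (le_trans s0)// ltW. Qed.
Let t0 : (0 <= t)%R. Proof. exact: tau_ge0. Qed.
Let tt' : (t < t')%R. Proof. exact: tau_lt. Qed.
Let t'0 : (0 <= t')%R. Proof. by rewrite (le_trans t0)// ltW. Qed.
Let t'1 : (t' < 1)%R. Proof. exact: tau_lt1. Qed.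
Let a := (t' - t)%R.
Let c := (1 - t')%R.
(** [a] and [c] are the variances of the increments [D] and [F] of [B] over [t, t'] and [t', 1];
    with this [k] the increment of [bridge_motion] is k (c D - a F). *)
Let k := ((sigma * (1 - t) * (1 - t'))^-1)%R.
Let a0 : (0 < a)%R. Proof. by rewrite subr_gt0. Qed.
Let c0 : (0 < c)%R. Proof. by rewrite subr_gt0. Qed.
Let t1 : (t < 1)%R. Proof. exact: lt_trans t'1. Qed.
Let k0 : (0 < k)%R.
Proof. by rewrite invr_gt0 !mulr_gt0// subr_gt0. Qed.

Let mB u : (0 <= u)%R -> measurable_fun setT (B u).
Proof. by have [h _ _ _] := hB; exact: h. Qed.

Let D w : V := (B t' w - B t w)%R.
Let F w : V := (B 1 w - B t' w)%R.
Let mD : measurable_fun setT D. Proof. by apply: measurable_rVB; exact: mB. Qed.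
Let mF : measurable_fun setT F. Proof. by apply: measurable_rVB; exact: mB. Qed.
Let gD : gaussian a (law P mD).
Proof. by move=> C mC; have [_ _ _ h] := hB; exact: h. Qed.
Let gF : gaussian c (law P mF).
Proof. by move=> C mC; have [_ _ _ h] := hB; exact: h. Qed.

Let mpast u (A : set (paths d `[0%R, u])) : measurable A -> measurable [set w | A (B ^~ w)].
Proof.
move=> mA; apply: (paths_preimage (sigma_algebra_measurable _) _ mA).
move=> r C; rewrite /= in_itv/= => /andP[r0 _] mC.
by apply: measurable_preimage => //; exact: mB.
Qed.

(** Independence of increments is used twice: at t' for [F] against the past and [D] together, then
    at t for [D] against the past. *)
Let pastDF (A : set (paths d `[0%R, t])) X Y : measurable A -> measurable X -> measurable Y ->
  P ([set w | A (B ^~ w)] `&` D @^-1` X `&` F @^-1` Y) =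
  P [set w | A (B ^~ w)] * (P (D @^-1` X) * P (F @^-1` Y)).
Proof.
move=> mA mX mY; have [_ _ h _] := hB.
pose A' : set (paths d `[0%R, t']) := [set w | A w] `&` [set w | X (w t' - w t)%R].
have mA' : measurable A'.
  apply: measurableI.
    apply: (measurable_preimage (F := fun w : paths d `[0%R, t'] => (w : paths d `[0%R, t])) _ mA).
    apply: measurable_paths_sub => u; rewrite /= !in_itv/= => /andP[-> ut].
    by rewrite (le_trans ut)// ltW.
  apply: (measurable_preimage (F := fun w : paths d `[0%R, t'] => (w t' - w t)%R : V) _ mX).
  apply: measurable_rVB; apply: measurable_eval; rewrite /= in_itv/= ?t'0 ?lexx//.
  by rewrite t0 ltW.
have := h t' 1%R t'0 t'1 A' Y mA' mY.
have -> : [set w | A' (B ^~ w)] = [set w | A (B ^~ w)] `&` D @^-1` X by [].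
move=> ->; rewrite muleA; congr (_ * _).
by apply: (h t t').
Qed.

Let DFindep X Y : measurable X -> measurable Y ->
  P (D @^-1` X `&` F @^-1` Y) = P (D @^-1` X) * P (F @^-1` Y).
Proof.
move=> mX mY; have := pastDF measurableT mX mY.
rewrite (_ : [set w | _] = setT)//.
have -> : P [set: T] = 1 := probability_setT P.
by rewrite setTI mul1e.
Qed.

Let pastDFQ (A : set (paths d `[0%R, t])) (Q : set (V * V)) :
  measurable A -> measurable Q ->
  P ((fun w => (D w, F w)) @^-1` Q `&` [set w | A (B ^~ w)]) =
  P ((fun w => (D w, F w)) @^-1` Q) * P [set w | A (B ^~ w)].
Proof.
move=> mA; have [G1 G2 G3 G4] := @rectangles_pi _ _ V V.
apply: (indep_pi G1 G2 G3 G4).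
- exact: measurable_fun_pair.
- exact: mpast.
- move=> _ [X mX [Y mY <-]].
  have -> : (fun w => (D w, F w)) @^-1` (X `*` Y) = D @^-1` X `&` F @^-1` Y by [].
  by rewrite setIC setIA pastDF// DFindep// muleC.
Qed.

Let S w : V := (D w + F w)%R.
Let I w : V := (k *: (c *: D w - a *: F w))%R.
Let mS : measurable_fun setT S. Proof. exact: measurable_rVD. Qed.
Let mI : measurable_fun setT I.
Proof.
by apply: measurable_rVZ => //; apply: measurable_rVB; exact: measurable_rVZ.
Qed.

(** The pair (D, F) is independent of the past and [I] is independent of [S] = D + F by rotation;
    hence [I] is independent of the past and [S] jointly. *)
Let pastSI (E : set (paths d `[0%R, t] * V)) (C : set V) : measurable E -> measurable C ->
  P ((fun w => (B ^~ w, S w)) @^-1` E `&` I @^-1` C) =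
  P ((fun w => (B ^~ w, S w)) @^-1` E) * P (I @^-1` C).
Proof.
move=> mE mC; have [G1 G2 G3 G4] := @rectangles_pi _ _ (paths d `[0%R, t]) V.
have mBp : measurable_fun setT (fun w => (B ^~ w : paths d `[0%R, t])).
  by apply: measurable_paths => u; rewrite /= in_itv/= => /andP[u0 _]; exact: mB.
apply: (indep_pi G1 G2 G3 G4) mE.
- exact: measurable_fun_pair.
- exact: measurable_preimage.
- move=> _ [A mA [Y mY <-]].
  have -> : (fun w => (B ^~ w, S w)) @^-1` (A `*` Y) = [set w | A (B ^~ w)] `&` S @^-1` Y by [].
  have mSY : measurable [set z : V * V | Y (z.1 + z.2)%R].
    by apply: (measurable_preimage _ mY); exact: measurable_rVD.
  have mIC : measurable [set z : V * V | C (k *: (c *: z.1 - a *: z.2))%R].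
    apply: (measurable_preimage _ mC); apply: measurable_rVZ => //.
    by apply: measurable_rVB; exact: measurable_rVZ.
  have h1 := pastDFQ mA mSY.
  have h2 := pastDFQ mA (measurableI _ _ mSY mIC).
  transitivity (P [set w | A (B ^~ w)] * (P (S @^-1` Y) * P (I @^-1` C))).
    rewrite -(rotation_indep a0 c0 k0 gD gF DFindep)// muleC -setIA.
    by rewrite [X in P X]setIC; exact: h2.
  rewrite muleA; congr (_ * _).
  by rewrite [X in _ = P X]setIC muleC; exact/esym/h1.
Qed.

(* The increment over [s, s'] is the rotated partner [I] of [D + F], hence is
   independent of [B 1 - B t] and of the past, that is, of the bridge up to [t]. *)
Lemma bridge_incrE w : (bridge_motion s' w - bridge_motion s w)%R = I w.
Proof.
apply/rowP => i; rewrite /bridge_motion -/t -/t' /I /D /F /k /c /a !mxE.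
by field; rewrite !subr_eq0 gt_eqF// [_ == t]gt_eqF// gt_eqF.
Qed.

Lemma bridge_incr_gaussian (C : 'I_d -> set R) : (forall i, measurable (C i)) ->
  P [set w | box C (bridge_motion s' w - bridge_motion s w)%R] =
  \prod_(i < d) gN (s' - s) (C i).
Proof.
move=> mC; have -> : (s' - s = k ^+ 2 * (a * c * (a + c)))%R.
  have e1 : (1 - t)%R = ((1 + sigma ^+ 2 * s)^-1)%R by exact: tau_onem.
  have e2 : (1 - t')%R = ((1 + sigma ^+ 2 * s')^-1)%R by exact: tau_onem.
  have -> : (a + c = 1 - t)%R by rewrite /a /c; ring.
  have -> : a = ((1 + sigma ^+ 2 * s)^-1 - (1 + sigma ^+ 2 * s')^-1)%R.
    by rewrite -e1 -e2 /a; ring.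
  rewrite /k /c e1 e2; field.
  by rewrite !lt0r_neq0// tau_den.
rewrite -(rotation_gaussian a0 c0 k0 gD gF DFindep mC) /law /=; congr (P _).
by apply/seteqP; split => w /=; rewrite bridge_incrE.
Qed.

Lemma bridge_incr_indep (A : set (paths d `[0%R, s])) (C : set V) :
  measurable A -> measurable C ->
  P ([set w | A (bridge_motion ^~ w)] `&` [set w | C (bridge_motion s' w - bridge_motion s w)%R]) =
  P [set w | A (bridge_motion ^~ w)] * P [set w | C (bridge_motion s' w - bridge_motion s w)%R].
Proof.
move=> mA mC.
(* The bridge up to time [s] is a function of [B] on [0, t] and of [S], because B 1 = B t + S. *)
pose Ph (z : paths d `[0%R, t] * V) : paths d `[0%R, s] := fun u =>
  ((sigma * (1 - tau u))^-1 *: (z.1 (tau u) - tau u *: (z.2 + z.1 t)))%R.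
have mPh : measurable_fun setT Ph.
  apply: measurable_paths => u; rewrite /= in_itv/= => /andP[u0 us].
  have mev r : (0 <= r)%R -> (r <= t)%R ->
      measurable_fun setT (fun z : paths d `[0%R, t] * V => z.1 r : V).
    move=> r0 rt; apply: (measurableT_comp (f := fun w : paths d `[0%R, t] => w r : V)) => //.
    by apply: measurable_eval; rewrite /= in_itv/= r0.
  apply: measurable_rVZ => //; apply: measurable_rVB.
    by apply: mev; [exact: tau_ge0|exact: tau_le].
  by apply: measurable_rVZ => //; apply: measurable_rVD => //; exact: mev.
pose E := Ph @^-1` A.
have mE : measurable E by exact: (measurable_preimage mPh mA).
have AE : [set w | A (bridge_motion ^~ w)] = (fun w => (B ^~ w, S w)) @^-1` E.
  apply/seteqP; split => w /=; apply: (paths_ext mA) => u;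
    rewrite /= in_itv/= => /andP[u0 us]; rewrite /bridge_motion /Ph /S /D /F /=;
    by congr (_ *: (_ - _ *: _))%R; apply/rowP => i; rewrite !mxE; ring.
have IE : [set w | C (bridge_motion s' w - bridge_motion s w)%R] = I @^-1` C.
  by apply/seteqP; split => w /=; rewrite bridge_incrE.
by rewrite AE IE; exact: pastSI.
Qed.

End increments.

Lemma wiener_bridge : wiener P bridge_motion.
Proof.
have [mB B0 _ _] := hB; split.
- move=> s s0; apply: measurable_rVZ => //; apply: measurable_rVB.
    by apply: mB; exact: tau_ge0.
  by apply: measurable_rVZ => //; apply: mB.
- apply: ae_imp B0 => w w0; rewrite /bridge_motion /Defs.tau !mulr0 mul0r.
  by rewrite w0 scale0r !subr0 scaler0.
- by move=> s t s0 st A C mA mC; exact: bridge_incr_indep.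
- by move=> s t s0 st C mC; exact: bridge_incr_gaussian.
Qed.

End bridge.

(** * Posterior means *)

Section fiber.
Local Open Scope ereal_scope.
Context {R : realType} {d1 d2} {S1 : measurableType d1} {S2 : measurableType d2}.
Variable k : R.-pker S1 ~> S2.

Section at_point.
Variable x : S1.

Definition fiber_def : set S2 -> \bar R := k x.

HB.instance Definition _ := Measure.on fiber_def.

Let fiber1 : fiber_def setT = 1. Proof. exact: prob_kernel. Qed.

HB.instance Definition _ := Measure_isProbability.Build _ _ _ fiber_def fiber1.

Definition fiber : probability S2 R := fiber_def.

End at_point.

Section comap.
Context {d3} {S3 : measurableType d3} {g : S3 -> S1}.
Hypothesis mg : measurable_fun setT g.

(** Pulling the kernel back along [g] lets the integrand depend on more parameters than the kernel:
    below, on the observation as well as on the initial point. *)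
Definition kcomap of measurable_fun setT g := fun z => k (g z).

Let mkcomap U : measurable U -> measurable_fun setT (kcomap mg ^~ U).
Proof.
move=> mU.
by apply: (measurableT_comp (f := fun x => k x U)) => //; exact: measurable_kernel.
Qed.

HB.instance Definition _ := isKernel.Build _ _ _ _ _ (kcomap mg) mkcomap.

Let kcomap1 z : kcomap mg z setT = 1. Proof. exact: prob_kernel. Qed.

HB.instance Definition _ := Kernel_isProbability.Build _ _ _ _ _ (kcomap mg) kcomap1.

Lemma measurable_fun_integral_fiber (f : S3 * S2 -> \bar R) :
  measurable_fun setT f -> (forall z, 0 <= f z) ->
  measurable_fun setT (fun z => \int[fiber (g z)]_y f (z, y)).
Proof.
move=> mf f0.
exact: (measurable_fun_integral_finite_kernel f (kcomap mg : R.-fker S3 ~> S2)).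
Qed.

End comap.
End fiber.

Section tilt.
Local Open Scope ereal_scope.
Context {R : realType} {d : nat}.
Local Notation V := 'rV[R]_d.
Variable k : R.-pker V ~> V.

(* At [s = 0] the weight is 1 rather than [expmart 0 r v]: the observation
   [r] then vanishes almost surely, and integrability would otherwise fail. *)
Definition weight (s : R) (r v : V) : R := if s == 0%R then 1%R else expmart s r v.

Lemma weight_gt0 s r v : (0 < weight s r v)%R.
Proof. by rewrite /weight; case: ifP => // _; exact: expR_gt0. Qed.

Lemma measurable_weight {disp} {T : measurableType disp} s (r v : T -> V) :
  measurable_fun setT r -> measurable_fun setT v ->
  measurable_fun setT (fun x => weight s (r x) (v x)).
Proof.
move=> mr mv; rewrite /weight; case: (s == 0%R); first exact: measurable_cst.
exact: measurable_expmart.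
Qed.

(** Completing the square, from |r - s v|^2 >= 0. The bound does not involve v, so posterior masses
    are finite for every fibre. *)
Lemma weight_le s r v : (0 <= s)%R ->
  (weight s r v <= expR (dot r r / (s *+ 2)))%R.
Proof.
move=> s0; rewrite /weight; case: ifPn => [/eqP ->|sn0].
  (* At s = 0 the quotient is 0 by the convention for division by zero, and the bound is the value 1
     of the weight. *)
  by rewrite mul0rn invr0 mulr0 expR0.
rewrite /expmart ler_expR.
have s1 : (0 < s)%R by rewrite lt_neqAle eq_sym sn0.
have := dot_ge0 (r - s *: v)%R.
rewrite dotBl ![dot _ (r - _)]dotC !dotBl dotZl [dot (s *: v) (s *: v)]dotZl.
rewrite ![dot _ (s *: v)]dotC !dotZl [dot v r]dotC => h.
rewrite ler_pdivlMr; last by rewrite pmulrn_lgt0.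
rewrite -mulr_natr; nra.
Qed.

(** The unnormalized posterior integral of [f] for the initial point [z.1] and the observation [z.2]
    at time [s]. *)
Definition tilt (f : V -> \bar R) (s : R) (z : V * V) : \bar R :=
  \int[fiber k z.1]_y (f y * (weight s z.2 (y - z.1))%:E).

Lemma tilt_ge0 f s z : (forall y, 0 <= f y) -> 0 <= tilt f s z.
Proof.
move=> f0; apply: integral_ge0 => y _; apply: mule_ge0 => //.
by rewrite lee_fin ltW// weight_gt0.
Qed.

Lemma measurable_tilt f s : measurable_fun setT f -> (forall y, 0 <= f y) ->
  measurable_fun setT (tilt f s).
Proof.
move=> mf f0.
apply: (measurable_fun_integral_fiber (S3 := (V * V)%type) (g := fst) k measurable_fst
  (f := fun z => f z.2 * (weight s z.1.2 (z.2 - z.1.1)%R)%:E)).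
  apply: emeasurable_funM; first exact: measurableT_comp.
  apply/measurable_EFinP; apply: measurable_weight.
    by apply: measurableT_comp => //.
  by apply: measurable_rVB => //; apply: measurableT_comp.
by move=> z; rewrite mule_ge0// lee_fin ltW// weight_gt0.
Qed.

Let mweight s (z : V * V) :
  measurable_fun setT (fun y : V => cst 1 y * (weight s z.2 (y - z.1)%R)%:E).
Proof.
apply: emeasurable_funM => //; apply/measurable_EFinP; apply: measurable_weight => //.
exact: measurable_rVB.
Qed.

Lemma tilt1_fin_num s z : (0 <= s)%R -> tilt (cst 1) s z \is a fin_num.
Proof.
move=> s0; rewrite ge0_fin_numE; last by apply: tilt_ge0.
apply: (@le_lt_trans _ _ (\int[fiber k z.1]_y (expR (dot z.2 z.2 / (s *+ 2)))%:E)).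
  apply: ge0_le_integral => //.
  - by move=> y _; rewrite mule_ge0// lee_fin ltW// weight_gt0.
  - by move=> y _; rewrite mul1e lee_fin weight_le.
rewrite integral_cst// [X in _ * X](_ : _ = 1) ?mule1 ?ltry//.
exact: probability_setT.
Qed.

(* Locked so that [done] never computes an integral to weak head normal form. *)
Definition mass s : V * V -> R := locked (fun z => fine (tilt (cst 1) s z)).

Lemma massK s z : mass s z = fine (tilt (cst 1) s z).
Proof. by rewrite /mass -lock. Qed.

Lemma massE s z : (0 <= s)%R -> tilt (cst 1) s z = (mass s z)%:E.
Proof. by move=> s0; rewrite massK fineK// tilt1_fin_num. Qed.

Lemma mass_gt0 s z : (0 <= s)%R -> (0 < mass s z)%R.
Proof.
move=> s0; rewrite massK; apply: fine_gt0; apply/andP; split; last first.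
  by rewrite -ge0_fin_numE ?tilt1_fin_num//; exact: tilt_ge0.
rewrite lt0e tilt_ge0// andbT; apply/negP => /eqP h.
have h0 : \int[fiber k z.1]_y `|cst 1 y * (weight s z.2 (y - z.1)%R)%:E| = 0.
  rewrite -[RHS]h; apply: eq_integral => y _; rewrite gee0_abs// mule_ge0//.
  by rewrite lee_fin ltW// weight_gt0.
have /ae_eq_integral_abs -/(_ measurableT (mweight s z)) [A [mA A0 hA]] := h0.
have : fiber k z.1 setT = 0.
  apply/eqP; rewrite -measure_le0 -A0; apply: le_measure; rewrite ?inE// => y _.
  apply: hA => /= /(_ Logic.I)/eqP; rewrite mul1e eqe gt_eqF//.
  exact: weight_gt0.
have -> : fiber k z.1 setT = 1 := probability_setT (fiber k z.1).
by move/eqP; rewrite onee_eq0.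
Qed.

Lemma measurable_mass s : measurable_fun setT (mass s).
Proof.
rewrite /mass -lock.
apply: measurableT_comp => //; apply: measurable_tilt => //.
Qed.

Definition post f s z := tilt f s z * (mass s z)^-1%:E.

Lemma post_ge0 f s z : (0 <= s)%R -> (forall y, 0 <= f y) -> 0 <= post f s z.
Proof.
move=> s0 f0; rewrite /post mule_ge0 ?tilt_ge0// lee_fin invr_ge0 ltW//.
exact: mass_gt0.
Qed.

Lemma measurable_post f s : (0 <= s)%R -> measurable_fun setT f ->
  (forall y, 0 <= f y) -> measurable_fun setT (post f s).
Proof.
move=> s0 mf f0; apply: emeasurable_funM; first exact: measurable_tilt.
apply/measurable_EFinP.
(* Since masses are positive, the inverse equals exp (- ln), a composition of measurable
   functions. *)
rewrite (_ : (fun z => _) = (fun z => expR (- ln (mass s z)))).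
  by do 3 (apply: measurableT_comp => //); exact: measurable_mass.
by apply/funext => z; rewrite expRN lnK// posrE mass_gt0.
Qed.

Lemma post_mass f s z : (0 <= s)%R -> post f s z * (mass s z)%:E = tilt f s z.
Proof.
by move=> s0; rewrite /post -muleA -EFinM mulVf ?mule1// gt_eqF// mass_gt0.
Qed.

Definition pospart i (y : V) : \bar R := (Num.max (y ord0 i) 0)%:E.
Definition negpart i (y : V) : \bar R := (Num.max (- y ord0 i) 0)%:E.

(** Positive and negative parts keep every integral nonnegative, and [fine] makes the mean a total
    measurable function, also over fibres without first moment. *)
Definition post_mean s : V * V -> V := locked (fun z =>
  \row_i (fine (post (pospart i) s z) - fine (post (negpart i) s z))%R).

Lemma post_meanK s z i : post_mean s z ord0 i =
  (fine (post (pospart i) s z) - fine (post (negpart i) s z))%R.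
Proof. by rewrite /post_mean -lock mxE. Qed.

Lemma measurable_pospart i : measurable_fun setT (pospart i).
Proof.
apply/measurable_EFinP; apply: measurable_maxr => //; exact: measurable_coord.
Qed.

Lemma measurable_negpart i : measurable_fun setT (negpart i).
Proof.
apply/measurable_EFinP; apply: measurable_maxr => //; apply: measurableT_comp => //.
exact: measurable_coord.
Qed.

Lemma pospart_ge0 i y : 0 <= pospart i y.
Proof. by rewrite lee_fin le_max lexx orbT. Qed.

Lemma negpart_ge0 i y : 0 <= negpart i y.
Proof. by rewrite lee_fin le_max lexx orbT. Qed.

Lemma measurable_post_mean s : (0 <= s)%R -> measurable_fun setT (post_mean s).
Proof.
move=> s0; apply: measurable_rV => i; under eq_fun do rewrite post_meanK.
apply: measurable_funB; apply: measurableT_comp => //; apply: measurable_post => //.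
- exact: measurable_pospart.
- exact: pospart_ge0.
- exact: measurable_negpart.
- exact: negpart_ge0.
Qed.

End tilt.

Lemma measurable_slice {d1 d2 d3} {A : measurableType d1} {B : measurableType d2}
    {C : measurableType d3} (f : A * B -> C) (x : A) :
  measurable_fun setT f -> measurable_fun setT (fun y => f (x, y)).
Proof. by move=> mf; apply: measurableT_comp => //; exact: measurable_pair1. Qed.

Lemma measurable_restrT {R : realType} {d} {disp} {T : measurableType disp} (s : R)
    (F : T -> paths d (`[0%R, +oo[ : set R)) :
  measurable_fun setT F -> measurable_fun setT (fun z => (F z : paths d `[0%R, s])).
Proof.
move=> mF.
exact: (measurableT_comp (@measurable_restr R d s) mF).
Qed.

(** * Almost sure uniqueness of conditional expectations *)

Section condexp_unique.
Local Open Scope ereal_scope.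
Context {R : realType} {disp} {T : measurableType disp}.
Variables (P : probability T R) (G : set (set T)).
Hypotheses (sG : sigma_algebra setT G) (GT : G `<=` measurable).

(** The event that g1 > g2 belongs to [G], so the integral of the positive function g1 - g2 over it
    vanishes and the event is null. *)
Let condexp_le (f g1 g2 : T -> R) : is_condexp P G f g1 -> is_condexp P G f g2 ->
  {ae P, forall w, (g1 w <= g2 w)%R}.
Proof.
move=> [_ m1 i1 e1] [_ m2 i2 e2].
have gE : @measurable _ (g_sigma_algebraType G) = G by exact: sigma_algebra_id.
have mg (g : T -> R) : (forall B : set R, measurable B -> G (g @^-1` B)) ->
    measurable_fun [set: g_sigma_algebraType G] g.
  by move=> h _ B mB; rewrite setTI gE; exact: h.
have mD := measurable_funB (mg _ m1) (mg _ m2).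
pose A := [set w | (0 < g1 w - g2 w)%R].
have GA : G A.
  have := mD measurableT _ (measurable_itv `]0%R, +oo[); rewrite setTI gE.
  rewrite (_ : _ @^-1` _ = A)//.
  by apply/seteqP; split => w; rewrite /= in_itv/= andbT.
have mA := GT GA.
have mDT : measurable_fun setT (fun w => (g1 w - g2 w)%R).
  by move=> _ B mB; rewrite setTI; apply: GT; have := mD measurableT B mB; rewrite setTI gE.
have iA g : P.-integrable setT (EFin \o g) -> P.-integrable A (EFin \o g) by exact: integrableS.
have D0 : \int[P]_(w in A) `|(g1 w - g2 w)%:E| = 0.
  transitivity (\int[P]_(w in A) ((g1 w)%:E - (g2 w)%:E)).
    by apply: eq_integral => w; rewrite inE /A /= => h; rewrite ger0_norm ?ltW.
  rewrite integralB_EFin//; [|exact: iA|exact: iA].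
  rewrite e1// e2// subee// -(e1 _ GA).
  exact: (integrable_fin_num mA (iA _ i1)).
have mDA : measurable_fun A (fun w => (g1 w - g2 w)%:E).
  by apply/measurable_EFinP; exact: measurable_funTS.
have /ae_eq_integral_abs -/(_ mA mDA) h := D0.
apply: ae_imp h => w h; rewrite leNgt; apply/negP => h12.
have Aw : A w by rewrite /A /= subr_gt0.
by have := h Aw => -[] /eqP; rewrite subr_eq0 gt_eqF.
Qed.

Lemma condexp_unique (f g1 g2 : T -> R) : is_condexp P G f g1 -> is_condexp P G f g2 ->
  {ae P, forall w, g1 w = g2 w}.
Proof.
move=> h1 h2; apply: ae_imp (ae_and (condexp_le h1 h2) (condexp_le h2 h1)) => w [a b].
by apply/eqP; rewrite eq_le a b.
Qed.

Lemma condexp_vec_unique d (f g1 g2 : T -> 'rV[R]_d) :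
  is_condexp_vec P G f g1 -> is_condexp_vec P G f g2 -> {ae P, forall w, g1 w = g2 w}.
Proof.
move=> [_ h1] [_ h2].
have : {ae P, forall w, forall i, g1 w ord0 i = g2 w ord0 i}.
  by apply: filter_forall => i; exact: condexp_unique (h1 i) (h2 i).
by apply: ae_imp => w h; apply/rowP.
Qed.

End condexp_unique.

(** There are too many times for a common null set, but events on which both processes almost surely
    agree are stable under countable operations; the null set depends on [A]. *)
Lemma ae_paths {R : realType} {d} {disp} {T : measurableType disp}
    (P : {measure set T -> \bar R}) (D : set R) (Z Z' : R -> T -> 'rV[R]_d) :
  (forall s, D s -> {ae P, forall w, Z s w = Z' s w}) ->
  forall A : set (paths d D), measurable A ->
  {ae P, forall w, A (Z ^~ w) <-> A (Z' ^~ w)}.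
Proof.
move=> hZ A mA.
pose C := [set A : set (R -> 'rV[R]_d) | {ae P, forall w, A (Z ^~ w) <-> A (Z' ^~ w)}].
suff : C A by [].
move: A mA; apply: smallest_sub; first split.
- by apply: (ae_imp (A := fun=> True)) => //; exact: aeW.
- move=> A CA; apply: ae_imp CA => w; rewrite /= => h.
  by split=> -[h1 h2]; split=> // h3; apply: h2; apply/h.
- move=> F CF; have : {ae P, forall w, forall n, F n (Z ^~ w) <-> F n (Z' ^~ w)} by exact: ae_foralln.
  by apply: ae_imp => w h; split=> -[n _ hn]; exists n => //; apply/h.
- move=> _ [t Dt [B mB <-]]; apply: ae_imp (hZ _ Dt) => w h.
  by rewrite /= h.
Qed.

Section fine_integral.
Local Open Scope ereal_scope.
Context {R : realType} {disp} {T : measurableType disp}.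
Variables (P : {measure set T -> \bar R}) (q : T -> \bar R).
Hypotheses (mq : measurable_fun setT q) (q0 : forall w, 0 <= q w).
Hypothesis hq : \int[P]_w q w < +oo.

Let iq : P.-integrable setT q.
Proof.
by apply/integrableP; split => //; under eq_integral do rewrite gee0_abs//.
Qed.

Lemma ge0_integrable_fine : P.-integrable setT (EFin \o (fine \o q)).
Proof.
apply: (le_integrable measurableT _ _ iq).
  by apply/measurable_EFinP; apply: measurableT_comp.
move=> w _ /=; rewrite gee0_abs// ?lee_fin ?fine_ge0//.
have := q0 w; case: (q w) => [r||]//=.
- by rewrite lee_fin => r0; rewrite ger0_norm.
- by rewrite normr0 leey.
Qed.

Lemma ge0_integral_fine A : measurable A ->
  \int[P]_(w in A) (fine (q w))%:E = \int[P]_(w in A) q w.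
Proof.
move=> mA; apply: ge0_ae_eq_integral => //.
- by apply/measurable_EFinP; apply: measurableT_comp => //; exact: measurable_funTS.
- exact: measurable_funTS.
- by move=> w _; rewrite lee_fin fine_ge0.
- by apply: ae_imp (integrable_ae measurableT iq) => w h _; rewrite fineK// h.
Qed.

End fine_integral.

(** * The Bayesian observation model, entering only through [hmodel] *)

Section model.
Local Open Scope ereal_scope.
Context {R : realType} {d : nat}.
Local Notation V := 'rV[R]_d.
Local Notation Om := (paths d (`[0%R, +oo[ : set R)).
Variables (k : R.-pker V ~> V) (mu : probability V R) (gam : probability Om R).
Hypothesis hgam : wiener gam (fun t (w : Om) => w t).
Context {disp} {T : measurableType disp}.
Variables (P : probability T R) (X Y : T -> V) (Q : R -> T -> V).
Hypotheses (mX : measurable_fun setT X) (mY : measurable_fun setT Y).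
Hypothesis mQ : forall t, (0 <= t)%R -> measurable_fun setT (Q t).
Hypothesis hmodel : forall f : (V * V) * Om -> \bar R,
  measurable_fun setT f -> (forall z, 0 <= f z) ->
  \int[P]_w f ((X w, Y w), path_map Q w) =
  \int[mu]_x \int[fiber k x]_y \int[gam]_w f ((x, y), shift_path (y - x) w).

Lemma weight_expmart_ae s (v : V) : (0 <= s)%R ->
  {ae gam, forall w : Om, expmart s (w s) v = weight s (w s) v}.
Proof.
move=> s0; have [_ h0 _ _] := hgam.
apply: ae_imp h0 => w w0; rewrite /weight; case: eqP => // ->.
by rewrite /expmart w0 dot0l !mul0r subr0 expR0.
Qed.

(** For fixed x and y, the Cameron-Martin formula trades the drift y - x for the weight; Tonelli
    then moves the integral over y inside, where it becomes [tilt]. *)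
Lemma bayes_formula s (f : V * paths d `[0%R, s] -> \bar R) (g : V -> \bar R) : (0 <= s)%R ->
  measurable_fun setT f -> (forall z, 0 <= f z) ->
  measurable_fun setT g -> (forall y, 0 <= g y) ->
  \int[P]_w (f (X w, Q ^~ w) * g (Y w)) =
  \int[mu]_x \int[gam]_w (f (x, w : paths d `[0%R, s]) * tilt k g s (x, w s)).
Proof.
move=> s0 mf f0 mg g0.
pose F (z : (V * V) * Om) := f (z.1.1, z.2 : paths d `[0%R, s]) * g z.1.2.
have mF : measurable_fun setT F.
  apply: emeasurable_funM; last by apply: measurableT_comp => //; apply: measurableT_comp.
  apply: (measurableT_comp mf); apply: measurable_fun_pair.
    exact: measurableT_comp.
  exact: (measurable_restrT measurable_snd).
have := hmodel mF (fun z => mule_ge0 (f0 _) (g0 _)); rewrite /F /= => ->.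
apply: eq_integral => x _.
have mfx : measurable_fun setT (fun w => f (x, w)) := measurable_slice x mf.
pose H (z : V * Om) := f (x, z.2 : paths d `[0%R, s]) * g z.1 * (weight s (z.2 s) (z.1 - x)%R)%:E.
transitivity (\int[fiber k x]_y \int[gam]_w H (y, w)).
  apply: eq_integral => y _.
  transitivity (\int[gam]_w (f (x, w : paths d `[0%R, s]) * g y * (expmart s (w s) (y - x)%R)%:E)).
    apply: (@cameron_martin _ _ _ hgam _ _ s0 (fun w => f (x, w) * g y)).
      exact: emeasurable_funM.
    by move=> w; exact: mule_ge0.
  have mfr : measurable_fun setT (fun w : Om => f (x, w : paths d `[0%R, s]) * g y).
    apply: emeasurable_funM => //.
    exact: (measurableT_comp (g := fun w : Om => (w : paths d `[0%R, s])) mfx (@measurable_restr _ _ s)).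
  apply: ge0_ae_eq_integral => //.
  - apply: emeasurable_funM => //; apply/measurable_EFinP; apply: measurable_expmart => //.
    exact: measurable_evalT.
  - apply: emeasurable_funM => //; apply/measurable_EFinP; apply: measurable_weight => //.
      exact: measurable_evalT.
    exact: (measurable_cst (y - x)%R).
  - by move=> w _; rewrite !mule_ge0// lee_fin expR_ge0.
  - by move=> w _; rewrite !mule_ge0// lee_fin ltW// weight_gt0.
  - by apply: ae_imp (weight_expmart_ae (y - x)%R s0) => w -> _.
have mH : measurable_fun setT H.
  apply: emeasurable_funM.
    apply: emeasurable_funM; last exact: measurableT_comp.
    apply: (measurableT_comp (g := fun z : V * Om => (z.2 : paths d `[0%R, s])) mfx).
    exact: measurable_restrT.
  apply/measurable_EFinP; apply: measurable_weight.
    by apply: (measurableT_comp (f := fun w : Om => w s : V)) => //; exact: measurable_evalT.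
  exact: measurable_rVB.
have H0 z : 0 <= H z by rewrite !mule_ge0// lee_fin ltW// weight_gt0.
transitivity (\int[gam]_w \int[fiber k x]_y H (y, w)).
  exact: (@fubini_tonelli _ _ _ _ _ (fiber k x) gam H mH H0).
apply: eq_integral => w _; rewrite /tilt /H /=.
transitivity (\int[fiber k x]_y (f (x, w) * (g y * (weight s (w s) (y - x)%R)%:E))).
  by apply: eq_integral => y _; rewrite muleA.
apply: ge0_integralZl => //.
- apply: emeasurable_funM => //; apply/measurable_EFinP; apply: measurable_weight => //.
  exact: measurable_rVB.
- by move=> y _; rewrite mule_ge0// lee_fin ltW// weight_gt0.
Qed.

Section post.
Variable s : R.
Hypothesis s0 : (0 <= s)%R.
Let mQs : measurable_fun setT (fun w => (Q ^~ w : paths d `[0%R, s])).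
Proof. by apply: measurable_paths => t; rewrite /= in_itv/= => /andP[t0 _]; exact: mQ. Qed.

Let ss : `[0%R, s]%classic s. Proof. by rewrite /= in_itv/= s0 lexx. Qed.

Let mev : measurable_fun setT (fun z : V * paths d `[0%R, s] => (z.1, z.2 s : V)).
Proof.
apply: measurable_fun_pair => //.
by apply: (measurableT_comp (f := fun w : paths d `[0%R, s] => w s : V)) => //; exact: measurable_eval.
Qed.

(** Bayes' formula is applied on both sides, to [g] on the left and to the constant 1 on the right;
    they match because [post] times the mass is [tilt]. *)
Lemma integral_post (f : V * paths d `[0%R, s] -> \bar R) (g : V -> \bar R) :
  measurable_fun setT f -> (forall z, 0 <= f z) ->
  measurable_fun setT g -> (forall y, 0 <= g y) ->
  \int[P]_w (f (X w, Q ^~ w) * g (Y w)) =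
  \int[P]_w (f (X w, Q ^~ w) * post k g s (X w, Q s w)).
Proof.
move=> mf f0 mg g0; rewrite bayes_formula//.
pose F z := f z * post k g s (z.1, z.2 s).
have mF : measurable_fun setT F.
  apply: emeasurable_funM => //.
  by apply: (measurableT_comp (f := post k g s)) mev; exact: measurable_post.
have F0 z : 0 <= F z by rewrite mule_ge0// post_ge0.
apply/esym; transitivity (\int[P]_w (F (X w, Q ^~ w) * cst 1 (Y w))).
  by apply: eq_integral => w _; rewrite mule1.
transitivity (\int[mu]_x \int[gam]_w (F (x, w : paths d `[0%R, s]) * tilt k (cst 1) s (x, w s))).
  exact: (bayes_formula (g := cst 1) s0 mF F0).
apply: eq_integral => x _; apply: eq_integral => w _.
by rewrite /F /= massE// -muleA post_mass.
Qed.

(** [G] is only required to lie between the events of (X, Q s) and those of X and Q up to time [s].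
    This covers both the observation filtration and the filtration of the Foellmer process. *)
Lemma post_condexp (G : set (set T)) :
  (forall A, G A -> exists2 A' : set (V * paths d `[0%R, s]), measurable A' &
    A = [set w | A' (X w, Q ^~ w)]) ->
  (forall B, measurable B -> G [set w | B (X w, Q s w)]) ->
  (forall i, P.-integrable setT (fun w => (Y w ord0 i)%:E)) ->
  is_condexp_vec P G Y (fun w => post_mean k s (X w, Q s w)).
Proof.
move=> GA GB iY.
have mXQ : measurable_fun setT (fun w => (X w, Q ^~ w : paths d `[0%R, s])).
  exact: measurable_fun_pair.
have mG A : G A -> measurable A.
  by move=> /GA[A' mA' ->]; exact: (measurable_preimage mXQ mA').
pose q g w := post k g s (X w, Q s w).
have mq g : measurable_fun setT g -> (forall y, 0 <= g y) -> measurable_fun setT (q g).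
  move=> mg g0; apply: (measurableT_comp (f := post k g s)); first exact: measurable_post.
  by apply: measurable_fun_pair => //; exact: mQ.
have q0 g w : (forall y, 0 <= g y) -> 0 <= q g w by move=> g0; exact: post_ge0.
have qint g A : measurable_fun setT g -> (forall y, 0 <= g y) -> G A ->
    \int[P]_(w in A) q g w = \int[P]_(w in A) g (Y w).
  move=> mg g0 GAA; have mA := mG _ GAA; have [A' mA' eA] := GA _ GAA.
  rewrite integral_mkcond [RHS]integral_mkcond.
  have e (h : T -> \bar R) : h \_ A = (fun w => (\1_A' (X w, Q ^~ w))%:E * h w).
    apply/funext => w; rewrite patchE eA indicE.
    case: ifPn => h1; rewrite [X in (nat_of_bool X)%:R](_ : _ = (w \in [set w | A' (X w, Q^~ w)])).
    - by rewrite h1 mul1e.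
    - by apply: asbool_equiv_eq.
    - by rewrite (negbTE h1) mul0e.
    - by apply: asbool_equiv_eq.
  rewrite !e; apply/esym.
  by apply: (integral_post (f := fun z => (\1_A' z)%:E)) => //; apply/measurable_EFinP.
have GT : G setT := GB _ measurableT.
have parts i w : (Y w ord0 i)%:E = pospart i (Y w) - negpart i (Y w).
  rewrite /pospart /negpart -EFinB; congr EFin.
  move: (Y w ord0 i) => a; rewrite !maxElt oppr_lt0.
  by case: (ltrgtP 0%R a) => h; rewrite -?h ?sub0r ?subr0 ?opprK ?oppr0.
split => [B mB|i].
  have := GB _ (measurable_preimage (measurable_post_mean k s0) mB).
  by [].
have partoo (g : V -> \bar R) : measurable_fun setT g -> (forall y, 0 <= g y) ->
    (forall y : V, g y <= `|(y ord0 i)%:E|) -> \int[P]_w q g w < +oo.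
  move=> mg g0 gle; rewrite qint//.
  have /integrableP[_] := iY i; apply: le_lt_trans; apply: ge0_le_integral => //.
    exact: measurableT_comp.
  by apply: measurableT_comp => //; exact: measurable_int (iY i).
have ip : \int[P]_w q (pospart i) w < +oo.
  apply: partoo; [exact: measurable_pospart|exact: pospart_ge0|move=> y].
  by rewrite lee_fin ge_max ler_norm normr_ge0.
have inn : \int[P]_w q (negpart i) w < +oo.
  apply: partoo; [exact: measurable_negpart|exact: negpart_ge0|move=> y].
  by rewrite lee_fin ge_max -normrN ler_norm normr_ge0.
have mqp := mq _ (@measurable_pospart _ _ i) (@pospart_ge0 _ _ i).
have mqn := mq _ (@measurable_negpart _ _ i) (@negpart_ge0 _ _ i).
have qp0 w := q0 _ w (@pospart_ge0 _ _ i).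
have qn0 w := q0 _ w (@negpart_ge0 _ _ i).
have Ip := ge0_integrable_fine mqp qp0 ip.
have In := ge0_integrable_fine mqn qn0 inn.
have zE w : (post_mean k s (X w, Q s w) ord0 i)%:E =
    (EFin \o (fine \o q (pospart i))) w - (EFin \o (fine \o q (negpart i))) w.
  by rewrite post_meanK EFinB.
split; first exact: iY.
- move=> B mB.
  apply: (GB [set z | B (post_mean k s z ord0 i)]).
  by apply: (measurable_preimage (F := fun z => post_mean k s z ord0 i)) => //;
    apply: measurable_coordT; exact: measurable_post_mean.
- rewrite (_ : EFin \o _ = (EFin \o (fine \o q (pospart i))) \- (EFin \o (fine \o q (negpart i)))).
    exact: integrableB.
  by apply/funext => w; exact: zE.
- move=> A GAA; have mA := mG _ GAA.
  have sub f : P.-integrable setT f -> P.-integrable A f by exact: integrableS.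
  transitivity (\int[P]_(w in A) q (pospart i) w - \int[P]_(w in A) q (negpart i) w).
    transitivity (\int[P]_(w in A) (fine (q (pospart i) w))%:E -
        \int[P]_(w in A) (fine (q (negpart i) w))%:E).
      rewrite -integralB_EFin//; last 2 first.
      + exact: sub.
      + exact: sub.
      by apply: eq_integral => w _; exact: zE.
    by rewrite (ge0_integral_fine mqp qp0 ip mA) (ge0_integral_fine mqn qn0 inn mA).
  rewrite !qint//; [|exact: measurable_negpart|exact: negpart_ge0|
     exact: measurable_pospart|exact: pospart_ge0].
  have Jp : P.-integrable setT (fun w => pospart i (Y w)).
    apply: (le_integrable measurableT _ _ (iY i)).
      by apply: (measurableT_comp (f := pospart i)) => //; exact: measurable_pospart.
    move=> w _; rewrite gee0_abs ?pospart_ge0//.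
    by rewrite lee_fin ge_max ler_norm normr_ge0.
  have Jn : P.-integrable setT (fun w => negpart i (Y w)).
    apply: (le_integrable measurableT _ _ (iY i)).
      by apply: (measurableT_comp (f := negpart i)) => //; exact: measurable_negpart.
    move=> w _; rewrite gee0_abs ?negpart_ge0//.
    by rewrite lee_fin ge_max -normrN ler_norm normr_ge0.
  rewrite -integralB_EFin//; last 2 first.
  + exact: sub.
  + exact: sub.
  by apply: eq_integral => w _; rewrite parts.
Qed.

End post.

(** The right-hand side involves only [mu], [k] and Wiener measure, so any two realizations of the
    model give the same law. *)
Lemma post_mean_law (Z : R -> T -> V) :
  (forall s, (0 <= s)%R -> measurable_fun setT (Z s)) ->
  (forall s, (0 <= s)%R -> {ae P, forall w, Z s w = post_mean k s (X w, Q s w)}) ->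
  forall A : set Om, measurable A ->
  path_law P Z A = \int[mu]_x \int[fiber k x]_y \int[gam]_w
    (\1_A (fun s => post_mean k s (x, shift_path (y - x) w s)))%:E.
Proof.
move=> mZ hZ A mA.
pose Z' s w := post_mean k s (X w, Q s w).
have mZ' s : (0 <= s)%R -> measurable_fun setT (Z' s).
  move=> s0; apply: (measurableT_comp (f := post_mean k s)); first exact: measurable_post_mean.
  by apply: measurable_fun_pair => //; exact: mQ.
pose Psi (z : (V * V) * Om) : Om := fun s => post_mean k s (z.1.1, z.2 s).
have mPsi : measurable_fun setT Psi.
  apply: measurable_paths => s; rewrite /= in_itv/= andbT => s0.
  apply: (measurableT_comp (f := post_mean k s)); first exact: measurable_post_mean.
  apply: measurable_fun_pair; first exact: measurableT_comp.
  by apply: (measurableT_comp (f := fun w : Om => w s : V)) => //; exact: measurable_evalT.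
transitivity (path_law P Z' A).
  apply: eq_measure_ae.
  - exact: (measurable_preimage (measurable_path_map mZ) mA).
  - exact: (measurable_preimage (measurable_path_map mZ') mA).
  - by apply: ae_paths mA => s; rewrite /= in_itv/= andbT; exact: hZ.
transitivity (\int[P]_w (\1_A (Psi ((X w, Y w), path_map Q w)))%:E).
  have mA' := measurable_preimage (measurable_path_map mZ') mA.
  transitivity (\int[P]_w (\1_(path_map Z' @^-1` A) w)%:E).
    by rewrite integral_indic// setIT.
  by apply: eq_integral => w _; rewrite !indicE.
have mf : measurable_fun setT (fun z => (\1_A (Psi z) : R)%:E).
  by apply/measurable_EFinP; apply: measurableT_comp mPsi; exact: measurable_indic.
have f0 z : 0 <= (\1_A (Psi z) : R)%:E by rewrite lee_fin.
exact: (hmodel mf f0).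
Qed.

End model.

(** Reduces continuity in a real parameter to sequences, for which dominated convergence is
    available. *)
Lemma within_cvg_seq {R : realType} {T U : pseudoMetricType R} (A : set T) (f : T -> U) (x : T)
    (l : U) :
  (forall u : nat -> T, (forall n, A (u n)) -> u @ \oo --> x -> f \o u @ \oo --> l) ->
  f @ within A (nbhs x) --> l.
Proof.
move=> h; apply/cvg_ballP => e e0; apply: contrapT => hn.
have /choice[u hu] : forall n : nat, exists y, [/\ A y, ball x n.+1%:R^-1 y & ~ ball l e (f y)].
  move=> n; apply: contrapT => hy; apply: hn.
  apply/nbhs_ballP; exists n.+1%:R^-1 => /=; first by rewrite invr_gt0.
  by move=> y xy Ay; apply: contrapT => fy; apply: hy; exists y.
have /cvg_ballP/(_ _ e0) : f \o u @ \oo --> l.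
  apply: h => [n|]; first by have [] := hu n.
  apply/cvg_ballP => r r0; near=> n; have [_ un _] := hu n.
  apply: le_ball un; apply: ltW; near: n.
  exact: (near_infty_natSinv_lt (PosNum r0)).
by move=> [n _ /(_ n (leqnn n))]; have [] := hu n.
Unshelve. all: by end_near. Qed.

Lemma cvg_rV {R : realType} {d} (u : nat -> 'rV[R]_d) (l : 'rV[R]_d) :
  (forall i, (fun n => u n ord0 i) @ \oo --> l ord0 i) -> u @ \oo --> l.
Proof.
move=> h; apply/cvg_ballP => e e0.
have : \forall n \near \oo, forall i, ball (l ord0 i) e (u n ord0 i).
  by apply: filter_forall => i; move/cvg_ballP : (h i); apply.
by apply: filterS => n hn; split => // j i; rewrite !ord1.
Qed.

Lemma cvg_rV_coord {R : realType} {d} (u : nat -> 'rV[R]_d) (l : 'rV[R]_d) i :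
  u @ \oo --> l -> (fun n => u n ord0 i) @ \oo --> l ord0 i.
Proof.
move=> /cvg_ballP h; apply/cvg_ballP => e e0.
by apply: filterS (h e e0) => n [_ hn]; exact: hn.
Qed.

Lemma cvg_dot {R : realType} {d} (u v : nat -> 'rV[R]_d) (l m : 'rV[R]_d) :
  u @ \oo --> l -> v @ \oo --> m -> (fun n => dot (u n) (v n)) @ \oo --> dot l m.
Proof.
move=> ul vm; rewrite /dot.
apply: cvg_big => [|i _]; first by move=> [a b]; exact: add_continuous.
by apply: cvgM; exact: cvg_rV_coord.
Qed.

Lemma and3_conj A B C : [/\ A, B & C] -> A /\ B /\ C. Proof. by case. Qed.

(** * Dependence of the posterior mean on the observation *)

Section tilt_cvg.
Local Open Scope ereal_scope.
Context {R : realType} {d : nat}.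
Local Notation V := 'rV[R]_d.
Variables (k : R.-pker V ~> V) (x : V).

Lemma tilt_cvg (g D : V -> \bar R) (s_ : nat -> R) (r_ : nat -> V) s r :
  measurable_fun setT g -> (forall y, 0 <= g y) -> (forall y, g y \is a fin_num) ->
  (fiber k x).-integrable setT D ->
  (forall n y, g y * (weight (s_ n) (r_ n) (y - x))%:E <= D y) ->
  (forall y, (fun n => weight (s_ n) (r_ n) (y - x)) @ \oo --> weight s r (y - x)%R) ->
  (fun n => tilt k g (s_ n) (x, r_ n)) @ \oo --> tilt k g s (x, r).
Proof.
move=> mg g0 gf iD gD wc.
have mgw s' r' : measurable_fun setT (fun y => g y * (weight s' r' (y - x)%R)%:E).
  apply: emeasurable_funM => //; apply/measurable_EFinP; apply: measurable_weight => //.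
  exact: measurable_rVB.
have gw0 s' r' y : 0 <= g y * (weight s' r' (y - x)%R)%:E.
  by rewrite mule_ge0// lee_fin ltW// weight_gt0.
apply: (proj2 (proj2 (and3_conj (dominated_convergence (mu := fiber k x) measurableT
  (f_ := fun n y => g y * (weight (s_ n) (r_ n) (y - x)%R)%:E)
  (f := fun y => g y * (weight s r (y - x)%R)%:E) (g := D) _ _ _ iD _)))).
- by move=> n; exact: mgw.
- exact: mgw.
- apply: aeW => y _; apply: cvgeZl => //.
  by apply: cvg_EFin; [exact: nearW|exact: wc].
- by apply: aeW => y n _; rewrite gee0_abs.
Qed.

Lemma mass_cvg (s_ : nat -> R) (r_ : nat -> V) s r : (0 <= s)%R ->
  (fun n => tilt k (cst 1) (s_ n) (x, r_ n)) @ \oo --> tilt k (cst 1) s (x, r) ->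
  (fun n => mass k (s_ n) (x, r_ n)) @ \oo --> mass k s (x, r).
Proof.
move=> s0; rewrite massE//.
have -> : (fun n => mass k (s_ n) (x, r_ n)) = fine \o (fun n => tilt k (cst 1) (s_ n) (x, r_ n)).
  by apply/funext => n; rewrite massK.
exact: fine_cvg.
Qed.

Lemma post_mean_cvg (s_ : nat -> R) (r_ : nat -> V) s r :
  (forall n, (0 <= s_ n)%R) -> (0 <= s)%R ->
  (fun n => tilt k (cst 1) (s_ n) (x, r_ n)) @ \oo --> tilt k (cst 1) s (x, r) ->
  (forall i g, g = pospart i \/ g = negpart i -> tilt k g s (x, r) \is a fin_num /\
    (fun n => tilt k g (s_ n) (x, r_ n)) @ \oo --> tilt k g s (x, r)) ->
  (fun n => post_mean k (s_ n) (x, r_ n)) @ \oo --> post_mean k s (x, r).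
Proof.
move=> sn0 s0 c1 cg; apply: cvg_rV => i; rewrite [X in _ --> X]post_meanK.
have -> : (fun n => post_mean k (s_ n) (x, r_ n) ord0 i) = (fun n =>
    (fine (post k (pospart i) (s_ n) (x, r_ n)) - fine (post k (negpart i) (s_ n) (x, r_ n)))%R).
  by apply/funext => n; rewrite post_meanK.
have cL : (fun n => (mass k (s_ n) (x, r_ n))^-1%:E) @ \oo --> (mass k s (x, r))^-1%:E.
  apply: cvg_EFin; first exact: nearW.
  apply: cvgV; first by rewrite gt_eqF// mass_gt0.
  exact: mass_cvg.
have cq g : g = pospart i \/ g = negpart i ->
    fine (post k g (s_ n) (x, r_ n)) @[n --> \oo] --> fine (post k g s (x, r)).
  move=> hg; have [fg cgg] := cg i g hg.
  have fp : post k g s (x, r) \is a fin_num by rewrite /post fin_numM.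
  apply: fine_cvg; rewrite fineK//; apply: cvgeM => //.
  by rewrite mule_def_fin.
by apply: cvgB; apply: cq; [left|right].
Qed.

End tilt_cvg.

Section tilt_continuous.
Local Open Scope ereal_scope.
Context {R : realType} {d : nat}.
Local Notation V := 'rV[R]_d.
Variables (k : R.-pker V ~> V) (x : V).
Variables (s_ : nat -> R) (r_ : nat -> V) (s : R) (r : V).
Hypotheses (sn0 : forall n, (0 < s_ n)%R) (s0 : (0 < s)%R).
Hypotheses (cs : s_ @ \oo --> s) (cr : r_ @ \oo --> r).

Let weight_cvg v : (fun n => weight (s_ n) (r_ n) v) @ \oo --> weight s r v.
Proof.
have -> : (fun n => weight (s_ n) (r_ n) v) = (fun n => expmart (s_ n) (r_ n) v).
  by apply/funext => n; rewrite /weight gt_eqF.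
rewrite /weight gt_eqF//; apply: continuous_cvg; first exact: continuous_expR.
apply: cvgB; first by apply: cvg_dot => //; exact: cvg_cst.
by do 2 (apply: cvgM; last exact: cvg_cst).
Qed.

(** The bounds of [weight_le] converge, because the limit time is positive; hence they are
    bounded. *)
Let weight_bounded : exists C : R, forall n v, (weight (s_ n) (r_ n) v <= C)%R.
Proof.
have : (fun n => expR (dot (r_ n) (r_ n) / (s_ n *+ 2))) @ \oo --> expR (dot r r / (s *+ 2)).
  apply: continuous_cvg; first exact: continuous_expR.
  apply: cvgM; first exact: cvg_dot.
  apply: (@cvgV _ _ _ _ (fun n => s_ n *+ 2)%R); first by rewrite mulrn_eq0/= gt_eqF.
  by rewrite mulr2n; apply: cvgD.
move=> /cvgP/cvg_seq_bounded [M [_ /(_ (M + 1)%R)]]; rewrite ltrDl ltr01 => /(_ isT) h.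
exists (M + 1)%R => n v; apply: le_trans (weight_le _ _ (ltW (sn0 n))) _.
by apply: le_trans (h n Logic.I); exact: ler_norm.
Qed.

Lemma tilt_cvg_pos (g : V -> \bar R) :
  measurable_fun setT g -> (forall y, 0 <= g y) -> (forall y, g y \is a fin_num) ->
  (fiber k x).-integrable setT g ->
  (fun n => tilt k g (s_ n) (x, r_ n)) @ \oo --> tilt k g s (x, r).
Proof.
move=> mg g0 gf ig; have [C hC] := weight_bounded.
apply: (tilt_cvg (D := fun y => C%:E * g y)) => //.
  exact: integrableZl.
by move=> n y; rewrite muleC lee_wpmul2r// lee_fin.
Qed.

Lemma tilt_fin_num (g : V -> \bar R) :
  measurable_fun setT g -> (forall y, 0 <= g y) ->
  (fiber k x).-integrable setT g -> tilt k g s (x, r) \is a fin_num.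
Proof.
move=> mg g0 ig; rewrite ge0_fin_numE ?tilt_ge0//.
pose C := expR (dot r r / (s *+ 2)).
apply: (@le_lt_trans _ _ (\int[fiber k x]_y (C%:E * g y))).
  apply: ge0_le_integral => //.
  - by move=> y _; rewrite mule_ge0// lee_fin ltW// weight_gt0.
  - apply: emeasurable_funM => //; apply/measurable_EFinP; apply: measurable_weight => //.
    exact: measurable_rVB.
  - by apply: emeasurable_funM.
  - by move=> y _; rewrite muleC lee_wpmul2r// lee_fin weight_le// ltW.
by apply: integrable_lty => //; exact: integrableZl.
Qed.

End tilt_continuous.

Section moments.
Local Open Scope ereal_scope.
Context {R : realType} {d : nat}.
Local Notation V := 'rV[R]_d.
Variables (k : R.-pker V ~> V) (x : V).
Hypothesis ik : forall i, (fiber k x).-integrable setT (fun y : V => (y ord0 i)%:E).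

Lemma integrable_part i (g : V -> \bar R) : g = pospart i \/ g = negpart i ->
  [/\ measurable_fun setT g, (forall y, 0 <= g y), (forall y, g y \is a fin_num) &
    (fiber k x).-integrable setT g].
Proof.
move=> h; have [mg g0 gf gl] : [/\ measurable_fun setT g, (forall y, 0 <= g y),
    (forall y, g y \is a fin_num) & forall y, g y <= `|(y ord0 i)%:E|].
  case: h => ->; split=> //.
  - exact: measurable_pospart.
  - exact: pospart_ge0.
  - by move=> y; rewrite lee_fin ge_max ler_norm normr_ge0.
  - exact: measurable_negpart.
  - exact: negpart_ge0.
  - by move=> y; rewrite lee_fin ge_max -normrN ler_norm normr_ge0.
split => //; apply: (le_integrable measurableT mg _ (ik i)) => y _.
by rewrite gee0_abs.
Qed.

Let i1 : (fiber k x).-integrable setT (cst 1 : V -> \bar R).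
Proof.
apply/integrableP; split => //; rewrite (eq_integral (cst 1)); last first.
  by move=> y _; rewrite /= normr1.
by rewrite integral_cst// mul1e [X in X < _](_ : _ = 1) ?ltry//; exact: probability_setT.
Qed.

Lemma post_mean_cvg_pos (s_ : nat -> R) (r_ : nat -> V) (s : R) (r : V) :
  (forall n, (0 < s_ n)%R) -> (0 < s)%R -> s_ @ \oo --> s -> r_ @ \oo --> r ->
  (fun n => post_mean k (s_ n) (x, r_ n)) @ \oo --> post_mean k s (x, r).
Proof.
move=> sn0 s0 cs cr; apply: post_mean_cvg.
- by move=> n; exact: ltW.
- exact: ltW.
- by apply: tilt_cvg_pos.
- move=> i g /integrable_part[mg g0 gf ig]; split; last exact: tilt_cvg_pos.
  exact: tilt_fin_num.
Qed.

Lemma mass_cvg_pos (s_ : nat -> R) (r_ : nat -> V) (s : R) (r : V) :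
  (forall n, (0 < s_ n)%R) -> (0 < s)%R -> s_ @ \oo --> s -> r_ @ \oo --> r ->
  (fun n => mass k (s_ n) (x, r_ n)) @ \oo --> mass k s (x, r).
Proof.
move=> sn0 s0 cs cr; apply: mass_cvg; first exact: ltW.
by apply: tilt_cvg_pos.
Qed.

End moments.

Lemma integral_lin2 {R : realType} {disp} {T : measurableType disp}
    (m : {measure set T -> \bar R}) (f g : T -> R) (a b : R) :
  m.-integrable setT (EFin \o f) -> m.-integrable setT (EFin \o g) ->
  m.-integrable setT (fun y => (f y * a - g y * b)%:E) /\
  (\int[m]_y (f y * a - g y * b)%:E =
   \int[m]_y (f y)%:E * a%:E - \int[m]_y (g y)%:E * b%:E)%E.
Proof.
move=> iF iG; have iFa := integrableZr measurableT a iF; have iGb := integrableZr measurableT b iG.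
split; first exact: (integrableB measurableT iFa iGb).
transitivity (\int[m]_y (((EFin \o f) y * a%:E) - ((EFin \o g) y * b%:E)))%E.
  by apply: eq_integral.
rewrite (integralB measurableT iFa iGb).
by rewrite (integralZr measurableT iF) (integralZr measurableT iG).
Qed.

Section affine_null.
Local Open Scope ereal_scope.
Context {R : realType} {d : nat}.
Local Notation V := 'rV[R]_d.
Variables (m : probability V R) (p : V -> R).
Hypothesis im : forall i, m.-integrable setT (fun y : V => (y ord0 i)%:E).
Hypothesis ip : forall g : V -> R, m.-integrable setT (EFin \o g) ->
  m.-integrable setT (fun y => (g y * p y)%:E).
Hypotheses (p1 : \int[m]_y (p y)%:E = 0) (py : forall i, \int[m]_y (y ord0 i * p y)%:E = 0).

Let N (g : V -> R) := m.-integrable setT (EFin \o g) /\ \int[m]_y (g y * p y)%:E = 0.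

Let ND g h : N g -> N h -> N (fun y => g y + h y)%R.
Proof.
move=> [ig g0] [ih h0]; split; first exact: (integrableD measurableT ig ih).
transitivity (\int[m]_y ((g y * p y)%:E + (h y * p y)%:E)).
  by apply: eq_integral => y _; rewrite mulrDl EFinD.
by rewrite (integralD measurableT (ip ig) (ip ih)) g0 h0 adde0.
Qed.

Let NZ a g : N g -> N (fun y => a * g y)%R.
Proof.
move=> [ig g0]; split; first exact: (integrableZl measurableT a ig).
transitivity (\int[m]_y (a%:E * (g y * p y)%:E)).
  by apply: eq_integral => y _; rewrite -mulrA EFinM.
by rewrite (integralZl measurableT (ip ig)) g0 mule0.
Qed.

Lemma affine_null (u : V) (a : R) :
  m.-integrable setT (fun y => (dot u y + a)%:E) /\ \int[m]_y ((dot u y + a) * p y)%:E = 0.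
Proof.
have N1 : N (cst 1%R).
  split; first exact: finite_measure_integrable_cst.
  by under eq_integral do rewrite mul1r.
have Ny i : N (fun y : V => y ord0 i) by split; [exact: im|exact: py].
have Nsum (l : seq 'I_d) : N (fun y : V => \sum_(i <- l) u ord0 i * y ord0 i)%R.
  elim: l => [|i l IH].
    rewrite (_ : (fun y => _) = (fun y => 0 * cst 1 y)%R); first exact: NZ.
    by apply/funext => y; rewrite big_nil mul0r.
  rewrite (_ : (fun y => _) = (fun y : V => u ord0 i * y ord0 i + \sum_(i <- l) u ord0 i * y ord0 i)%R).
    exact: (ND (NZ _ (Ny i)) IH).
  by apply/funext => y; rewrite big_cons.
have Na := NZ a N1; rewrite (_ : (fun y => _) = cst a) in Na; last first.
  by apply/funext => y; rewrite mulr1.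
exact: (ND (Nsum _) Na).
Qed.

End affine_null.

(* Up to a positive factor, the difference [p] of the two normalized weights
   has the sign of [phi - c], where [phi y = dot (r - r') (y - x)]; equal means
   make [p] orthogonal to affine functions, so [(phi - c) * p] vanishes. *)
Section rigidity.
Local Open Scope ereal_scope.
Context {R : realType} {d : nat}.
Local Notation V := 'rV[R]_d.
Variables (k : R.-pker V ~> V) (x : V) (s : R).
Hypothesis ik : forall i, (fiber k x).-integrable setT (fun y : V => (y ord0 i)%:E).
Hypothesis s0 : (0 < s)%R.

Let mw r : measurable_fun setT (fun y : V => weight s r (y - x)%R).
Proof. by apply: measurable_weight => //; exact: measurable_rVB. Qed.

Let iw r (g : V -> R) : (fiber k x).-integrable setT (EFin \o g) ->
  (fiber k x).-integrable setT (fun y => (g y * weight s r (y - x)%R)%:E).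
Proof.
move=> ig.
pose C := expR (dot r r / (s *+ 2)).
have iC : (fiber k x).-integrable setT (fun y => C%:E * (EFin \o g) y) by exact: integrableZl.
have mg : measurable_fun setT g by have /measurable_int/measurable_EFinP := ig.
apply: (le_integrable measurableT _ _ iC).
  by apply/measurable_EFinP; exact: measurable_funM.
move=> y _ /=; rewrite lee_fin !normrM mulrC ler_wpM2r//.
rewrite !ger0_norm ?expR_ge0//; first by rewrite weight_le// ltW.
by rewrite ltW// weight_gt0.
Qed.

Lemma post_meanE r i : (post_mean k s (x, r) ord0 i)%:E =
  \int[fiber k x]_y (y ord0 i * weight s r (y - x)%R)%:E * (mass k s (x, r))^-1%:E.
Proof.
have fin g : g = pospart i \/ g = negpart i -> tilt k g s (x, r) \is a fin_num.
  by move=> /(integrable_part ik)[mg g0 gf ig]; exact: tilt_fin_num.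
rewrite post_meanK EFinB !fineK ?fin_numM ?fin//; [|by right|by left].
rewrite /post -muleBl//; last by rewrite fin_num_adde_defl// fin_numN fin//; right.
congr (_ * _); rewrite /tilt /= -integralB//.
  apply: eq_integral => y _ /=; rewrite -!EFinM -EFinB -mulrBl; congr (_ * _)%:E.
  move: (y ord0 i) => a; rewrite !maxElt oppr_lt0.
  by case: (ltrgtP 0%R a) => h; rewrite -?h ?sub0r ?subr0 ?opprK ?oppr0.
  by apply: iw; have [] := integrable_part ik (or_introl (erefl (pospart i))).
by apply: iw; have [] := integrable_part ik (or_intror (erefl (negpart i))).
Qed.

Lemma post_mean_rigid r r' : post_mean k s (x, r) = post_mean k s (x, r') ->
  exists2 c : R, (0 < c)%R &
    {ae fiber k x, forall y, expmart s r (y - x)%R = (c * expmart s r' (y - x))%R}.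
Proof.
move=> rr'.
(* The masses, and [p] below, are introduced through existential packages so that their integrals
   stay opaque. *)
have [L eL] : {L | L = mass k s (x, r)} by exists (mass k s (x, r)).
have [L' eL'] : {L' | L' = mass k s (x, r')} by exists (mass k s (x, r')).
have L0 : (0 < L)%R by rewrite eL; apply: mass_gt0; exact: ltW.
have L'0 : (0 < L')%R by rewrite eL'; apply: mass_gt0; exact: ltW.
have [p p_def] : {p : V -> R | forall y,
    p y = (weight s r (y - x) / L - weight s r' (y - x) / L')%R} by eexists.
have gpE g y : (g y * p y = g y * weight s r (y - x) * L^-1 - g y * weight s r' (y - x) * L'^-1)%R.
  by rewrite p_def mulrBr !mulrA.
have ip g : (fiber k x).-integrable setT (EFin \o g) ->
    (fiber k x).-integrable setT (fun y => (g y * p y)%:E).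
  move=> ig; under eq_fun do rewrite gpE.
  by have [] := integral_lin2 L^-1 L'^-1 (iw r ig) (iw r' ig).
have i1 : (fiber k x).-integrable setT (EFin \o cst 1%R).
  exact: finite_measure_integrable_cst.
have pE g : (fiber k x).-integrable setT (EFin \o g) -> \int[fiber k x]_y (g y * p y)%:E =
   \int[fiber k x]_y (g y * weight s r (y - x)%R)%:E * L^-1%:E -
   \int[fiber k x]_y (g y * weight s r' (y - x)%R)%:E * L'^-1%:E.
  move=> ig; under eq_integral do rewrite gpE.
  by have [] := integral_lin2 L^-1 L'^-1 (iw r ig) (iw r' ig).
have p1 : \int[fiber k x]_y (p y)%:E = 0.
  transitivity (\int[fiber k x]_y (cst 1%R y * p y)%:E).
    by apply: eq_integral => y _; rewrite mul1r.
  rewrite (pE _ i1).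
  have e q : \int[fiber k x]_y (cst 1%R y * weight s q (y - x))%:E = (mass k s (x, q))%:E.
    by rewrite -massE ?ltW.
  by rewrite !e -eL -eL' -!EFinM !mulfV ?gt_eqF// subee.
have py i : \int[fiber k x]_y (y ord0 i * p y)%:E = 0.
  by rewrite (pE _ (ik i)) eL eL' -!post_meanE rr' subee.
pose u := (r - r')%R.
(* The value of [phi] at which the two normalized weights coincide. *)
pose c := ln (L / L').
pose phi y := (dot u (y - x))%R.
have phiE y : (phi y - c = dot u y + - (dot u x + c))%R.
  by rewrite /phi [dot u (y - x)]dotC dotBl dotC [dot x u]dotC/=; ring.
have [Iphi Nphi] := affine_null ik ip p1 py u (- (dot u x + c))%R.
have wE y : weight s r (y - x) = (weight s r' (y - x) * expR (phi y))%R.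
  rewrite /weight gt_eqF// /expmart -expRD /phi /u dotBl; congr expR; ring.
have ec : expR c = (L / L')%R by rewrite lnK// posrE divr_gt0.
have pE' y : p y = (weight s r' (y - x) / L * (expR (phi y) - expR c))%R.
  by rewrite p_def wE ec; field; rewrite !gt_eqF.
have pos y : (0 <= (phi y - c) * p y)%R.
  have q0 : (0 <= weight s r' (y - x) / L)%R by rewrite divr_ge0 ?ltW// weight_gt0.
  rewrite pE' mulrCA mulr_ge0//.
  have [h|h] := leP c (phi y).
    by rewrite mulr_ge0// subr_ge0// ler_expR.
  by rewrite mulr_le0// subr_le0 ?ler_expR// ltW.
exists (expR c); first exact: expR_gt0.
have mf : measurable_fun setT (fun y => ((phi y - c) * p y)%:E).
  under eq_fun do rewrite phiE.
  exact: (measurable_int _ (ip (fun y => dot u y + - (dot u x + c))%R Iphi)).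
have h0 : \int[fiber k x]_y `|((phi y - c) * p y)%:E| = 0.
  by rewrite -Nphi; apply: eq_integral => y _; rewrite gee0_abs ?lee_fin// phiE.
have /ae_eq_integral_abs -/(_ measurableT mf) := h0.
apply: ae_imp => y /(_ Logic.I) [] /eqP.
rewrite mulf_eq0 pE' mulf_eq0 subr_eq0 => h.
have {h} : phi y = c.
  apply/eqP; case/orP: h => // /orP[].
    by rewrite gt_eqF// divr_gt0// weight_gt0.
  by rewrite subr_eq0 => /eqP/expR_inj ->.
have := wE y; rewrite /weight gt_eqF// => -> ->; exact: mulrC.
Qed.

End rigidity.

(** * Measurable factorization through a continuous map *)

Section selection.
Context {R : realType} {d : nat}.
Local Notation V := 'rV[R]_d.

Definition rat_point (i : nat) : V :=
  \row_j ratr (odflt 0 (unpickle i : option 'rV[rat]_d) ord0 j).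

Lemma rat_point_dense (r : V) (e : R) : 0 < e -> exists i, ball r e (rat_point i).
Proof.
move=> e0.
have /choice[q hq] : forall j : 'I_d, exists q : rat, `|r ord0 j - ratr q| < e.
  move=> j; have /rat_in_itvoo[q] : r ord0 j - e < r ord0 j + e by rewrite ltrD2l gtrN.
  by rewrite in_itv/= => /andP[h1 h2]; exists q; rewrite distrC ltr_distl h1 h2.
exists (pickle (\row_j q j : 'rV[rat]_d)); split => // i j.
by rewrite /rat_point pickleK mxE/= mxE ord1; exact: hq.
Qed.

(* A Borel function of [z] which takes the value [h r] at [z = b r] whenever [h]
   factors through [b]; it makes [h r] measurable with respect to [b r]. *)
Definition sel (b : V -> V) (h : V -> R) (z : V) : \bar R :=
  esups (fun n => einfs (fun m => esups (fun i =>
    if (`|rat_point i| <= n%:R) && (`|b (rat_point i) - z| < m.+1%:R^-1)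
    then (h (rat_point i))%:E else 0%E) 0) 0) 0.

(* On a compact cube, [b q] close to [b r0] forces [h q] close to [h r0]. *)
Lemma selE (b : V -> V) (h : V -> R) (r0 : V) :
  continuous b -> continuous h -> (forall r, 0 <= h r) ->
  (forall r, b r = b r0 -> h r = h r0) -> sel b h (b r0) = (h r0)%:E.
Proof.
move=> cb ch h0 hb; apply/eqP; rewrite eq_le; apply/andP; split.
  apply: ub_ereal_sup => _ [n _ <-].
  apply/lee_addgt0Pr => e e0.
  (* The points of the cube where [h] exceeds its value at [r0] by at least [e]. The image of this
     compact set under [b] misses [b r0], hence a whole neighbourhood of it. *)
  pose K := [set r : V | `|r| <= n%:R /\ h r0 + e <= h r].
  have cK : compact K.
    apply: bounded_closed_compact.
      by exists n%:R; split => // M nM r [hr _]; exact: (le_trans hr (ltW nM)).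
    rewrite (_ : K = (fun r : V => `|r|) @^-1` [set x | x <= n%:R] `&`
      h @^-1` [set x | h r0 + e <= x]); last by apply/seteqP; split => r [].
    apply: closedI.
      by apply: closed_comp; [move=> r _; exact: norm_continuous|exact: closed_le].
    by apply: closed_comp; [move=> r _; exact: ch|exact: closed_ge].
  have cbK : compact (b @` K).
    apply: continuous_compact => //; apply: continuous_subspaceT => r; exact: cb.
  have : nbhs (b r0) (~` (b @` K)).
    apply: open_nbhs_nbhs; split.
      by apply: closed_openC; apply: compact_closed => //; exact: norm_hausdorff.
    move=> [r [_ hr]] /hb e1; move: hr; rewrite e1 gerDl leNgt e0 //.
  move=> /nbhs_ballP[a /= a0 ha].
  have [m hm] : exists m : nat, m.+1%:R^-1 < a.
    have [m _ /(_ m (leqnn m)) hm] := near_infty_natSinv_lt (PosNum a0).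
    by exists m.
  apply: (@le_trans _ _ (esups (fun i =>
    if (`|rat_point i| <= n%:R) && (`|b (rat_point i) - b r0| < m.+1%:R^-1)
    then (h (rat_point i))%:E else 0%E) 0)).
    by apply: ereal_inf_lbound; exists m.
  (* Rational points that fail the test contribute 0, which is harmless because [h] is
     nonnegative. *)
  apply: ub_ereal_sup => _ [i _ <-]; case: ifPn => [/andP[c1 c2]|_]; last first.
    by rewrite lee_fin addr_ge0// ltW.
  rewrite -EFinD lee_fin leNgt; apply/negP => c3.
  apply: (ha (b (rat_point i))); last by exists (rat_point i) => //; split => //; exact: ltW.
  by rewrite -ball_normE /= distrC (lt_trans c2).
(* A cube containing the unit ball around [r0]; rational points close to [r0] then pass every test
   and have [h] close to [h r0]. *)
have [n hn] : exists n : nat, `|r0| + 1 <= n%:R.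
  by exists (Num.bound (`|r0| + 1)); apply/ltW/archi_boundP; rewrite addr_ge0.
apply: (@le_trans _ _ (einfs (fun m => esups (fun i =>
    if (`|rat_point i| <= n%:R) && (`|b (rat_point i) - b r0| < m.+1%:R^-1)
    then (h (rat_point i))%:E else 0%E) 0) 0)); last first.
  by apply: ereal_sup_ubound; exists n.
apply: le_ereal_inf_tmp => _ [m _ <-].
apply/lee_addgt0Pr => e e0.
have : \forall r \near r0, `|b r - b r0| < m.+1%:R^-1 /\ h r0 - e < h r.
  have c1 : \forall r \near r0, `|b r0 - b r| < m.+1%:R^-1.
    by have /cvgrPdist_lt := cb r0; apply; rewrite invr_gt0.
  have c2 : \forall r \near r0, `|h r0 - h r| < e by have /cvgrPdist_lt := ch r0; exact.
  near=> r; split; first by rewrite distrC; near: r.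
  by have : `|h r0 - h r| < e; [near: r|rewrite ltr_norml => /andP[_]; rewrite ltrBlDr ltrBlDl addrC].
move=> /nbhs_ballP[a /= a0 ha].
have [i hi] := @rat_point_dense r0 (Num.min a 1) ltac:(by rewrite lt_min a0 ltr01).
have [h1 h2] : `|b (rat_point i) - b r0| < m.+1%:R^-1 /\ h r0 - e < h (rat_point i).
  by apply: ha; apply: le_ball hi; rewrite ge_min lexx.
apply: (@le_trans _ _ ((h (rat_point i))%:E + e%:E)%E).
  by rewrite -EFinD lee_fin -lerBlDr ltW.
rewrite leeD2r//; apply: ereal_sup_ubound; exists i => //.
rewrite h1 andbT ifT//.
have : `|r0 - rat_point i| < 1.
  by have := le_ball _ hi; rewrite -ball_normE; apply; rewrite ge_min lexx orbT.
move=> h3; apply: le_trans hn; rewrite -[X in `|X|](subrK r0).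
by rewrite (le_trans (ler_normD _ _))// addrC lerD2l distrC ltW.
Unshelve. all: by end_near. Qed.

Lemma measurable_sel {disp} {T : measurableType disp} (b : T -> V -> V) (h : T -> V -> R)
    (z : T -> V) :
  (forall r, measurable_fun setT (b ^~ r)) -> (forall r, measurable_fun setT (h ^~ r)) ->
  measurable_fun setT z -> measurable_fun setT (fun t => sel (b t) (h t) (z t)).
Proof.
move=> mb mh mz; rewrite /sel.
apply: measurable_fun_esups => n; apply: measurable_fun_einfs => m.
apply: measurable_fun_esups => i.
case: (_ <= _) => //=; apply: measurable_fun_ifT => //; last exact/measurable_EFinP.
apply: (measurable_fun_bool true).
rewrite setTI.
apply: (measurable_preimage (F := fun t => (b t (rat_point i) - z t)%R)
  (A := [set v : V | `|v| < m.+1%:R^-1])).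
  exact: measurable_rVB.
apply: open_measurable_rV; rewrite (_ : [set v | _] = ball (0 : V) m.+1%:R^-1).
  exact: ball_open.
by rewrite -ball_normE; apply/seteqP; split => v /=; rewrite sub0r normrN.
Qed.

End selection.

Lemma lt_limn_einf {R : realType} (u : (\bar R)^nat) (c : \bar R) :
  (c < limn_einf u)%E -> \forall n \near \oo, (c < u n)%E.
Proof.
rewrite limn_einf_lim (cvg_lim _ (@cvg_einfs_sup _ u))//.
move=> /ereal_sup_gt[_ [N _ <-] cN]; exists N => // n /= Nn.
by apply: lt_le_trans cN _; apply: ereal_inf_lbound; exists n.
Qed.

Lemma cvg_seq {R : realType} {T U : pseudoMetricType R} (f : T -> U) (x : T) (l : U) :
  (forall u : nat -> T, u @ \oo --> x -> f \o u @ \oo --> l) -> f @ x --> l.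
Proof.
move=> h; apply: cvg_trans (within_cvg_seq (A := setT) (fun u _ => h u)) => A hA.
suff : nbhs x (f @^-1` A) by [].
have : within setT (nbhs x) (f @^-1` A) by [].
by rewrite /within /=; apply: filterS => y; exact.
Qed.

(** Quantitative form of a classical remark: two lower semicontinuous functions with continuous sum
    are continuous. *)
Lemma near_of_sum {R : realFieldType} (a b a' b' e : R) : a - e / 2 < a' -> b - e / 2 < b' ->
  `|a + b - (a' + b')| < e / 2 -> `|a - a'| < e.
Proof. by rewrite !ltr_norml => h1 h2 /andP[h3 h4]; apply/andP; split; lra. Qed.

(** * The Markov property *)

Section transition.
Local Open Scope ereal_scope.
Context {R : realType} {d : nat}.
Local Notation V := 'rV[R]_d.
Variables (k : R.-pker V ~> V) (G : probability V R) (s t : R).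
Hypotheses (s0 : (0 <= s)%R) (st : (s < t)%R) (hG : gaussian (t - s) G).

Let t0 : (0 < t)%R. Proof. exact: le_lt_trans st. Qed.

(** The unnormalized transition operator from [s] to [t]: under Wiener measure the observation moves
    by the increment [v], and the posterior mass at time [t] is the likelihood ratio. *)
Definition trans (f : V * V -> \bar R) (z : V * V) : \bar R :=
  \int[G]_v (f (z.1, z.2 + v)%R * tilt k (cst 1) t (z.1, z.2 + v)%R).

Let mshift : measurable_fun setT (fun z : (V * V) * V => (z.1.1, z.1.2 + z.2)%R).
Proof.
apply: measurable_fun_pair; first exact: measurableT_comp.
by apply: measurable_rVD => //; exact: measurableT_comp.
Qed.

Let mL : measurable_fun setT (tilt k (cst 1) t).
Proof. exact: measurable_tilt. Qed.

Let L0 z : 0 <= tilt k (cst 1) t z. Proof. exact: tilt_ge0. Qed.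

Lemma measurable_trans_integrand f (x r : V) : measurable_fun setT f -> measurable_fun setT
  (fun v => f (x, r + v)%R * tilt k (cst 1) t (x, r + v)%R).
Proof.
move=> mf; have m1 : measurable_fun setT (fun v : V => (x, r + v)%R).
  by apply: measurable_fun_pair => //; exact: measurable_rVD.
by apply: emeasurable_funM; [exact: measurableT_comp m1|exact: measurableT_comp m1].
Qed.

Lemma trans_ge0 f z : (forall z, 0 <= f z) -> 0 <= trans f z.
Proof. by move=> f0; apply: integral_ge0 => v _; rewrite mule_ge0. Qed.

Lemma measurable_trans f : measurable_fun setT f -> (forall z, 0 <= f z) ->
  measurable_fun setT (trans f).
Proof.
move=> mf f0.
pose F (z : (V * V) * V) := f (z.1.1, z.1.2 + z.2)%R * tilt k (cst 1) t (z.1.1, z.1.2 + z.2)%R.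
have mF : measurable_fun setT F.
  by apply: emeasurable_funM; exact: measurableT_comp mshift.
have F0 z : 0 <= F z by rewrite mule_ge0.
exact: (@measurable_fun_fubini_tonelli_F _ _ _ _ _ G F mF F0).
Qed.

Lemma transD f g z : measurable_fun setT f -> (forall z, 0 <= f z) ->
  measurable_fun setT g -> (forall z, 0 <= g z) ->
  trans (fun z => f z + g z) z = trans f z + trans g z.
Proof.
move=> mf f0 mg g0; rewrite /trans -ge0_integralD//; last 4 first.
- by move=> v _; rewrite mule_ge0.
- exact: measurable_trans_integrand.
- by move=> v _; rewrite mule_ge0.
- exact: measurable_trans_integrand.
by apply: eq_integral => v _; rewrite ge0_muleDl.
Qed.

Lemma trans_le f g z : measurable_fun setT f -> (forall z, 0 <= f z) ->
  measurable_fun setT g -> (forall z, f z <= g z) -> trans f z <= trans g z.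
Proof.
move=> mf f0 mg fg; apply: ge0_le_integral => //.
- by move=> v _; rewrite mule_ge0.
- exact: measurable_trans_integrand.
- exact: measurable_trans_integrand.
- by move=> v _; rewrite lee_wpmul2r.
Qed.

(* At [s = 0] the process starts from the observation [0]. *)
Definition anchor (r : V) : V := if s == 0%R then 0%R else r.

(** The posterior mass is a martingale under Wiener measure: each exponential factorizes at time [s]
    and its increment has mean 1. *)
Lemma trans1 x r : trans (cst 1) (x, anchor r) = tilt k (cst 1) s (x, r).
Proof.
pose H (z : V * V) := (expmart s (anchor r) (z.2 - x) * expmart (t - s) z.1 (z.2 - x))%:E.
have mH : measurable_fun setT H.
  apply/measurable_EFinP; apply: measurable_funM; apply: measurable_expmart => //;
    exact: measurable_rVB.
have H0 z : 0 <= H z by rewrite lee_fin mulr_ge0// expR_ge0.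
transitivity (\int[G]_v \int[fiber k x]_y H (v, y)).
  apply: eq_integral => v _; rewrite mul1e /tilt; apply: eq_integral => y _.
  rewrite mul1e /weight gt_eqF// /H /= -expmartD//.
transitivity (\int[fiber k x]_y \int[G]_v H (v, y)).
  exact: (@fubini_tonelli _ _ _ _ _ G (fiber k x) H mH H0).
apply: eq_integral => y _; rewrite mul1e.
transitivity ((expmart s (anchor r) (y - x))%:E * \int[G]_v (expmart (t - s) v (y - x))%:E).
  rewrite -ge0_integralZl//.
  - by apply/measurable_EFinP; exact: measurable_expmart.
  - by move=> v _; rewrite lee_fin expR_ge0.
  - by rewrite lee_fin expR_ge0.
rewrite gaussian_mgf ?subr_gt0// mule1 /anchor /weight; case: eqP => // ->.
by rewrite /expmart dot0l !mul0r subr0 expR0.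
Qed.

Lemma trans_fin_num f x r : measurable_fun setT f -> (forall z, 0 <= f z) ->
  (forall z, f z <= 1) -> trans f (x, anchor r) \is a fin_num.
Proof.
move=> mf f0 f1; rewrite ge0_fin_numE ?trans_ge0//.
apply: (@le_lt_trans _ _ (trans (cst 1) (x, anchor r))); first exact: trans_le.
by rewrite trans1 -ge0_fin_numE ?tilt1_fin_num// tilt_ge0.
Qed.

(* Shifting the Gaussian moves [r] into a continuous density, so Fatou applies
   although [f] is only measurable. *)
Lemma trans_lsc f x (r_ : nat -> V) r c : measurable_fun setT f -> (forall z, 0 <= f z) ->
  (forall z, f z \is a fin_num) -> r_ @ \oo --> r ->
  c < trans f (x, r) -> \forall n \near \oo, c < trans f (x, r_ n).
Proof.
move=> mf f0 ff cr.
pose g (v : V) := f (x, v) * tilt k (cst 1) t (x, v).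
have mg : measurable_fun setT g.
  by apply: emeasurable_funM; exact: measurable_slice.
have g0 v : 0 <= g v by rewrite mule_ge0.
have ts0 : (0 < t - s)%R by rewrite subr_gt0.
pose e (q v : V) := expmart (t - s) v ((t - s)^-1 *: q)%R.
have shift (q : V) : trans f (x, q) = \int[G]_v (g v * (e q v)%:E).
  rewrite /e -(gaussian_shift _ ts0 hG mg g0); apply: eq_integral => v _.
  suff -> : (v + (t - s) *: ((t - s)^-1 *: q))%R = (q + v)%R by exact: erefl.
  by rewrite scalerA mulfV ?gt_eqF// scale1r addrC.
have mge (q : V) : measurable_fun setT (fun v => g v * (e q v)%:E).
  by apply: emeasurable_funM => //; apply/measurable_EFinP; exact: measurable_expmart.
have ce (v : V) : (fun n => e (r_ n) v) @ \oo --> e r v.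
  rewrite /e /expmart; apply: continuous_cvg; first exact: continuous_expR.
  have cq : (fun n => (t - s)^-1 *: r_ n)%R @ \oo --> ((t - s)^-1 *: r)%R by exact: cvgZl_tmp.
  apply: cvgB; first by apply: cvg_dot => //; exact: cvg_cst.
  apply: cvgM; last exact: cvg_cst.
  by apply: cvgM; [exact: cvg_cst|exact: cvg_dot].
have ge0 (q v : V) : setT v -> 0 <= g v * (e q v)%:E.
  by move=> _; rewrite mule_ge0// lee_fin expR_ge0.
have h := fatou G measurableT (fun n => mge (r_ n)) (fun n => ge0 (r_ n)).
move=> cf; apply: lt_limn_einf; apply: lt_le_trans cf _.
rewrite shift; under [X in _ <= limn_einf X]eq_fun do rewrite shift.
apply: le_trans h; rewrite le_eqVlt; apply/orP; left; apply/eqP.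
apply: eq_integral => v _; apply/esym; rewrite limn_einf_lim.
apply: cvg_lim => //; apply: cvg_einfs; apply: cvgeZl.
  by rewrite fin_numM// tilt1_fin_num// ltW.
by apply: cvg_EFin; [exact: nearW|exact: ce].
Qed.

Variable f : V * V -> \bar R.
Hypotheses (mf : measurable_fun setT f) (f0 : forall z, 0 <= f z) (f1 : forall z, f z <= 1).

Let ff z : f z \is a fin_num.
Proof. by rewrite ge0_fin_numE// (le_lt_trans (f1 z))// ltry. Qed.

(** The conditional expectation of f (X, Q t) given the past at time [s], as a function of (X, Q s);
    see [kern_condexp]. *)
Definition kern (z : V * V) : R := (fine (trans f (z.1, anchor z.2)) / mass k s z)%R.

Lemma kern_ge0 z : (0 <= kern z)%R.
Proof.
by rewrite /kern divr_ge0 ?fine_ge0 ?trans_ge0// ltW// mass_gt0.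
Qed.

Lemma kern_mass x r : (kern (x, r))%:E * tilt k (cst 1) s (x, r) = trans f (x, anchor r).
Proof.
rewrite massE// -EFinM /kern /= divfK; last by rewrite gt_eqF// mass_gt0.
by rewrite fineK// trans_fin_num.
Qed.

Lemma kern_le1 z : (kern z <= 1)%R.
Proof.
case: z => x r; rewrite /kern ler_pdivrMr ?mass_gt0// mul1r massK fine_le//.
- exact: trans_fin_num.
- exact: tilt1_fin_num.
- by rewrite -trans1; apply: trans_le.
Qed.

Lemma measurable_kern : measurable_fun setT kern.
Proof.
rewrite /kern; apply: measurable_funM.
  apply: measurableT_comp => //.
  apply: (measurableT_comp (measurable_trans mf f0)).
  apply: measurable_fun_pair; first exact: measurable_fst.
  by rewrite /anchor; case: (s == 0%R); [exact: measurable_cst|exact: measurable_snd].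
rewrite (_ : (fun z => _) = (fun z => expR (- ln (mass k s z)))).
  by do 3 (apply: measurableT_comp => //); exact: measurable_mass.
by apply/funext => z; rewrite expRN lnK// posrE mass_gt0.
Qed.

Let fC z := 1 - f z.
Let mfC : measurable_fun setT fC. Proof. exact: emeasurable_funB. Qed.
Let fC0 z : 0 <= fC z. Proof. by rewrite /fC sube_ge0 ?ff. Qed.
Let fC1 z : fC z <= 1. Proof. by rewrite leeBlDr// leeDl. Qed.

(** A strong Feller property. By [trans_lsc] the transforms of [f] and of 1 - f are lower
    semicontinuous, and their sum is the posterior mass at time [s], which is continuous. *)
Lemma kern_continuous x : (0 < s)%R -> continuous (fun r => kern (x, r)).
Proof.
move=> sp r.
suff h (r_ : nat -> V) : r_ @ \oo --> r -> (fun n => kern (x, r_ n)) @ \oo --> kern (x, r).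
  by apply: cvg_seq => u; exact: h.
move=> cr.
have cL : (fun n => mass k s (x, r_ n)) @ \oo --> mass k s (x, r).
  by apply: (mass_cvg_pos (s_ := cst s)) => //; exact: cvg_cst.
rewrite /kern /=; apply: cvgM; last by apply: cvgV => //; rewrite gt_eqF// mass_gt0.
have anc q : anchor q = q by rewrite /anchor gt_eqF.
apply/cvgrPdist_lt => e e0; rewrite !anc.
pose a g q := fine (trans g (x, q)).
have aE g q : measurable_fun setT g -> (forall z, 0 <= g z) -> (forall z, g z <= 1) ->
    trans g (x, q) = (a g q)%:E.
  by move=> mg g0 g1; rewrite fineK// -[q]anc trans_fin_num.
have sum q : (a f q + a fC q)%R = mass k s (x, q).
  apply: EFin_inj; rewrite EFinD -(aE f q mf f0 f1) -(aE fC q mfC fC0 fC1).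
  rewrite -(transD _ mf f0 mfC fC0) -(massE k (x, q) s0) -trans1 anc.
  by congr (trans _ _); apply/funext => z; rewrite /fC addeC subeK ?ff.
have e2 : (0 < e / 2)%R by rewrite divr_gt0.
have h1 : \forall n \near \oo, (a f r - e / 2 < a f (r_ n))%R.
  have : (a f r - e / 2)%:E < trans f (x, r) by rewrite (aE _ _ mf f0 f1) lte_fin ltrBlDr ltrDl.
  move=> /(trans_lsc mf f0 ff cr); apply: filterS => n.
  by rewrite (aE _ _ mf f0 f1) lte_fin.
have h2 : \forall n \near \oo, (a fC r - e / 2 < a fC (r_ n))%R.
  have ffC z : fC z \is a fin_num by rewrite fin_numB ff.
  have : (a fC r - e / 2)%:E < trans fC (x, r) by rewrite (aE _ _ mfC fC0 fC1) lte_fin ltrBlDr ltrDl.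
  move=> /(trans_lsc mfC fC0 ffC cr); apply: filterS => n.
  by rewrite (aE _ _ mfC fC0 fC1) lte_fin.
have h3 : \forall n \near \oo, (`|mass k s (x, r) - mass k s (x, r_ n)| < e / 2)%R.
  by move/cvgrPdist_lt : cL; exact.
near=> n.
have q1 : (a f r - e / 2 < a f (r_ n))%R by near: n.
have q2 : (a fC r - e / 2 < a fC (r_ n))%R by near: n.
have : (`|mass k s (x, r) - mass k s (x, r_ n)| < e / 2)%R by near: n.
rewrite -!sum anc => q3; change (`|a f r - a f (r_ n)| < e)%R.
move: q1 q2 q3; move: (a f r) (a fC r) (a f (r_ n)) (a fC (r_ n)).
by clear=> ? ? ? ? q1 q2 q3; exact: near_of_sum q1 q2 q3.
Unshelve. all: by end_near. Qed.

End transition.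

Section transition_rigid.
Local Open Scope ereal_scope.
Context {R : realType} {d : nat}.
Local Notation V := 'rV[R]_d.
Variables (k : R.-pker V ~> V) (G : probability V R) (s t : R) (x : V).
Hypotheses (s0 : (0 < s)%R) (st : (s < t)%R).
Variables (r r' : V) (c : R).
Hypothesis c0 : (0 < c)%R.
Hypothesis hc : {ae fiber k x, forall y, expmart s r (y - x)%R = (c * expmart s r' (y - x))%R}.

Let t0 : (0 < t)%R. Proof. exact: lt_trans st. Qed.

(** By [expmartD], weights that are proportional at time [s] remain so, with the same constant,
    after a common increment [v]. *)
Lemma tilt_scale u v (g : V -> \bar R) : (s <= u)%R ->
  measurable_fun setT g -> (forall y, 0 <= g y) ->
  tilt k g u (x, r + v)%R = c%:E * tilt k g u (x, r' + v)%R.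
Proof.
move=> su mg g0; have u0 : (0 < u)%R := lt_le_trans s0 su.
have mgw q : measurable_fun setT (fun y => g y * (weight u q (y - x)%R)%:E).
  apply: emeasurable_funM => //; apply/measurable_EFinP; apply: measurable_weight => //.
  exact: measurable_rVB.
have gw0 q y : 0 <= g y * (weight u q (y - x)%R)%:E.
  by rewrite mule_ge0// lee_fin ltW// weight_gt0.
rewrite /tilt /= -ge0_integralZl//; last by rewrite lee_fin ltW.
apply: ge0_ae_eq_integral => //.
- by apply: emeasurable_funM => //; exact: mgw.
- by move=> y _; rewrite mule_ge0// lee_fin ltW.
apply: ae_imp hc => y h _.
rewrite muleCA -EFinM /weight gt_eqF//; congr (_ * _%:E).
by rewrite !(expmartD s u) h mulrA.
Qed.

Lemma post_mean_scale u v : (s <= u)%R ->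
  post_mean k u (x, r + v)%R = post_mean k u (x, r' + v)%R.
Proof.
move=> su; have u0 : (0 <= u)%R by rewrite ltW// (lt_le_trans s0).
have cL : mass k u (x, r + v)%R = (c * mass k u (x, r' + v))%R.
  by apply: EFin_inj; rewrite EFinM -!massE// tilt_scale.
apply/rowP => i; rewrite !post_meanK.
suff e g : measurable_fun setT g -> (forall y, 0 <= g y) ->
    post k g u (x, r + v)%R = post k g u (x, r' + v)%R.
  by rewrite !e//; [exact: measurable_negpart|exact: negpart_ge0|
    exact: measurable_pospart|exact: pospart_ge0].
move=> mg g0; rewrite /post tilt_scale// cL invfM EFinM muleACA -EFinM.
by rewrite mulfV ?mul1e// gt_eqF.
Qed.

(** After any increment the posterior means agree, so [f] takes equal values; the remaining factors
    in numerator and denominator both scale by [c]. *)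
Lemma kern_scale (B : set (V * V)) (f :=  fun z => (\1_B (z.1, post_mean k t z) : R)%:E) :
  measurable B -> kern k G s t f (x, r) = kern k G s t f (x, r').
Proof.
move=> mB.
have mf : measurable_fun setT f.
  apply/measurable_EFinP; apply: (measurableT_comp (f := \1_B : V * V -> R)) => //.
  by apply: measurable_fun_pair => //; apply: measurable_post_mean; exact: ltW.
have anc q : anchor s q = q :> V by rewrite /anchor gt_eqF.
have cL : mass k s (x, r) = (c * mass k s (x, r'))%R.
  apply: EFin_inj; rewrite EFinM -!massE ?ltW//.
  by rewrite -[r]addr0 -[r']addr0 tilt_scale.
have -> : kern k G s t f (x, r) =
    (fine (c%:E * trans k G t f (x, r')) / (c * mass k s (x, r')))%R.
  rewrite /kern !anc -cL; congr (fine _ / _)%R; rewrite /trans /= -ge0_integralZl//.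
  - apply: eq_integral => v _; rewrite /f /= (post_mean_scale _ (ltW st)).
    by rewrite (tilt_scale _ (ltW st))// muleCA.
  - exact: measurable_trans_integrand.
  - by move=> v _; rewrite mule_ge0// ?lee_fin// tilt_ge0.
  - by rewrite lee_fin ltW.
rewrite /kern !anc /=.
(* [fine] sends infinite values to 0 and [c] is positive, so [c] comes out in every case. *)
have -> : fine (c%:E * trans k G t f (x, r')) = (c * fine (trans k G t f (x, r')))%R.
  case: (trans k G t f (x, r')) => [q||]//.
    by rewrite gt0_muley ?lte_fin//= mulr0.
  by rewrite gt0_muleNy ?lte_fin//= mulr0.
by rewrite invfM mulrACA mulfV ?mul1r// gt_eqF.
Qed.

End transition_rigid.

(** * Sub-sigma-algebras and versions of conditional expectations *)

Section sub_sigma_algebra.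
Context {disp} {T : measurableType disp} (G : set (set T)).
Hypothesis sG : sigma_algebra setT G.

Lemma measurable_fun_sub {d} {S : measurableType d} (f : T -> S) :
  (forall B, measurable B -> G (f @^-1` B)) <->
  measurable_fun [set: g_sigma_algebraType G] f.
Proof.
have gE : @measurable _ (g_sigma_algebraType G) = G by exact: sigma_algebra_id.
split=> [h _ B mB|h B mB]; first by rewrite setTI gE; exact: h.
by have := h measurableT B mB; rewrite setTI gE.
Qed.

Lemma pair_events {d1 d2} {S1 : measurableType d1} {S2 : measurableType d2}
    (f : T -> S1) (g : T -> S2) :
  (forall B, measurable B -> G (f @^-1` B)) -> (forall B, measurable B -> G (g @^-1` B)) ->
  forall B, measurable B -> G [set w | B (f w, g w)].
Proof.
move=> /measurable_fun_sub mf /measurable_fun_sub mg.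
exact/measurable_fun_sub/measurable_fun_pair.
Qed.

End sub_sigma_algebra.

Section condexp_lemmas.
Local Open Scope ereal_scope.
Context {R : realType} {disp} {T : measurableType disp} (P : probability T R).

Lemma integrable_indic_event (A : set T) : measurable A -> P.-integrable setT (EFin \o \1_A).
Proof. by move=> mA; exact: integrable_indic. Qed.

Lemma condexp_self (G : set (set T)) (A : set T) : sigma_algebra setT G -> measurable A ->
  G A -> is_condexp P G \1_A \1_A.
Proof.
move=> sG mA GA; split => //; [exact: integrable_indic_event| |exact: integrable_indic_event].
apply/measurable_fun_sub => //.
by apply: measurable_indic; rewrite -[measurable]/(<<s G >>) sigma_algebra_id.
Qed.

Lemma condexp_sub (G G' : set (set T)) (f g : T -> R) : G' `<=` G ->
  (forall B : set R, measurable B -> G' (g @^-1` B)) ->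
  is_condexp P G f g -> is_condexp P G' f g.
Proof. by move=> GG mg [h1 h2 h3 h4]; split => // A /GG; exact: h4. Qed.

(** [G] is not assumed complete, so the measurability of the new version [g] is a separate
    hypothesis. *)
Lemma condexp_ae (G : set (set T)) (f f' g g' : T -> R) : G `<=` measurable ->
  measurable_fun setT f -> measurable_fun setT g ->
  (forall B : set R, measurable B -> G (g @^-1` B)) ->
  {ae P, forall w, f w = f' w} -> {ae P, forall w, g w = g' w} ->
  (exists M : R, forall w, (`|f w| <= M)%R /\ (`|g w| <= M)%R) ->
  is_condexp P G f' g' -> is_condexp P G f g.
Proof.
move=> GM mf mg Gg hf hg [M hM] [i1 _ i2 h].
have int (u : T -> R) : measurable_fun setT u -> (forall w, (`|u w| <= M)%R) ->
    P.-integrable setT (EFin \o u).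
  move=> mu uM; apply: (le_integrable (g := cst M%:E) measurableT).
  - exact/measurable_EFinP.
  - by move=> w _ /=; rewrite lee_fin; apply: le_trans (uM w) (ler_norm _).
  - exact: finite_measure_integrable_cst.
split => //; [by apply: int => // w; have [] := hM w|by apply: int => // w; have [] := hM w|].
move=> A GA; have mA := GM _ GA.
have sw (u u' : T -> R) : measurable_fun setT u -> P.-integrable setT (EFin \o u') ->
    {ae P, forall w, u w = u' w} ->
    \int[P]_(w in A) (u w)%:E = \int[P]_(w in A) (u' w)%:E.
  move=> mu iu' hu; apply: ae_eq_integral => //.
  - by apply/measurable_EFinP; exact: measurable_funTS.
  - exact: measurable_funTS (measurable_int _ iu').
  - by apply: ae_imp hu => w -> _.
by rewrite (sw _ _ mf i1 hf) (sw _ _ mg i2 hg) h.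
Qed.

End condexp_lemmas.

Section markov_model.
Local Open Scope ereal_scope.
Context {R : realType} {d : nat}.
Local Notation V := 'rV[R]_d.
Local Notation Om := (paths d (`[0%R, +oo[ : set R)).
Variables (k : R.-pker V ~> V) (mu : probability V R) (gam : probability Om R).
Hypothesis hgam : wiener gam (fun t (w : Om) => w t).
Context {disp} {T : measurableType disp}.
Variables (P : probability T R) (X Y : T -> V) (Q : R -> T -> V).
Hypotheses (mX : measurable_fun setT X) (mY : measurable_fun setT Y).
Hypothesis mQ : forall t, (0 <= t)%R -> measurable_fun setT (Q t).
Hypothesis hmodel : forall f : (V * V) * Om -> \bar R,
  measurable_fun setT f -> (forall z, 0 <= f z) ->
  \int[P]_w f ((X w, Y w), path_map Q w) =
  \int[mu]_x \int[fiber k x]_y \int[gam]_w f ((x, y), shift_path (y - x) w).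

Lemma model_ae (p : V -> Prop) : {ae mu, forall x, p x} -> {ae P, forall w, p (X w)}.
Proof.
move=> [N [mN N0 hN]]; exists (X @^-1` N); split.
- exact: measurable_preimage.
- transitivity (\int[P]_w (\1_N (X w) : R)%:E).
    transitivity (\int[P]_w (\1_(X @^-1` N) w : R)%:E); last by [].
    by rewrite integral_indic// ?setIT//; exact: measurable_preimage.
  have mf : measurable_fun setT (fun z : (V * V) * Om => (\1_N z.1.1 : R)%:E).
    apply/measurable_EFinP; apply: (measurableT_comp (f := \1_N : V -> R)) => //.
    exact: measurableT_comp.
  have := hmodel mf (fun z => _); rewrite /= => -> //.
    transitivity (\int[mu]_x (\1_N x)%:E); last by rewrite integral_indic// setIT.
    apply: eq_integral => x _.
    transitivity (\int[fiber k x]_y (\1_N x : R)%:E).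
      apply: eq_integral => y _; rewrite integral_cst//.
      by rewrite [X in _ * X](_ : _ = 1) ?mule1//; exact: probability_setT.
    rewrite integral_cst//.
    by rewrite [X in _ * X](_ : _ = 1) ?mule1//; exact: probability_setT.
- by move=> w /= hw; apply: hN.
Qed.

Section step.
Variables (s t : R).
Hypotheses (s0 : (0 <= s)%R) (st : (s < t)%R).
Let t0 : (0 <= t)%R. Proof. by rewrite ltW// (le_lt_trans s0). Qed.
Let G := law gam (measurable_incr s0 t0).
Let hG : gaussian (t - s) G. Proof. exact: wiener_incr_gaussian. Qed.

Lemma anchor_ae : {ae gam, forall w : Om, anchor s (w s) = w s}.
Proof.
have [_ h0 _ _] := hgam; apply: ae_imp h0 => w w0.
by rewrite /anchor; case: eqP => // ->.
Qed.

(** Bayes' formula at the later time [t] reduces to Wiener measure, where [wiener_step] integrates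
    out the increment after [s]. *)
Lemma transition_formula (f0 : V * paths d `[0%R, s] -> \bar R) (f : V * V -> \bar R) :
  measurable_fun setT f0 -> (forall z, 0 <= f0 z) ->
  measurable_fun setT f -> (forall z, 0 <= f z) ->
  \int[P]_w (f0 (X w, Q ^~ w) * f (X w, Q t w)) =
  \int[mu]_x \int[gam]_w (f0 (x, w : paths d `[0%R, s]) * trans k G t f (x, w s)).
Proof.
move=> mf0 f00 mf fp.
have ss : `[0%R, s]%classic s by rewrite /= in_itv/= s0 lexx.
have tt : `[0%R, t]%classic t by rewrite /= in_itv/= t0 lexx.
pose h (z : V * paths d `[0%R, t]) := f0 (z.1, z.2 : paths d `[0%R, s]) * f (z.1, z.2 t).
have mh : measurable_fun setT h.
  apply: emeasurable_funM.
    apply: (measurableT_comp mf0); apply: measurable_fun_pair; first exact: measurable_fst.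
    apply: (measurableT_comp (f := fun w : paths d `[0%R, t] => (w : paths d `[0%R, s])) _ measurable_snd).
    apply: measurable_paths_sub => u; rewrite /= !in_itv/= => /andP[-> us].
    by rewrite (le_trans us)// ltW.
  apply: (measurableT_comp mf); apply: measurable_fun_pair; first exact: measurable_fst.
  apply: (measurableT_comp (f := fun w : paths d `[0%R, t] => w t : V) _ measurable_snd).
  exact: measurable_eval.
have h0 z : 0 <= h z by rewrite mule_ge0.
transitivity (\int[P]_w (h (X w, Q ^~ w) * cst 1 (Y w))).
  by apply: eq_integral => w _; rewrite mule1.
transitivity (\int[mu]_x \int[gam]_w (h (x, w : paths d `[0%R, t]) * tilt k (cst 1) t (x, w t))).
  exact: (bayes_formula hgam hmodel (g := cst 1) t0 mh h0).
apply: eq_integral => x _.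
pose F (z : paths d `[0%R, s] * V) := f0 (x, z.1) *
  (f (x, z.1 s + z.2)%R * tilt k (cst 1) t (x, z.1 s + z.2)%R).
have mF : measurable_fun setT F.
  have m1 : measurable_fun setT (fun z : paths d `[0%R, s] * V => (x, z.1 s + z.2)%R).
    apply: measurable_fun_pair; first exact: measurable_cst.
    apply: measurable_rVD; last exact: measurable_snd.
    apply: (measurableT_comp (f := fun w : paths d `[0%R, s] => w s : V) _ measurable_fst).
    exact: measurable_eval.
  apply: emeasurable_funM; first exact: (measurableT_comp (measurable_slice x mf0) measurable_fst).
  apply: emeasurable_funM; first exact: measurableT_comp m1.
  by apply: (measurableT_comp (f := tilt k (cst 1) t)) m1; exact: measurable_tilt.
have F0 z : 0 <= F z by rewrite !mule_ge0// tilt_ge0.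
transitivity (\int[gam]_w F (w : paths d `[0%R, s], w t - w s)%R).
  by apply: eq_integral => w _; rewrite /F /h /= addrC subrK muleA.
transitivity (\int[gam]_w \int[G]_z F (w : paths d `[0%R, s], z)).
  exact: wiener_step.
apply: eq_integral => w _; rewrite /F /trans /=.
apply: ge0_integralZl => //.
- exact: measurable_trans_integrand.
- by move=> v _; rewrite mule_ge0// tilt_ge0.
Qed.

Section event.
Variable f : V * V -> \bar R.
Hypotheses (mf : measurable_fun setT f) (f0 : forall z, 0 <= f z) (f1 : forall z, f z <= 1).
Let h := kern k G s t f.

(** Bayes' formula at time [s] multiplies [h] by the posterior mass and returns [trans]; [anchor_ae]
    covers s = 0, where the two observations agree only almost surely. *)
Lemma integral_kern (g : V * paths d `[0%R, s] -> \bar R) :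
  measurable_fun setT g -> (forall z, 0 <= g z) ->
  \int[P]_w (g (X w, Q ^~ w) * f (X w, Q t w)) =
  \int[P]_w (g (X w, Q ^~ w) * (h (X w, Q s w))%:E).
Proof.
move=> mg g0.
have ss : `[0%R, s]%classic s by rewrite /= in_itv/= s0 lexx.
have h0 z : (0 <= h z)%R by exact: kern_ge0.
have mh : measurable_fun setT h by exact: measurable_kern.
pose F (z : V * paths d `[0%R, s]) := g z * (h (z.1, z.2 s))%:E.
have mev : measurable_fun setT (fun z : V * paths d `[0%R, s] => (z.1, z.2 s : V)).
  apply: measurable_fun_pair; first exact: measurable_fst.
  apply: (measurableT_comp (f := fun w : paths d `[0%R, s] => w s : V) _ measurable_snd).
  exact: measurable_eval.
have mF : measurable_fun setT F.
  by apply: emeasurable_funM => //; apply/measurable_EFinP; exact: measurableT_comp mev.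
have F0 z : 0 <= F z by rewrite mule_ge0// lee_fin.
rewrite transition_formula//.
transitivity (\int[P]_w (F (X w, Q ^~ w) * cst 1 (Y w))); last first.
  by apply: eq_integral => w _; rewrite mule1.
transitivity (\int[mu]_x \int[gam]_w (F (x, w : paths d `[0%R, s]) * tilt k (cst 1) s (x, w s))); last first.
  exact/esym/(bayes_formula hgam hmodel (g := cst 1) s0 mF F0).
have mgx x : measurable_fun setT (fun w : Om => g (x, w : paths d `[0%R, s])).
  exact: (measurableT_comp (measurable_slice x mg) (@measurable_restr R d s)).
have mxs (x : V) : measurable_fun setT (fun w : Om => (x, w s : V)).
  by apply: measurable_fun_pair => //; exact: measurable_evalT.
apply: eq_integral => x _; apply: ge0_ae_eq_integral => //.
- apply: emeasurable_funM => //.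
  by apply: (measurableT_comp (f := trans k G t f)); [exact: measurable_trans|exact: mxs].
- apply: emeasurable_funM.
    apply: emeasurable_funM => //; apply/measurable_EFinP.
    exact: (measurableT_comp (f := h) mh (mxs x)).
  by apply: (measurableT_comp (f := tilt k (cst 1) s)) => //; exact: measurable_tilt.
- by move=> w _; rewrite mule_ge0// trans_ge0.
- by move=> w _; rewrite mule_ge0// tilt_ge0.
apply: ae_imp anchor_ae => w hw _.
have e1 : (h (x, w s))%:E * tilt k (cst 1) s (x, w s) = trans k G t f (x, w s).
  by rewrite -[in RHS]hw; exact: (kern_mass k s0 st hG mf f0 f1).
by rewrite -e1 muleA; exact: erefl.
Qed.

Lemma kern_condexp (E : set (set T)) (e : V * V -> R) :
  (forall A, E A -> exists2 A' : set (V * paths d `[0%R, s]), measurable A' &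
    A = [set w | A' (X w, Q ^~ w)]) ->
  (forall B, measurable B -> E [set w | B (X w, Q s w)]) ->
  (forall z, f z = (e z)%:E) ->
  is_condexp P E (fun w => e (X w, Q t w)) (fun w => h (X w, Q s w)).
Proof.
move=> EA EB fe.
have me : measurable_fun setT e.
  by apply/measurable_EFinP; apply: eq_measurable_fun mf => z _; rewrite fe.
have e0 z : (0 <= e z)%R by rewrite -lee_fin -fe.
have e1 z : (e z <= 1)%R by rewrite -lee_fin -fe.
have mh : measurable_fun setT h by exact: measurable_kern.
have mQs : measurable_fun setT (fun w => (Q ^~ w : paths d `[0%R, s])).
  by apply: measurable_paths => u; rewrite /= in_itv/= => /andP[u0 _]; exact: mQ.
have mXQ : measurable_fun setT (fun w => (X w, Q ^~ w : paths d `[0%R, s])).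
  exact: measurable_fun_pair.
have int (u : V * V -> R) r : (0 <= r)%R -> measurable_fun setT u ->
    (forall z, 0 <= u z <= 1)%R -> P.-integrable setT (fun w => (u (X w, Q r w))%:E).
  move=> r0 mu' u01; apply: (le_integrable (g := cst 1) measurableT).
  - apply/measurable_EFinP; apply: (measurableT_comp mu').
    by apply: measurable_fun_pair => //; exact: mQ.
  - by move=> w _ /=; rewrite normr1 lee_fin; have /andP[a b] := u01 (X w, Q r w); rewrite ger0_norm.
  - exact: finite_measure_integrable_cst.
split.
- by apply: (int e) => // z; rewrite e0 e1.
- by move=> B mB; apply: (EB (h @^-1` B)); exact: measurable_preimage.
- by apply: (int h) => // z; rewrite kern_ge0//= kern_le1.
move=> A /EA[A' mA' eA].
have ind (u : T -> \bar R) : \int[P]_(w in A) u w =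
    \int[P]_w ((\1_A' (X w, Q ^~ w))%:E * u w).
  rewrite integral_mkcond; apply: eq_integral => w _.
  rewrite patchE eA indicE.
  case: ifPn => h1; rewrite [X in (nat_of_bool X)%:R](_ : _ = (w \in [set w | A' (X w, Q^~ w)])).
  - by rewrite h1 mul1e.
  - by apply: asbool_equiv_eq.
  - by rewrite (negbTE h1) mul0e.
  - by apply: asbool_equiv_eq.
rewrite (ind (fun w => (h (X w, Q s w))%:E)) (ind (fun w => (e (X w, Q t w))%:E)).
have mA1 : measurable_fun setT (fun z => (\1_A' z : R)%:E) by apply/measurable_EFinP.
have A0 z : 0 <= (\1_A' z : R)%:E by rewrite lee_fin.
transitivity (\int[P]_w ((\1_A' (X w, Q ^~ w))%:E * f (X w, Q t w))).
  exact/esym/(integral_kern mA1 A0).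
by apply: eq_integral => w _; rewrite fe.
Qed.

End event.

(** The heart of the Markov property: by [post_mean_rigid] and [kern_scale] the transition
    probability depends on the observation only through the posterior mean, and [sel] makes this
    dependence Borel. *)
Lemma kern_posterior (B : set (V * V)) (f := fun z => (\1_B (z.1, post_mean k t z) : R)%:E) :
  measurable B ->
  {ae mu, forall x i, (fiber k x).-integrable setT (fun y : V => (y ord0 i)%:E)} ->
  exists2 g : V * V -> R, measurable_fun setT g /\ (forall z, (`|g z| <= 1)%R) &
    {ae P, forall w, g (X w, post_mean k s (X w, Q s w)) = kern k G s t f (X w, Q s w)}.
Proof.
move=> mB hk.
have mf : measurable_fun setT f.
  apply/measurable_EFinP; apply: (measurableT_comp (f := \1_B : V * V -> R)) => //.
  by apply: measurable_fun_pair => //; exact: measurable_post_mean.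
have f0 z : 0 <= f z by rewrite lee_fin.
have f1 z : f z <= 1 by rewrite lee_fin indicE lern1; case: (_ \in _).
have mh : measurable_fun setT (kern k G s t f) by exact: measurable_kern.
have h0 z : (0 <= kern k G s t f z)%R by exact: kern_ge0.
have h1 z : (kern k G s t f z <= 1)%R by exact: kern_le1.
have hn z : (`|kern k G s t f z| <= 1)%R by rewrite ger0_norm.
(* At time 0 the anchored observation is 0 and all weights are 1, so a function of X alone
   suffices. *)
have [s00|sn0] := eqVneq s 0%R.
  exists (fun z => kern k G s t f (z.1, 0%R)); first split => //.
    by apply: (measurableT_comp mh); apply: measurable_fun_pair.
  apply: aeW => w /=.
  have anc r : anchor s r = 0%R :> V by rewrite /anchor s00 eqxx.
  have w1 r v : weight s r v = 1%R :> R by rewrite /weight s00 eqxx.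
  have m0 r : mass k s (X w, r) = mass k s (X w, 0%R).
    by rewrite !massK /tilt; congr fine; apply: eq_integral => y _; rewrite !w1.
  by rewrite /kern !anc /= (m0 (Q s w)).
have sp : (0 < s)%R by rewrite lt_neqAle eq_sym sn0.
pose S (z : V * V) := sel (fun r => post_mean k s (z.1, r)) (fun r => kern k G s t f (z.1, r)) z.2.
have mS : measurable_fun setT S.
  apply: (@measurable_sel R d _ _ (fun z r => post_mean k s (z.1, r))
    (fun z r => kern k G s t f (z.1, r))).
  - move=> r; apply: (measurableT_comp (f := post_mean k s)); first exact: measurable_post_mean.
    exact: measurable_fun_pair.
  - by move=> r; apply: (measurableT_comp mh); exact: measurable_fun_pair.
  - exact: measurable_snd.
(* Clamping gives the bound everywhere; it changes nothing where the fibre has first moments and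
   [selE] applies. *)
exists (fun z => Num.max 0 (Num.min 1 (fine (S z))))%R.
  split.
    by apply: measurable_maxr => //; apply: measurable_minr => //; exact: measurableT_comp.
  by move=> z; rewrite ger0_norm ?le_max ?lexx// ge_max ler01 ge_min lexx.
apply: ae_imp (model_ae hk) => w hw.
have -> : S (X w, post_mean k s (X w, Q s w)) = (kern k G s t f (X w, Q s w))%:E.
  apply: (selE (b := fun r => post_mean k s (X w, r)) (h := fun r => kern k G s t f (X w, r))).
  - move=> r; apply: cvg_seq => u cu.
    by apply: (@post_mean_cvg_pos _ _ _ _ hw (cst s) u s r) => //; exact: cvg_cst.
  - exact: kern_continuous.
  - by [].
  - move=> r /(post_mean_rigid hw sp)[c c0 hc].
    exact: (kern_scale G sp st c0 hc mB).
by rewrite /= min_r// max_r.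
Qed.

End step.

Section conclusion.
Variables (F : R -> set (set T)) (Z : R -> T -> V).
Hypothesis hk : {ae mu, forall x i, (fiber k x).-integrable setT (fun y : V => (y ord0 i)%:E)}.
Hypothesis Fsigma : forall s, (0 <= s)%R -> sigma_algebra setT (F s).
Hypothesis Fpaths : forall s, (0 <= s)%R -> forall A, F s A ->
  exists2 A' : set (V * paths d `[0%R, s]), measurable A' & A = [set w | A' (X w, Q ^~ w)].
Hypothesis FX : forall s, (0 <= s)%R -> forall B, measurable B -> F s (X @^-1` B).
Hypothesis FQ : forall s, (0 <= s)%R -> forall B, measurable B -> F s (Q s @^-1` B).
Hypothesis FZ : forall s, (0 <= s)%R -> forall B, measurable B -> F s (Z s @^-1` B).
Hypothesis hZ : forall s, (0 <= s)%R -> {ae P, forall w, Z s w = post_mean k s (X w, Q s w)}.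

Lemma filtration_measurable s : (0 <= s)%R -> F s `<=` measurable.
Proof.
move=> s0 A /(Fpaths s0)[A' mA' ->].
apply: (measurable_preimage (F := fun w => (X w, Q ^~ w : paths d `[0%R, s])) _ mA').
apply: measurable_fun_pair => //.
by apply: measurable_paths => u; rewrite /= in_itv/= => /andP[u0 _]; exact: mQ.
Qed.

Lemma posterior_mean_markov : markov_process P F (fun s w => (X w, Z s w)).
Proof.
have sigmaF s : (0 <= s)%R -> sigma_rv (fun w => (X w, Z s w)) `<=` F s.
  move=> s0 A /sigma_rvP[B mB ->].
  by apply: (pair_events (Fsigma s0)) => //; [exact: FX|exact: FZ].
have mZ s : (0 <= s)%R -> measurable_fun setT (Z s).
  by move=> s0 _ B mB; rewrite setTI; apply: (filtration_measurable s0); exact: FZ.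
split=> // s t s0 st B mB.
have t0 : (0 <= t)%R := le_trans s0 st.
have mXZ r : (0 <= r)%R -> measurable_fun setT (fun w => (X w, Z r w)).
  by move=> r0; apply: measurable_fun_pair => //; exact: mZ.
(* A version for [F s] that is already measurable in (X, Z s) is also a version for this smaller
   sigma-algebra. *)
have sub g : (forall B : set R, measurable B -> sigma_rv (fun w => (X w, Z s w)) (g @^-1` B)) ->
    is_condexp P (F s) (\1_((fun w => (X w, Z t w)) @^-1` B)) g ->
    is_condexp P (sigma_rv (fun w => (X w, Z s w))) (\1_((fun w => (X w, Z t w)) @^-1` B)) g /\
    is_condexp P (F s) (\1_((fun w => (X w, Z t w)) @^-1` B)) g.
  by move=> hg h; split => //; apply: condexp_sub hg h; exact: sigmaF.
have sgm (g : V * V -> R) : measurable_fun setT g -> forall B : set R, measurable B ->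
    sigma_rv (fun w => (X w, Z s w)) ((fun w => g (X w, Z s w)) @^-1` B).
  move=> mg C mC; apply/sigma_rvP; exists (g @^-1` C) => //.
  exact: measurable_preimage.
have [est|nst] := eqVneq s t.
  exists (fun w => \1_B (X w, Z s w)); rewrite -est in sub *; apply: sub.
    exact: (sgm (\1_B)).
  apply: condexp_self; [exact: Fsigma| |].
  - by apply: measurable_preimage mB; exact: mXZ.
  - by apply: (pair_events (Fsigma s0)) => //; [exact: FX|exact: FZ].
have lst : (s < t)%R by rewrite lt_neqAle nst.
pose f (z : V * V) := (\1_B (z.1, post_mean k t z) : R)%:E.
have mf : measurable_fun setT f.
  apply/measurable_EFinP; apply: (measurableT_comp (f := \1_B : V * V -> R)) => //.
  by apply: measurable_fun_pair => //; exact: measurable_post_mean.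
have f0 z : 0 <= f z by rewrite lee_fin.
have f1 z : f z <= 1 by rewrite lee_fin indicE lern1; case: (_ \in _).
have [g [mg g1] hg] := kern_posterior s0 lst mB hk.
exists (fun w => g (X w, Z s w)); apply: sub; first exact: sgm.
have h := kern_condexp s0 lst mf f0 f1 (Fpaths s0)
  (pair_events (Fsigma s0) (FX s0) (FQ s0)) (e := fun z => \1_B (z.1, post_mean k t z))
  (fun=> erefl).
apply: condexp_ae h.
- exact: filtration_measurable.
- by apply: measurable_indic; apply: measurable_preimage mB; exact: mXZ.
- by apply: (measurableT_comp mg); exact: mXZ.
- by move=> C mC; apply: (sigmaF _ s0); exact: sgm.
- by apply: ae_imp (hZ t0) => w hw; rewrite !indicE /= -hw.
- by apply: ae_imp (ae_and (hZ s0) hg) => w [-> ->].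
- exists 1%R => w; split => //.
  by rewrite ger0_norm ?indicE ?ler0n// lern1; case: (_ \in _).
Qed.

End conclusion.
End markov_model.

Lemma measurable_shift_path2 {R : realType} {d} {disp} {T : measurableType disp}
    (v : T -> 'rV[R]_d) (w : T -> paths d (`[0%R, +oo[ : set R)) :
  measurable_fun setT v -> measurable_fun setT w ->
  measurable_fun setT (fun z => (shift_path (v z) (w z) : paths d (`[0%R, +oo[ : set R))).
Proof.
move=> mv mw; apply: measurable_paths => t; rewrite /= in_itv/= andbT => t0.
apply: measurable_rVD; last exact: measurable_rVZ.
exact: (measurableT_comp (f := fun w : paths d `[0%R, +oo[ => w t : 'rV[R]_d) (measurable_evalT t0) mw).
Qed.

Lemma measurable_model_integral {R : realType} {d} (k : R.-pker 'rV[R]_d ~> 'rV[R]_d)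
    (gam : probability (paths d (`[0%R, +oo[ : set R)) R)
    (f : ('rV[R]_d * 'rV[R]_d) * paths d (`[0%R, +oo[ : set R) -> \bar R) :
  measurable_fun setT f -> (forall z, 0 <= f z)%E ->
  measurable_fun setT (fun x => \int[fiber k x]_y \int[gam]_w f ((x, y), shift_path (y - x) w))%E.
Proof.
move=> mf f0.
pose F (z : ('rV[R]_d * 'rV[R]_d) * paths d (`[0%R, +oo[ : set R)) :=
  f (z.1, (shift_path (z.1.2 - z.1.1) z.2 : paths d (`[0%R, +oo[ : set R))).
have mF : measurable_fun setT F.
  apply: (measurableT_comp mf); apply: measurable_fun_pair; first exact: measurable_fst.
  apply: measurable_shift_path2; last exact: measurable_snd.
  by apply: measurable_rVB; apply: measurableT_comp.
have F0 z : (0 <= F z)%E by exact: f0.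
have mG := @measurable_fun_fubini_tonelli_F _ _ _ _ _ gam F mF F0.
have h := measurable_fun_integral_fiber k (@measurable_id _ 'rV[R]_d setT) mG.
by apply: h => z; apply: integral_ge0 => w _; exact: F0.
Qed.

Lemma measurable_posterior_law {R : realType} {d} (k : R.-pker 'rV[R]_d ~> 'rV[R]_d)
    (gam : probability (paths d (`[0%R, +oo[ : set R)) R) (A : set (paths d (`[0%R, +oo[ : set R))) :
  measurable A ->
  measurable_fun setT (fun x => \int[fiber k x]_y \int[gam]_w
    (\1_A (fun s => post_mean k s (x, shift_path (y - x) w s)))%:E)%E.
Proof.
move=> mA.
pose Psi (z : ('rV[R]_d * 'rV[R]_d) * paths d (`[0%R, +oo[ : set R))
    : paths d (`[0%R, +oo[ : set R) := fun s => post_mean k s (z.1.1, z.2 s).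
have mPsi : measurable_fun setT Psi.
  apply: measurable_paths => s; rewrite /= in_itv/= andbT => s0.
  apply: (measurableT_comp (f := post_mean k s)); first exact: measurable_post_mean.
  apply: measurable_fun_pair; first exact: measurableT_comp.
  by apply: (measurableT_comp (f := fun w : paths d (`[0%R, +oo[ : set R) => w s : 'rV[R]_d)) => //;
    exact: measurable_evalT.
apply: (measurable_model_integral k gam (f := fun z => (\1_A (Psi z) : R)%:E)) => //.
  by apply/measurable_EFinP; apply: (measurableT_comp (f := \1_A : paths d (`[0%R, +oo[ : set R) -> R)) mPsi.
Qed.

(** * Foellmer martingales *)

Section foellmer_fiber.
Local Open Scope ereal_scope.
Context {R : realType} {d : nat}.
Local Notation V := 'rV[R]_d.
Local Notation Om := (paths d (`[0%R, +oo[ : set R)).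
Variables (k : R.-pker V ~> V) (gam : probability Om R).
Hypothesis hgam : wiener gam (fun t (w : Om) => w t).
Context {d0} {T0 : measurableType d0} (P0 : probability T0 R) (B : R -> T0 -> V).
Hypothesis hB : wiener P0 B.
Variable sigma : R.
Hypothesis sigma0 : (0 < sigma)%R.
Local Notation tau := (tau sigma).
Variable x : V.
Hypothesis ik : forall i, (fiber k x).-integrable setT (fun y : V => (y ord0 i)%:E).
Context {d1} {T1 : measurableType d1} (P1 : probability T1 R) (U M : R -> T1 -> V).
Hypothesis hU : foellmer_process P0 B sigma x (k x) P1 U.
Hypothesis hM : doob_martingale P1 U M.

(* [obs] maps the Foellmer process to the observation process
   [s *: (y - x) + W s]; its noise [bridge_motion] is again a Wiener process. *)
Let scale s : R := ((sigma ^+ 2 * (1 - tau s))^-1)%R.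
Let obs (u : R -> V) (s : R) : V := (scale s *: (u (tau s) - x))%R.
Let Q s w := obs (U ^~ w) s.

Let tau01 s : (0 <= s)%R -> (0 <= tau s <= 1)%R.
Proof. by move=> s0; rewrite tau_ge0// ltW// tau_lt1. Qed.

Let mU t : (0 <= t <= 1)%R -> measurable_fun setT (U t).
Proof. by move=> ht; have [h _ _ _ _] := hU; exact: h. Qed.

Let mU1 : measurable_fun setT (U 1%R). Proof. by apply: mU; rewrite ler01 lexx. Qed.

Let mQ s : (0 <= s)%R -> measurable_fun setT (Q s).
Proof.
by move=> s0; apply: measurable_rVZ => //; apply: measurable_rVB => //; apply: mU; exact: tau01.
Qed.

Let mobs : measurable_fun setT (fun u : paths d `[0%R, 1%R] => (obs u : Om)).
Proof.
apply: measurable_paths => s; rewrite /= in_itv/= andbT => s0.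
apply: measurable_rVZ => //; apply: measurable_rVB => //.
by apply: measurable_eval; rewrite /= in_itv/=; exact: tau01.
Qed.

Lemma obs_bridge y w s : (0 <= s)%R ->
  obs (fun t => brownian_bridge B sigma x y t w) s =
  shift_path (y - x) (bridge_motion B sigma ^~ w) s.
Proof.
move=> s0; have ts := tau_onem sigma s0; have dn := tau_den sigma s0.
(* This identity characterizes [tau]: the drift t (y - x) of the bridge is rescaled to s (y - x). *)
have e : (tau s / (sigma ^+ 2 * (1 - tau s)) = s)%R.
  by rewrite ts /Defs.tau; field; rewrite !gt_eqF.
have t1 : (1 - tau s != 0)%R by rewrite ts invr_neq0// gt_eqF.
rewrite /obs /scale /shift_path /bridge_motion /brownian_bridge.
apply/rowP => i; rewrite !mxE -[X in _ = (_ + X * _)%R]e.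
by move: t1; move: (B _ _ _ _) (B _ _ _ _) => b c; move: (tau s) => t t1; field; rewrite t1 gt_eqF.
Qed.

Let gam0_eq y (A : set Om) : measurable A ->
  P0 [set w | A (shift_path y (bridge_motion B sigma ^~ w))] =
  gam [set w : Om | A (shift_path y w)].
Proof.
move=> mA.
have wb := wiener_bridge hB sigma0.
have mb : measurable_fun setT (path_map (bridge_motion B sigma)).
  by apply: measurable_path_map; have [] := wb.
have mA' : measurable [set w : Om | A (shift_path y w)].
  exact: (measurable_preimage (F := fun w : Om => (shift_path y w : Om)) (@measurable_shift_path _ _ _ y) mA).
by rewrite -(wiener_unique (wiener_law mb wb) hgam mA').
Qed.

Let hrect (C : set V) (A : set Om) : measurable C -> measurable A ->
  P1 (U 1%R @^-1` C `&` path_map Q @^-1` A) =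
  \int[fiber k x]_(y in C) gam [set w : Om | A (shift_path (y - x) w)].
Proof.
move=> mC mA; have [_ _ _ _ h] := hU.
have mA' : measurable [set u : paths d `[0%R, 1%R] | A (obs u)].
  exact: (measurable_preimage (F := fun u : paths d `[0%R, 1%R] => (obs u : Om)) mobs mA).
have := h _ C mA' mC; rewrite setIC => ->.
apply: eq_integral => y _; rewrite -gam0_eq// /path_law; congr (P0 _).
apply/seteqP; split => w /=; apply: (paths_ext mA) => s; rewrite /= in_itv/= andbT => s0.
  exact: obs_bridge.
exact/esym/obs_bridge.
Qed.

Let pairY (y : V) (w : Om) : V * Om := (y, (shift_path (y - x) w : Om)).

Let mpair : measurable_fun setT (fun z : V * Om => pairY z.1 z.2).
Proof.
apply: measurable_fun_pair; first exact: measurable_fst.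
apply: measurable_shift_path2; last exact: measurable_snd.
by apply: measurable_rVB; [exact: measurable_fst|exact: measurable_cst].
Qed.

Let mpairy y : measurable_fun setT (pairY y).
Proof. exact: (measurable_slice y mpair). Qed.

Let eta (y : V) : {measure set (V * Om) -> \bar R} := law gam (mpairy y).

Let meta A : measurable A -> measurable_fun setT (eta ^~ A).
Proof.
move=> mA; pose F (z : V * Om) := (\1_A (pairY z.1 z.2) : R)%:E.
have mF : measurable_fun setT F.
  by apply/measurable_EFinP; apply: (measurableT_comp (f := \1_A : V * Om -> R)) mpair.
have F0 z : 0 <= F z by rewrite lee_fin.
apply: (eq_measurable_fun (fun y => \int[gam]_w F (y, w))).
  move=> y _; rewrite /eta /law /=.
  transitivity (\int[gam]_w (\1_(pairY y @^-1` A) w : R)%:E); first by [].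
  by rewrite integral_indic ?setIT//; exact: measurable_preimage.
exact: (@measurable_fun_fubini_tonelli_F _ _ _ _ _ gam F mF F0).
Qed.

(** The Foellmer fibre is an observation model whose initial law is the Dirac mass at [x]. On
    rectangles this is the bridge description of the process given its end point, with
    [wiener_unique] replacing the rescaled bridge noise by [gam]. *)
Let hmodel (f : (V * V) * Om -> \bar R) : measurable_fun setT f -> (forall z, 0 <= f z) ->
  \int[P1]_w f ((cst x w, U 1%R w), path_map Q w) =
  \int[dirac x]_x' \int[fiber k x']_y \int[gam]_w f ((x', y), shift_path (y - x') w).
Proof.
move=> mf f0.
rewrite [RHS]integral_dirac//; last by exact: measurable_model_integral.
rewrite diracT mul1e.
pose g (z : V * Om) := f ((x, z.1), z.2).
have mg : measurable_fun setT g.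
  apply: (measurableT_comp mf); apply: measurable_fun_pair; last exact: measurable_snd.
  by apply: measurable_fun_pair; [exact: measurable_cst|exact: measurable_fst].
have g0 z : 0 <= g z by exact: f0.
have mUQ : measurable_fun setT (fun w => (U 1%R w, path_map Q w)).
  by apply: measurable_fun_pair => //; exact: measurable_path_map.
transitivity (\int[law P1 mUQ]_z g z); first by rewrite integral_law.
transitivity (\int[mixture (fiber k x) meta]_z g z); last first.
  transitivity (\int[fiber k x]_y \int[eta y]_z g z); first exact: integral_mixture.
  by apply: eq_integral => y _; rewrite integral_law.
apply: eq_measure_integral => A mA _.
have [G1 G2 G3 G4] := @rectangles_pi _ _ V Om.
apply: (measure_eq_pi G1 G2 G3 G4) mA.
  by rewrite /law /= preimage_setT -[X in X < _]/(P1 setT) [X in X < _]probability_setT ltry.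
move=> _ [C mC [D mD <-]].
transitivity (P1 (U 1%R @^-1` C `&` path_map Q @^-1` D)); first by [].
rewrite hrect// /mixture integral_mkcond; apply: eq_integral => y _.
rewrite patchE /eta /law /=; case: ifPn => [yC|yC].
  congr (gam _); apply/seteqP; split => w /= h; last by case: h.
  by split => //; move: yC; rewrite inE.
rewrite (_ : _ @^-1` _ = set0) ?measure0//.
by apply/seteqP; split => w //= [h _]; move: yC; rewrite notin_setE.
Qed.

Section at_time.
Variable s : R.
Hypothesis s0 : (0 <= s)%R.
Let G := sigma_process `[0%R, tau s] U.

Let Gsigma : sigma_algebra setT G.
Proof. exact: smallest_sigma_algebra. Qed.

Let Gmeas : G `<=` measurable.
Proof.
apply: smallest_sub; first exact: sigma_algebra_measurable.
move=> _ [t + [C mC <-]]; rewrite /= in_itv/= => /andP[t0 ts].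
rewrite setTI; apply: measurable_preimage mC; apply: mU.
by rewrite t0 (le_trans ts)// ltW// tau_lt1.
Qed.

(** The inverse of [tau]. With it [unobs] recovers the process on [0, tau s] from the observation on
    [0, s], so that both generate the same events. *)
Let rho (u : R) : R := (u / (sigma ^+ 2 * (1 - u)))%R.

Let rhoK u : (0 <= u <= tau s)%R -> (0 <= rho u <= s)%R /\ tau (rho u) = u.
Proof.
move=> /andP[u0 us]; have u1 : (0 < 1 - u)%R by rewrite subr_gt0 (le_lt_trans us)// tau_lt1.
have s2 : (0 < sigma ^+ 2)%R by rewrite exprn_gt0.
split; last by rewrite /rho /Defs.tau; field; rewrite subrK oner_eq0 !gt_eqF.
apply/andP; split; first by rewrite divr_ge0// mulr_ge0// ltW.
rewrite /rho ler_pdivrMr ?mulr_gt0//.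
have e : (tau s = sigma ^+ 2 * s * (1 - tau s))%R.
  by rewrite (tau_onem sigma s0).
apply: (le_trans us); rewrite e mulrA [(s * _)%R]mulrC ler_wpM2l//.
  by rewrite mulr_ge0// ltW.
by rewrite lerD2l lerN2.
Qed.

Let unobs (q : R -> V) (u : R) : V := (x + (sigma ^+ 2 * (1 - u)) *: q (rho u))%R.

Let unobsK (v : R -> V) u : (0 <= u <= tau s)%R -> unobs (obs v) u = v u.
Proof.
move=> hu; have [_ tu] := rhoK hu; rewrite /unobs /obs /scale tu scalerA mulfV.
  by rewrite scale1r addrC subrK.
have /andP[_ us] := hu.
by rewrite gt_eqF// mulr_gt0 ?exprn_gt0// subr_gt0 (le_lt_trans us)// tau_lt1.
Qed.

(** Doob martingale and posterior mean are conditional expectations of the same end point with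
    respect to the same events. *)
Lemma foellmer_posterior : {ae P1, forall w, M (tau s) w = post_mean k s (x, Q s w)}.
Proof.
apply: (condexp_vec_unique Gsigma Gmeas (hM (tau01 s0))).
apply: (post_condexp hgam (measurable_cst x) mU1 mQ hmodel s0).
- move=> A /sigma_processP[A0 mA0 ->].
  have munobs : measurable_fun setT (fun q : paths d `[0%R, s] => (unobs q : paths d `[0%R, tau s])).
    apply: measurable_paths => u; rewrite /= in_itv/= => /rhoK[hu _].
    apply: measurable_rVD => //; apply: measurable_rVZ => //.
    by apply: measurable_eval; rewrite /= in_itv.
  exists [set z : V * paths d `[0%R, s] | A0 (unobs z.2)].
    by apply: (measurable_preimage _ mA0); exact: (measurableT_comp munobs measurable_snd).
  apply/seteqP; split => w /=; apply: (paths_ext mA0) => u; rewrite /= in_itv/= => hu.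
    exact/esym/unobsK.
  exact: unobsK.
- move=> D mD; apply: sub_gen_smallest; exists (tau s).
    by rewrite /= in_itv/= lexx tau_ge0.
  exists [set v : V | D (x, scale s *: (v - x))%R]; last by rewrite setTI.
  apply: (measurable_preimage _ mD); apply: measurable_fun_pair => //.
  by apply: measurable_rVZ => //; exact: measurable_rVB.
- move=> i; apply/integrableP; split.
    by apply/measurable_EFinP; exact: measurable_coordT.
  have /integrableP[mi fi] := ik i.
  have [_ _ _ hU1 _] := hU.
  apply: le_lt_trans fi.
  have mn : measurable_fun setT (fun y : V => `|(y ord0 i)%:E|) by exact: measurableT_comp.
  have -> : \int[P1]_w `|(U 1%R w ord0 i)%:E| = \int[law P1 mU1]_y `|(y ord0 i)%:E|.
    by rewrite integral_law.
  rewrite le_eqVlt; apply/orP; left; apply/eqP.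
  by apply: eq_measure_integral => C mC _; exact: hU1.
Qed.

Lemma measurable_doob : measurable_fun setT (M (tau s)).
Proof. by move=> _ C mC; rewrite setTI; apply: Gmeas; have [+ _] := hM (tau01 s0); exact. Qed.

End at_time.

Lemma foellmer_fiber_law (A : set Om) : measurable A ->
  path_law P1 (fun s => M (tau s)) A = \int[fiber k x]_y \int[gam]_w
    (\1_A (fun s => post_mean k s (x, shift_path (y - x) w s)))%:E.
Proof.
move=> mA.
rewrite (post_mean_law (measurable_cst x) mQ hmodel measurable_doob foellmer_posterior mA).
rewrite integral_dirac ?diracT ?mul1e//.
exact: measurable_posterior_law.
Qed.

End foellmer_fiber.

Lemma foellmer_martingale_law {R : realType} {d} (k : R.-pker 'rV[R]_d ~> 'rV[R]_d)
    (mu : probability 'rV[R]_d R) (gam : probability (paths d (`[0%R, +oo[ : set R)) R)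
    {d0} {T0 : measurableType d0} (P0 : probability T0 R) (B : R -> T0 -> 'rV[R]_d) (sigma : R)
    {d1} {T1 : measurableType d1} (P1 : probability T1 R) (M : R -> T1 -> 'rV[R]_d) :
  wiener gam (fun t (w : paths d (`[0%R, +oo[ : set R)) => w t) -> wiener P0 B -> 0 < sigma ->
  {ae mu, forall x i, (fiber k x).-integrable setT (fun y : 'rV[R]_d => (y ord0 i)%:E)} ->
  foellmer_martingale P0 B sigma mu k P1 M ->
  forall A : set (paths d (`[0%R, +oo[ : set R)), measurable A ->
  path_law P1 (fun s => M (tau sigma s)) A =
  (\int[mu]_x \int[fiber k x]_y \int[gam]_w
    (\1_A (fun s => post_mean k s (x, shift_path (y - x) w s)))%:E)%E.
Proof.
move=> hgam hB sigma0 hk [mM [q [hq Mq]]] A mA.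
(* The law of [M] is prescribed on [0, 1]; the times [tau sigma s] stay in [0, 1), so [A] pulls back
   to an event there. *)
pose A' : set (paths d `[0%R, 1%R]) := [set v | A (fun s => v (tau sigma s))].
have mA' : measurable A'.
  apply: (measurable_preimage (F := fun v : paths d `[0%R, 1%R] =>
    (fun s => v (tau sigma s) : 'rV[R]_d) : paths d (`[0%R, +oo[ : set R)) _ mA).
  apply: measurable_paths => s; rewrite /= in_itv/= andbT => s0.
  by apply: measurable_eval; rewrite /= in_itv/= tau_ge0// ltW// tau_lt1.
transitivity (\int[mu]_x q x A')%E; first exact: (Mq _ mA').
apply: ge0_ae_eq_integral => //.
- exact: measurable_kernel.
- exact: measurable_posterior_law.
- by move=> x _; apply: integral_ge0 => y _; apply: integral_ge0 => w _; rewrite lee_fin.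
apply: ae_imp (ae_and hk hq) => x [ik [d2 [T2 [P2 [U [N [hU hN hQ]]]]]]] _.
rewrite (hQ _ mA').
exact: (foellmer_fiber_law hgam hB sigma0 ik hU hN mA).
Qed.

Lemma measurable_bool_natr {R : realType} {disp} {T : measurableType disp} (b : T -> bool) :
  measurable_fun setT b -> measurable_fun setT (fun w => (b w : nat)%:R : R).
Proof.
move=> mb; rewrite (_ : (fun w => _) = (fun w => if b w then 1 else 0)).
  exact: measurable_fun_ifT.
by apply/funext => w; case: (b w).
Qed.

(** * Paths of the posterior mean *)

Section maximal.
Local Open Scope ereal_scope.
Context {R : realType} {d : nat}.
Local Notation V := 'rV[R]_d.
Local Notation Om := (paths d (`[0%R, +oo[ : set R)).
Variable gam : probability Om R.
Hypothesis hgam : wiener gam (fun t (w : Om) => w t).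

Section ville.
Variables (v : V) (c : R).
Hypothesis c0 : (0 < c)%R.
Let E t (w : R -> V) := expmart t (w t) v.
Let mE t (D : set R) : D t -> measurable_fun setT (fun w : paths d D => E t w).
Proof. by move=> Dt; apply: measurable_expmart => //; exact: measurable_eval. Qed.

Let hit (l : seq R) (w : R -> V) : bool := has (fun t => c <= E t w)%R l.

Let mhit (l : seq R) : (forall t, t \in l -> (0 <= t)%R) ->
  measurable_fun setT (fun w : Om => hit l w).
Proof.
elim: l => [_|t l ih h]; first exact: measurable_cst.
rewrite /hit /=; apply: measurable_or.
  by apply: measurable_fun_ler => //; apply: mE; rewrite /= in_itv/= andbT h// mem_head.
by apply: ih => u ul; apply: h; rewrite in_cons ul orbT.
Qed.

(* Doob's maximal inequality for the exponential martingale, by splitting at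
   the first time of the grid where it exceeds [c]. *)
Lemma expmart_hit (l : seq R) s (f : paths d `[0%R, s] -> \bar R) :
  (0 <= s)%R -> path <=%R s l -> measurable_fun setT f -> (forall w, 0 <= f w) ->
  \int[gam]_w (f w * (c * (hit l w : nat)%:R)%:E) <= \int[gam]_w (f w * (E s w)%:E).
Proof.
elim: l s f => [|t l ih] s f s0 /=.
  move=> _ mf f0; rewrite integral0_eq ?integral_ge0//.
    by move=> w _; rewrite mule_ge0// lee_fin expR_ge0.
  by move=> w _; rewrite /hit /= mulr0 mule0.
move=> /andP[st pl] mf f0.
have t0 : (0 <= t)%R := le_trans s0 st.
have tt : `[0%R, t]%classic t by rewrite /= in_itv/= t0 lexx.
(* [g] keeps the paths that are above the level at [t], where [E t] dominates [c]; [h] keeps the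
   others, to which the induction hypothesis started at [t] applies. *)
pose g (w : paths d `[0%R, t]) : \bar R := f w * ((c <= E t w)%R : nat)%:R%:E.
pose h (w : paths d `[0%R, t]) : \bar R := f w * (~~ (c <= E t w)%R : nat)%:R%:E.
have mft : measurable_fun setT (fun w : paths d `[0%R, t] => f w).
  apply: (measurableT_comp mf); apply: measurable_paths_sub => u.
  by rewrite /= !in_itv/= => /andP[-> us]; exact: le_trans st.
have mb : measurable_fun setT (fun w : paths d `[0%R, t] => (c <= E t w)%R).
  by apply: measurable_fun_ler => //; exact: mE.
have mg : measurable_fun setT g.
  by apply: emeasurable_funM => //; apply/measurable_EFinP; exact: measurable_bool_natr.
have mh : measurable_fun setT h.
  apply: emeasurable_funM => //; apply/measurable_EFinP; apply: measurable_bool_natr.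
  exact: measurable_neg.
have g0 w : 0 <= g w by rewrite mule_ge0// lee_fin.
have h0 w : 0 <= h w by rewrite mule_ge0// lee_fin.
have mEO : measurable_fun setT (fun w : Om => E t w) by apply: mE; rewrite /= in_itv/= t0.
have mgO : measurable_fun setT (fun w : Om => g w) by exact: (measurableT_comp mg (@measurable_restr R d t)).
have mhO : measurable_fun setT (fun w : Om => h w) by exact: (measurableT_comp mh (@measurable_restr R d t)).
have pt : forall u, u \in l -> (0 <= u)%R.
  move=> u ul; apply: (le_trans t0).
  by have /allP := order_path_min le_trans pl; exact.
apply: (@le_trans _ _ (\int[gam]_w (g w * (E t w)%:E) +
    \int[gam]_w (h w * (c * (hit l w : nat)%:R)%:E))).
  rewrite -ge0_integralD//; first last.
  - apply: emeasurable_funM => //; apply/measurable_EFinP; apply: measurable_funM => //.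
    by apply: measurable_bool_natr; exact: mhit.
  - by move=> w _; rewrite mule_ge0// lee_fin mulr_ge0// ltW.
  - by apply: emeasurable_funM => //; exact/measurable_EFinP.
  - by move=> w _; rewrite mule_ge0// lee_fin expR_ge0.
  apply: ge0_le_integral => //.
  - by move=> w _; rewrite mule_ge0// lee_fin mulr_ge0// ltW.
  - apply: emeasurable_funM.
      exact: (measurableT_comp mft (@measurable_restr R d t)).
    apply/measurable_EFinP; apply: measurable_funM => //.
    apply: measurable_bool_natr; apply: (mhit (l := t :: l)) => u.
    by rewrite in_cons => /orP[/eqP ->//|]; exact: pt.
  - apply: emeasurable_funD; apply: emeasurable_funM => //; apply/measurable_EFinP => //.
    by apply: measurable_funM => //; apply: measurable_bool_natr; exact: mhit.
  move=> w _; rewrite /g /h /hit /=; case: (leP c (E t w)) => hc /=.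
    by rewrite mulr1 mule1 mule0 mul0e adde0 lee_wpmul2l// lee_fin.
  by rewrite mule0 mul0e add0e mule1.
apply: (@le_trans _ _ (\int[gam]_w (g w * (E t w)%:E) + \int[gam]_w (h w * (E t w)%:E))).
  by rewrite leeD2l// ih.
rewrite -ge0_integralD//; first last.
- by apply: emeasurable_funM => //; exact/measurable_EFinP.
- by move=> w _; rewrite mule_ge0// lee_fin expR_ge0.
- by apply: emeasurable_funM => //; exact/measurable_EFinP.
- by move=> w _; rewrite mule_ge0// lee_fin expR_ge0.
rewrite -(wiener_expmart hgam v s0 st mf f0).
rewrite le_eqVlt; apply/orP; left; apply/eqP; apply: eq_integral => w _.
rewrite -ge0_muleDl// /g /h; congr (_ * _).
by case: (leP c (E t w)) => _; rewrite /= mule1 mule0 ?adde0 ?add0e.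
Qed.

Lemma measurable_hit (l : seq R) : (forall t, t \in l -> (0 <= t)%R) ->
  measurable [set w : Om | has (fun t => c <= expmart t (w t) v)%R l].
Proof.
by move=> l0; have := mhit l0 measurableT (Y := [set true]) Logic.I; rewrite setTI.
Qed.

Lemma expmart_hit_prob (l : seq R) : sorted <=%R l -> (forall t, t \in l -> (0 <= t)%R) ->
  c%:E * gam [set w : Om | has (fun t => c <= expmart t (w t) v)%R l] <= 1.
Proof.
move=> sl l0.
have pl : path <=%R 0%R l.
  case: l sl l0 => [//|t l] /= tl l0; rewrite tl andbT; apply: l0; exact: mem_head.
have mH : measurable [set w : Om | hit l w] by exact: measurable_hit.
apply: (@le_trans _ _ (\int[gam]_w (cst 1 w * (c * (hit l w : nat)%:R)%:E))).
  have -> : \int[gam]_w (cst 1 w * (c * (hit l w : nat)%:R)%:E) =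
      \int[gam]_w (c%:E * (\1_[set w : Om | hit l w] w)%:E).
    apply: eq_integral => w _; rewrite mul1e -EFinM indicE; congr (_ * (nat_of_bool _)%:R)%:E.
    by apply/idP/idP; rewrite inE.
  rewrite ge0_integralZl//; first by rewrite integral_indic// setIT.
    by apply/measurable_EFinP.
  by rewrite lee_fin ltW.
apply: le_trans (expmart_hit (f := cst 1) (lexx 0%R) pl (measurable_cst _) (fun=> lee01)) _.
have [_ h0 _ _] := hgam.
rewrite (_ : \int[gam]_w _ = \int[gam]_w cst 1 w).
  rewrite integral_cst// mul1e [X in X <= _](_ : _ = 1)//; exact: probability_setT.
apply: ge0_ae_eq_integral => //.
- apply: emeasurable_funM => //; apply/measurable_EFinP; apply: mE.
  by rewrite /= in_itv/= lexx.
- by move=> w _; rewrite mul1e lee_fin expR_ge0.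
by apply: ae_imp h0 => w w0 _; rewrite /E /expmart w0 dot0l !mul0r subr0 expR0 mul1e.
Qed.

End ville.

(** An enumeration of the rationals, so that an event over all rational times of an interval is a
    countable union of cylinder events. *)
Definition rat_time (n : nat) : R := ratr (odflt 0%R (unpickle n : option rat)).

Lemma measurable_exceed (S lam : R) (i : 'I_d) (sg : bool) :
  measurable [set w : Om | exists n, (0 <= rat_time n <= S)%R /\
    (lam <= (-1) ^+ sg * w (rat_time n) ord0 i)%R].
Proof.
rewrite (_ : [set w | _] = \bigcup_n (if (0 <= rat_time n <= S)%R then
  [set w : Om | (lam <= (-1) ^+ sg * w (rat_time n) ord0 i)%R] else set0)).
  apply: bigcupT_measurable => n; case: ifP => // /andP[h _].
  have mb : measurable_fun setT (fun w : Om => (lam <= (-1) ^+ sg * w (rat_time n) ord0 i)%R).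
    apply: measurable_fun_ler => //; apply: measurable_funM => //.
    by apply: measurable_coordT; exact: measurable_evalT.
  by have := mb measurableT [set true] Logic.I; rewrite setTI.
apply/seteqP; split => [w [n [h1 h2]]|w [n _]]; first by exists n => //; rewrite h1.
by case: ifP => // h1 h2; exists n.
Qed.

(** The maximal inequality with v = +-(lam / S) e_i and level c = exp (lam^2 / (2 S)): if the signed
    coordinate reaches lam at a time t <= S, the exponent is at least lam^2 / S - t lam^2 / (2 S^2)
    >= lam^2 / (2 S). Finite sets of rational times increase to all of them. *)
Lemma sup_tail (S lam : R) (i : 'I_d) (sg : bool) : (0 < S)%R -> (0 <= lam)%R ->
  gam [set w : Om | exists n, (0 <= rat_time n <= S)%R /\
    (lam <= (-1) ^+ sg * w (rat_time n) ord0 i)%R] <= (expR (- (lam ^+ 2 / (S *+ 2))))%:E.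
Proof.
move=> S0 lam0.
pose v : V := (\row_j ((-1) ^+ sg * (lam / S) * (j == i)%:R))%R.
pose c := expR (lam ^+ 2 / (S *+ 2)).
have dotv (u : V) : dot u v = ((-1) ^+ sg * (lam / S) * u ord0 i)%R.
  rewrite /dot (bigD1 i)//= big1 => [|j ji]; rewrite mxE ?eqxx ?mulr1 ?addr0 1?mulrC//.
  by rewrite (negbTE ji) mulr0 mul0r.
have sg2 : ((-1) ^+ sg * (-1) ^+ sg = 1 :> R)%R by rewrite -expr2 sqrr_sign.
pose l (m : nat) := sort <=%R [seq rat_time n | n <- iota 0 m & (0 <= rat_time n <= S)%R].
have lP m t : reflect (exists2 n, (n < m)%N & (0 <= rat_time n <= S)%R /\ t = rat_time n) (t \in l m).
  rewrite /l mem_sort; apply: (iffP mapP) => [[n]|[n nm [h ->]]].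
    by rewrite mem_filter mem_iota add0n => /andP[h /= nm] ->; exists n.
  by exists n => //; rewrite mem_filter h mem_iota add0n.
pose F m := [set w : Om | has (fun t => c <= expmart t (w t) v)%R (l m)].
have l0 m t : t \in l m -> (0 <= t)%R by move=> /lP[n _ [/andP[h _] ->]].
have mF m : measurable (F m) by apply: measurable_hit; exact: l0.
have bF m : gam (F m) <= c^-1%:E.
  have c0 : (0 < c)%R by exact: expR_gt0.
  have := expmart_hit_prob v c0 (sort_le_sorted _) (@l0 m).
  by rewrite -lee_pdivlMl// mule1.
have ndF : nondecreasing_seq F.
  move=> m n mn; apply/subsetPset => w /hasP[t /lP[j jm [h ->]] ht].
  apply/hasP; exists (rat_time j) => //; apply/lP; exists j => //.
  exact: leq_trans mn.
rewrite expRN -/c; apply: (@le_trans _ _ (gam (\bigcup_m F m))).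
  apply: le_measure; rewrite ?inE.
  - exact: measurable_exceed.
  - exact: bigcupT_measurable.
  move=> w [n [h1 h2]]; exists n.+1 => //; apply/hasP; exists (rat_time n).
    by apply/lP; exists n.
  have /andP[t0 tS] := h1.
  rewrite ler_expR dotv dotv mxE eqxx mulr1.
  move: h2; move: (w (rat_time n) ord0 i) (rat_time n) t0 tS ((-1) ^+ sg)%R sg2 => u t t0 tS e e2 h2.
  have -> : (e * (lam / S) * (e * (lam / S)) = (lam / S) ^+ 2)%R by rewrite mulrACA e2 mul1r.
  have -> : (lam ^+ 2 / (S *+ 2) = (lam / S) ^+ 2 * S / 2)%R by field; rewrite gt_eqF.
  have lamE : (lam = lam / S * S)%R by field; rewrite gt_eqF.
  have q0 : (0 <= lam / S)%R by rewrite divr_ge0// ltW.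
  move: lamE q0; move: (lam / S)%R => q lamE q0.
  have h3 : (q * lam <= e * q * w t ord0 i)%R by rewrite [(e * q)%R]mulrC -mulrA ler_wpM2l.
  have h4 : (t * q ^+ 2 <= S * q ^+ 2)%R by rewrite ler_wpM2r// sqr_ge0.
  have h5 : (q * lam = q ^+ 2 * S)%R by rewrite lamE; ring.
  lra.
apply: (cvge_to_le (nondecreasing_cvg_mu (mu := gam) mF (bigcupT_measurable F mF) ndF)).
exact: nearW.
Qed.

(* Borel-Cantelli along the times [exp (-n)]. *)
Lemma small_time_ae (b : R) : (0 < b)%R ->
  {ae gam, forall w : Om, forall i, exists N, forall n m, (N <= n)%N ->
    (0 <= rat_time m <= expR (- n%:R))%R ->
    (w (rat_time m) ord0 i ^+ 2 <= b * n%:R * expR (- n%:R))%R}.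
Proof.
move=> b0; apply: filter_forall => i.
pose S (n : nat) := (expR (- n%:R) : R)%R.
(* With this threshold the bound exp (- lam^2 / (2 S)) becomes exp (- b n / 2), a geometric
   sequence. *)
pose lam (n : nat) := Num.sqrt (b * n%:R * S n)%R.
have S0 n : (0 < S n)%R by exact: expR_gt0.
have lam2 n : (lam n ^+ 2 = b * n%:R * S n)%R.
  by rewrite sqr_sqrtr// !mulr_ge0// ltW.
pose D (sg : bool) n := [set w : Om | exists m, (0 <= rat_time m <= S n)%R /\
    (lam n <= (-1) ^+ sg * w (rat_time m) ord0 i)%R].
have mD sg n : measurable (D sg n) by exact: measurable_exceed.
pose r := (expR (- (b / 2)) : R)%R.
have r1 : (r < 1)%R by rewrite -[X in (_ < X)%R]expR0 ltr_expR oppr_lt0 divr_gt0.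
have bound sg n : gam (D sg n) <= (r ^+ n)%:E.
  apply: le_trans (sup_tail i sg (S0 n) (sqrtr_ge0 _)) _.
  rewrite lee_fin lam2 -expRM_natl ler_expR -mulr_natr le_eqVlt; apply/orP; left; apply/eqP.
  by field; rewrite gt_eqF.
have D0 sg : gam (lim_sup_set (D sg)) = 0.
  apply: lim_sup_set_cvg0 => //.
  apply: (@le_lt_trans _ _ ((1 - r)^-1)%:E); last by rewrite ltry.
  apply: lime_le; first exact: is_cvg_nneseries.
  apply: nearW => n; apply: (@le_trans _ _ ((1 - r ^+ n) / (1 - r))%:E).
    elim: n => [|n ih]; first by rewrite big_geq// expr0 subrr mul0r.
    rewrite big_nat_recr//=; apply: (le_trans (leeD ih (bound sg n))).
    rewrite -EFinD lee_fin le_eqVlt; apply/orP; left; apply/eqP.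
    by rewrite exprS; field; rewrite subr_eq0 gt_eqF.
  rewrite lee_fin; apply: ler_piMl; first by rewrite invr_ge0 subr_ge0 ltW.
  by rewrite gerBl exprn_ge0// expR_ge0.
have ev sg : {ae gam, forall w : Om, exists N, forall n, (N <= n)%N -> ~ D sg n w}.
  exists (lim_sup_set (D sg)); split => //.
    apply: bigcapT_measurable => n; apply: bigcup_measurable => j _; exact: mD.
  move=> w /= hn N _; apply: contrapT => h2; apply: hn; exists N => j Nj Dj; apply: h2.
  by exists j.
apply: ae_imp (ae_and (ev false) (ev true)) => w [[N1 h1] [N2 h2]].
exists (maxn N1 N2) => n m; rewrite geq_max => /andP[n1 n2] hm; rewrite -/(S n) -lam2.
have q1 : (w (rat_time m) ord0 i < lam n)%R.
  rewrite ltNge; apply/negP => h; apply: (h1 n n1); exists m; split => //.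
  by rewrite expr0 mul1r.
have q2 : (- w (rat_time m) ord0 i < lam n)%R.
  rewrite ltNge; apply/negP => h; apply: (h2 n n2); exists m; split => //.
  by rewrite expr1 mulN1r.
rewrite -real_normK ?num_real// ler_sqr ?nnegrE ?normr_ge0 ?sqrtr_ge0//.
by rewrite ler_norml lerNl !ltW.
Qed.

End maximal.

(** * Continuity of the posterior mean along one path *)

Section posterior_path.
Local Open Scope ereal_scope.
Context {R : realType} {d : nat}.
Local Notation V := 'rV[R]_d.
Variables (k : R.-pker V ~> V) (x : V).
Hypothesis iS : (fiber k x).-integrable setT (fun y : V => (dot y y)%:E).

Lemma coord2_le (y : V) i : (y ord0 i ^+ 2 <= dot y y)%R.
Proof.
rewrite /dot (bigD1 i)//= -expr2 lerDl sumr_ge0// => j _.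
by rewrite -expr2 sqr_ge0.
Qed.

Lemma coord_le_norm (q : V) i : (`|q ord0 i| <= `|q|)%R.
Proof.
rewrite [X in (_ <= X)%R]/Num.norm /= mx_normrE.
exact: (le_bigmax _ (fun ij : 'I_1 * 'I_d => `|q ij.1 ij.2|%R) (ord0, i)).
Qed.

Lemma dot_le_norm (q v : V) : (dot q v <= `|q| * \sum_(i < d) `|v ord0 i|)%R.
Proof.
rewrite mulr_sumr; apply: ler_sum => i _; apply: (le_trans (ler_norm _)).
by rewrite normrM ler_wpM2r// coord_le_norm.
Qed.

(** The norm of row vectors is the maximum norm; this comparison is the origin of the factor d in
    the small-time bounds. *)
Lemma dot_self_le (q : V) : (dot q q <= d%:R * `|q| ^+ 2)%R.
Proof.
rewrite /dot; apply: (@le_trans _ _ (\sum_(i < d) `|q| ^+ 2)%R).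
  apply: ler_sum => i _; rewrite -expr2 -real_normK ?num_real//.
  by rewrite ler_sqr ?nnegrE// coord_le_norm.
by rewrite sumr_const card_ord mulr_natl.
Qed.

Lemma dotB_le (y z : V) : (dot (y - z) (y - z) <= 2 * dot y y + 2 * dot z z)%R.
Proof.
rewrite /dot !mulr_sumr -big_split; apply: ler_sum => i _ /=.
by rewrite !mxE; move: (y ord0 i) (z ord0 i) => a b; have := sqr_ge0 (a + b)%R; rewrite expr2; nra.
Qed.

Lemma mul_sum_norm_le (g : R) (v : V) :
  (g * \sum_(i < d) `|v ord0 i| <= d%:R * g ^+ 2 + dot v v)%R.
Proof.
rewrite mulr_natl -[X in (_ *+ X)%R](card_ord d) -sumr_const /dot mulr_sumr -big_split.
apply: ler_sum => i _ /=; rewrite -expr2 -[X in (_ + X)%R]real_normK ?num_real//.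
by move: (`|v ord0 i|)%R => a; nra.
Qed.

Let int_affine (a b : R) :
  (fiber k x).-integrable setT (fun y : V => (a + b * dot y y)%:E).
Proof.
have i1 : (fiber k x).-integrable setT (EFin \o cst a).
  exact: finite_measure_integrable_cst.
exact: (integrableD measurableT i1 (integrableZl measurableT b iS)).
Qed.

Lemma integrable_coord i : (fiber k x).-integrable setT (fun y : V => (y ord0 i)%:E).
Proof.
apply: (le_integrable measurableT _ _ (int_affine 1 1)).
  by apply/measurable_EFinP; exact: measurable_coord.
move=> y _ /=; rewrite lee_fin mul1r [X in (_ <= X)%R]ger0_norm ?addr_ge0 ?dot_ge0//.
have := coord2_le y i; rewrite -real_normK ?num_real//.
have := normr_ge0 (y ord0 i); move: (`|y ord0 i|)%R => a; nra.
Qed.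

Section near0.
Variables (delta C : R) (q : R -> V).
Hypothesis C0 : (0 <= C)%R.
Hypothesis q0 : q 0%R = 0%R.
Hypothesis cq : (q @ within `[0%R, delta] (nbhs 0%R) --> (0%R : V)).
Hypothesis hC : forall s, (0 < s <= delta)%R ->
  (`|q s| ^+ 2 * expR (d%:R * `|q s| ^+ 2 / s) <= C)%R.

Let weightE s v : weight s (q s) v = expmart s (q s) v.
Proof.
rewrite /weight; case: eqP => // ->.
by rewrite /expmart q0 dot0l !mul0r subr0 expR0.
Qed.

(* With [a = |q s|] and [L = |v|_1], the exponent is at most [a * L], and also
   at most [d * a^2 / (2 s)]; the second bound is used when [a * L > 1]. *)
Lemma weight_small s v : (0 <= s <= delta)%R ->
  (weight s (q s) v <= expR 1 + (1 + C) * \sum_(i < d) `|v ord0 i|)%R.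
Proof.
move=> /andP[s0 sd].
have L0 : (0 <= \sum_(i < d) `|v ord0 i|)%R by rewrite sumr_ge0.
have e1 : (1 <= expR 1 :> R)%R by rewrite -[X in (X <= _)%R]expR0 ler_expR.
move: L0 (dot_le_norm (q s) v); set L := (\sum_(i < d) _)%R => L0 hL.
have [s00|sn0] := eqVneq s 0%R.
  rewrite weightE s00 /expmart q0 dot0l !mul0r subr0 expR0.
  by rewrite (le_trans e1)// lerDl mulr_ge0// addr_ge0.
have sp : (0 < s)%R by rewrite lt_neqAle eq_sym sn0.
have hs : (0 < s <= delta)%R by rewrite sp.
have h := hC hs.
have [aL|aL] := leP (`|q s| * L)%R 1%R.
  apply: (@le_trans _ _ (expR 1)); last by rewrite lerDl mulr_ge0// addr_ge0.
  rewrite weightE ler_expR; apply: le_trans aL; apply: le_trans hL.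
  by rewrite gerBl divr_ge0// mulr_ge0// dot_ge0.
pose E := expR (d%:R * `|q s| ^+ 2 / (s *+ 2)).
have E2 : (E * E = expR (d%:R * `|q s| ^+ 2 / s))%R.
  by rewrite /E -expRD; congr expR; field.
have wE : (weight s (q s) v <= E)%R.
  apply: (le_trans (weight_le _ _ s0)); rewrite ler_expR ler_wpM2r//.
    by rewrite invr_ge0 mulrn_wge0.
  exact: dot_self_le.
have aE : (`|q s| * E <= 1 + C)%R.
  have : ((`|q s| * E) ^+ 2 <= C)%R by rewrite exprMn [(E ^+ 2)%R]expr2 E2.
  have : (0 <= `|q s| * E)%R by rewrite mulr_ge0// expR_ge0.
  move: (`|q s| * E)%R => u u0 uC; nra.
apply: (le_trans wE).
have E0 : (0 <= E)%R by exact: expR_ge0.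
apply: (@le_trans _ _ ((`|q s| * E) * L)%R).
  rewrite mulrAC -[X in (X <= _)%R]mul1r ler_wpM2r// ltW//.
by rewrite (le_trans (ler_wpM2r L0 aE))// lerDr expR_ge0.
Qed.

(** Dominated convergence: both the weight, by [weight_small], and the integrands grow at most
    linearly in y, so their product is dominated by an affine function of |y|^2, integrable by
    [iS]. *)
Lemma post_mean_cvg0 :
  (fun s => post_mean k s (x, q s)) @ within `[0%R, delta] (nbhs 0%R) --> post_mean k 0 (x, 0%R).
Proof.
apply: within_cvg_seq => s_ sA sc.
have s0 n : (0 <= s_ n)%R by have := sA n; rewrite /= in_itv/= => /andP[].
have qc : (fun n => q (s_ n)) @ \oo --> (0%R : V).
  move=> B /cq hB.
  have h : \forall n \near \oo, `[0%R, delta]%classic (s_ n) -> B (q (s_ n)) := sc _ hB.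
  suff : \forall n \near \oo, B (q (s_ n)) by [].
  by apply: filterS h => n; apply; exact: sA.
have main (g : V -> \bar R) : measurable_fun setT g -> (forall y, 0 <= g y) ->
    (forall y, g y \is a fin_num) -> (forall y, (fine (g y) ^+ 2 <= 1 + dot y y)%R) ->
    tilt k g 0 (x, 0%R) \is a fin_num /\
    (fun n => tilt k g (s_ n) (x, q (s_ n))) @ \oo --> tilt k g 0 (x, 0%R).
  move=> mg g0 gf g2.
  have ge y : g y = (fine (g y))%:E by rewrite fineK.
  have ig : \int[fiber k x]_y g y < +oo.
    apply: (@le_lt_trans _ _ (\int[fiber k x]_y (2 + 1 * dot y y)%:E)).
      apply: ge0_le_integral => //; first by have := measurable_int _ (int_affine 2 1).
      move=> y _; rewrite ge lee_fin; have := g2 y; move: (fine (g y)) (dot y y) => a b; nra.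
    exact: integrable_lty (int_affine 2 1).
  split.
    rewrite ge0_fin_numE ?tilt_ge0//; apply: le_lt_trans ig.
    rewrite le_eqVlt; apply/orP; left; apply/eqP; apply: eq_integral => y _.
    by rewrite /weight eqxx mule1.
  (* [a] and [b] collect the terms without and with |y|^2 after g <= 2 + |y|^2, [mul_sum_norm_le]
     and [dotB_le]. *)
  pose a := (2 * expR 1 + (1 + C) * (d%:R + 2 * dot x x))%R.
  pose b := (expR 1 + (1 + C) * (d%:R + 2))%R.
  apply: (tilt_cvg (D := fun y => (a + b * dot y y)%:E)) => //.
  - move=> n y; rewrite ge -EFinM lee_fin.
    have g00 : (0 <= fine (g y))%R by exact: fine_ge0.
    have sn : (0 <= s_ n <= delta)%R by have := sA n; rewrite /= in_itv.
    apply: (le_trans (ler_wpM2l g00 (weight_small (y - x) sn))).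
    have := mul_sum_norm_le (fine (g y)) (y - x); have := dotB_le y x; have := g2 y.
    have e0 : (0 <= expR 1 :> R)%R by exact: expR_ge0.
    have d0 : (0 <= d%:R :> R)%R by [].
    rewrite /a /b; move: e0 d0 C0; move: (expR 1) (d%:R : R) (dot y y) (dot x x) (dot (y - x) (y - x)).
    move: (fine (g y)) g00 (\sum_(i < d) _)%R => u u0 L e dd S X Z e0 d0 C1 h1 h2 h3.
    have h4 : (u * L <= dd * (1 + S) + 2 * S + 2 * X)%R.
      apply: (le_trans h3); rewrite -addrA lerD//; exact: ler_wpM2l.
    have h5 : (u * e <= (2 + S) * e)%R by apply: ler_wpM2r => //; nra.
    have C2 : (0 <= 1 + C)%R by lra.
    have h6 : ((1 + C) * (u * L) <= (1 + C) * (dd * (1 + S) + 2 * S + 2 * X))%R by exact: ler_wpM2l.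
    have -> : (u * (e + (1 + C) * L) = u * e + (1 + C) * (u * L))%R by ring.
    by apply: (le_trans (lerD h5 h6)); rewrite le_eqVlt; apply/orP; left; apply/eqP; ring.
  - move=> y; rewrite [X in _ --> X]/weight eqxx.
    have -> : (fun n => weight (s_ n) (q (s_ n)) (y - x)) =
        (fun n => expmart (s_ n) (q (s_ n)) (y - x)) by apply/funext => n; exact: weightE.
    have -> : (1 = expmart 0 (0 : V) (y - x) :> R)%R by rewrite /expmart dot0l !mul0r subr0 expR0.
    apply: continuous_cvg; first exact: continuous_expR.
    apply: cvgB; first by apply: cvg_dot => //; exact: cvg_cst.
    by do 2 (apply: cvgM; last exact: cvg_cst).
apply: post_mean_cvg => //.
- by apply main => // y; rewrite /= expr1n lerDl dot_ge0.
- move=> i g hg; have [mg g0 gf ig] := integrable_part integrable_coord hg.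
  apply: main => // y; have := coord2_le y i.
  case: hg => ->; rewrite /pospart /negpart /= ; move: (y ord0 i) (dot y y) => a b.
    by rewrite maxElt; case: ifP => _; nra.
  by rewrite maxElt; case: ifP => _; nra.
Qed.

End near0.

Lemma post_mean_continuous (q : R -> V) (delta C : R) :
  (0 < delta)%R -> (0 <= C)%R -> q 0%R = 0%R ->
  {within `[0%R, +oo[, continuous q} ->
  (forall s, (0 < s <= delta)%R -> (`|q s| ^+ 2 * expR (d%:R * `|q s| ^+ 2 / s) <= C)%R) ->
  {within `[0%R, +oo[, continuous (fun s => post_mean k s (x, q s))}.
Proof.
move=> delta0 C0 q0 /subspace_continuousP cq hC; apply/subspace_continuousP => s.
rewrite /= in_itv/= andbT => s0.
have [s00|sn0] := eqVneq s 0%R; last first.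
  have sp : (0 < s)%R by rewrite lt_neqAle eq_sym sn0.
  (* On the neighbourhood ]0, +oo[ of [s] all times of an approximating sequence are positive, as
     [post_mean_cvg_pos] requires. *)
  have h : (fun s => post_mean k s (x, q s)) @ within `]0%R, +oo[ (nbhs s) --> post_mean k s (x, q s).
    apply: within_cvg_seq => s_ sA sc.
    have sn n : (0 < s_ n)%R by have := sA n; rewrite /= in_itv/= andbT.
    apply: (post_mean_cvg_pos integrable_coord) => //.
    have hs : `[0%R, +oo[%classic s by rewrite /= in_itv/= andbT ltW.
    move=> B /(cq _ hs) hB.
    have h : \forall n \near \oo, `[0%R, +oo[%classic (s_ n) -> B (q (s_ n)) := sc _ hB.
    suff : \forall n \near \oo, B (q (s_ n)) by [].
    by apply: filterS h => n; apply; rewrite /= in_itv/= andbT ltW.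
  move=> B /h hB.
  have hB' : \forall t \near s, `]0%R, +oo[%classic t -> B (post_mean k t (x, q t)) := hB.
  have pos : \forall t \near s, (0 < t)%R by apply: open_nbhs_nbhs; split => //; exact: open_gt.
  suff : \forall t \near s, `[0%R, +oo[%classic t -> B (post_mean k t (x, q t)) by [].
  by apply: filterS2 hB' pos => t h1 t0 _; apply: h1; rewrite /= in_itv/= andbT.
have c0 : q @ within `[0%R, delta] (nbhs 0%R) --> (0%R : V).
  have hs : `[0%R, +oo[%classic (0%R : R) by rewrite /= in_itv/= lexx.
  move=> B hB; rewrite -q0 in hB; have hB1 := cq _ hs _ hB.
  have hB' : \forall t \near (0%R : R), `[0%R, +oo[%classic t -> B (q t) := hB1.
  suff : \forall t \near (0%R : R), `[0%R, delta]%classic t -> B (q t) by [].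
  apply: filterS hB' => t h; rewrite /= in_itv/= => /andP[t0 _]; apply: h.
  by rewrite /= in_itv/= t0.
move=> B; rewrite s00 => hB0; have {hB0}hB : nbhs (post_mean k 0%R (x, q 0%R)) B := hB0.
move: hB; rewrite q0 => /(post_mean_cvg0 C0 q0 c0 hC) hB.
have hB' : \forall t \near (0%R : R), `[0%R, delta]%classic t -> B (post_mean k t (x, q t)) := hB.
have dl : \forall t \near (0%R : R), (t < delta)%R by apply: open_nbhs_nbhs; split => //; exact: open_lt.
suff : \forall t \near (0%R : R), `[0%R, +oo[%classic t -> B (post_mean k t (x, q t)) by [].
apply: filterS2 hB' dl => t h1 td; rewrite /= in_itv/= andbT => t0; apply: h1.
by rewrite /= in_itv/= t0 ltW.
Qed.

End posterior_path.

Lemma norm_sqr_le {R : realType} {d} (q : 'rV[R]_d) (c : R) : 0 <= c ->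
  (forall i, q ord0 i ^+ 2 <= c) -> `|q| ^+ 2 <= c.
Proof.
move=> c0 h; have [->|] := eqVneq `|q| 0; first by rewrite expr0n.
move=> /mx_norm_neq0[[i j]] /=; rewrite [in X in X -> _]ord1 => e.
have -> : `|q| = `|q ord0 j| by rewrite -e.
by rewrite real_normK ?num_real.
Qed.

(** * Small-time growth of the observation *)

Section small_time.
Context {R : realType} {d : nat}.
Local Notation V := 'rV[R]_d.

Lemma rat_time_dense (a b : R) : a < b -> exists m, a < rat_time m < b.
Proof.
move=> /rat_in_itvoo[q]; rewrite in_itv/= => h.
by exists (pickle q); rewrite /rat_time pickleK.
Qed.

(** For s of order exp (-n) the noise contributes at most 2 d e n times this rate to d |R_s|^2 / s;
    the choice makes that at most n / 2. The successor of d avoids a zero denominator when d = 0. *)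
Definition small_rate : R := (4 * d.+1%:R * expR 1)^-1.

Lemma small_rate_gt0 : 0 < small_rate.
Proof. by rewrite invr_gt0 !mulr_gt0 ?expR_gt0. Qed.

Variables (w : R -> V) (u : V).
Hypothesis cw : {within `[0, +oo[, continuous w}.
Hypothesis w0 : w 0 = 0.
Hypothesis hw : forall i, exists N, forall n m, (N <= n)%N ->
    0 <= (rat_time m : R) <= expR (- n%:R) ->
    w (rat_time m) ord0 i ^+ 2 <= small_rate * n%:R * expR (- n%:R).

(** A strict violation at [s] is an open condition, so by continuity it also occurs at a rational
    time just before [s], still in the range of the hypothesis. *)
Lemma small_time_real : exists N, forall n s i, (N <= n)%N -> 0 <= s <= expR (- n%:R) ->
  w s ord0 i ^+ 2 <= small_rate * n%:R * expR (- n%:R).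
Proof.
have /choice[N hN] := hw.
exists (\max_i N i)%N => n s i Nn /andP[s0 sn].
have Ni : (N i <= n)%N by apply: leq_trans Nn; exact: leq_bigmax.
have [s00|sn0] := eqVneq s 0.
  by rewrite s00 w0 mxE expr0n/= !mulr_ge0 ?expR_ge0// ltW// small_rate_gt0.
have sp : 0 < s by rewrite lt_neqAle eq_sym sn0.
rewrite leNgt; apply/negP => hlt.
set c := small_rate * n%:R * expR (- n%:R) in hlt.
have cs : w @ within `[0, +oo[ (nbhs s) --> w s.
  by move/subspace_continuousP : cw; apply; rewrite /= in_itv/= andbT.
have op : nbhs (w s) [set v : V | c < v ord0 i ^+ 2].
  have := @coord_continuous R 1 d ord0 i (w s).
  move=> /(_ [set r | c < r ^+ 2]); apply.
  have : (fun r : R => r ^+ 2) @ (w s ord0 i) --> (w s ord0 i) ^+ 2 by exact: exprn_continuous.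
  move=> /(_ [set r | c < r]); apply.
  by apply: open_nbhs_nbhs; split => //; exact: open_gt.
have := cs _ op.
rewrite /= /within /= => /nbhs_ballP[e /= e0 he].
have [m /andP[h1 h2]] : exists m, Num.max 0 (s - e) < rat_time m < s.
  by apply: rat_time_dense; rewrite gt_max sp/= gtrBl.
move: h1; rewrite gt_max => /andP[m0 ms].
have := he (rat_time m); rewrite /ball/= => /(_ _)/(_ _) h3.
have : c < w (rat_time m) ord0 i ^+ 2.
  apply: h3; last by rewrite in_itv/= andbT ltW.
  by rewrite ger0_norm ?subr_ge0 ?ltW// ltrBlDl -ltrBlDr.
rewrite ltNge => /negP; apply; apply: (hN i n m Ni).
by rewrite (ltW m0)/= (le_trans _ sn)// ltW.
Qed.

(** Noise and drift are separated by (a + b)^2 <= 2 a^2 + 2 b^2. The exponential is then at most a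
    constant times exp (n / 2), which the squared norm in front, of order n exp (-n), absorbs. *)
Lemma shift_small_time : exists delta C : R, [/\ 0 < delta, 0 <= C & forall s, 0 < s <= delta ->
  `|shift_path u w s| ^+ 2 * expR (d%:R * `|shift_path u w s| ^+ 2 / s) <= C].
Proof.
have [N hN] := small_time_real.
pose b := small_rate; pose U := `|u| ^+ 2.
have b0 : 0 < b by exact: small_rate_gt0.
have U0 : 0 <= U by rewrite sqr_ge0.
pose K := expR (2 * d%:R * expR 1 * U).
exists (expR (- N%:R)), ((4 * b + 2 * U) * K); split; first exact: expR_gt0.
  by rewrite mulr_ge0 ?expR_ge0// addr_ge0// mulr_ge0// ltW.
move=> s /andP[s0 sN].
(* Chosen so that exp (-(n + 1)) < s <= exp (-n); in particular 1 / s <= e exp n. *)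
pose n := Num.truncn (- ln s).
have lN : N%:R <= - ln s by rewrite lerNr -ler_expR lnK ?posrE.
have ls0 : 0 <= - ln s by apply: le_trans lN.
have /andP[n1 n2] := truncn_itv ls0.
have Nn : (N <= n)%N.
  have : (N%:R : R) < n.+1%:R by apply: le_lt_trans n2.
  by rewrite ltr_nat ltnS.
have sn : s <= expR (- n%:R) by rewrite -[s]lnK ?posrE// ler_expR lerNr.
have sn1 : s^-1 <= expR 1 * expR n%:R.
  rewrite -expRD -[s]lnK ?posrE// -expRN ler_expR.
  by rewrite addrC natr1 ltW.
pose e := expR (- n%:R) : R.
have e0 : 0 < e by exact: expR_gt0.
have e1 : e <= 1 by rewrite /e -[X in _ <= X]expR0 ler_expR oppr_le0.
have een : e * expR n%:R = 1 by rewrite /e -expRD addNr expR0.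
set a := `|shift_path u w s|.
have a2 : a ^+ 2 <= 2 * b * n%:R * e + 2 * U * e ^+ 2.
  have B0 : 0 <= 2 * b * n%:R * e + 2 * U * e ^+ 2.
    by rewrite addr_ge0// !mulr_ge0// ?ltW.
  apply: norm_sqr_le => // i; rewrite /shift_path !mxE.
  have := hN n s i Nn; rewrite (ltW s0) sn => /(_ isT); rewrite -/b -/e => h1.
  have h2 : u ord0 i ^+ 2 <= U.
    by rewrite -real_normK ?num_real// ler_sqr ?nnegrE// coord_le_norm.
  have h3 : s ^+ 2 <= e ^+ 2 by rewrite ler_sqr ?nnegrE// ltW.
  have h4 : s ^+ 2 * u ord0 i ^+ 2 <= e ^+ 2 * U by rewrite ler_pM// sqr_ge0.
  have -> : 2 * b * n%:R * e + 2 * U * e ^+ 2 = 2 * (b * n%:R * e) + 2 * (e ^+ 2 * U) by ring.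
  have h5 := sqr_ge0 (w s ord0 i - s * u ord0 i).
  have -> : (w s ord0 i + s * u ord0 i) ^+ 2 = 2 * w s ord0 i ^+ 2 +
    2 * (s ^+ 2 * u ord0 i ^+ 2) - (w s ord0 i - s * u ord0 i) ^+ 2 by ring.
  by move: h1 h4 h5; lra.
(* The square root of exp n: since e h h = 1 and n <= 2 h, the product n e h is at most 2. *)
pose h := expR (n%:R / 2) : R.
have hh : h * h = expR n%:R by rewrite /h -expRD; congr expR; field.
have h1 : 1 + n%:R / 2 <= h by exact: expR_ge1Dx.
have n0 : 0 <= n%:R :> R by [].
have ehh : e * h * h = 1 by rewrite -mulrA hh.
have E0 : 0 < expR 1 :> R by exact: expR_gt0.
have expo : d%:R * a ^+ 2 / s <= n%:R / 2 + 2 * d%:R * expR 1 * U.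
  apply: (@le_trans _ _ (d%:R * (2 * b * n%:R * e + 2 * U * e ^+ 2) * (expR 1 * expR n%:R))).
    apply: ler_pM => //; last by rewrite ler_wpM2l.
    - by rewrite mulr_ge0// sqr_ge0.
    - by rewrite invr_ge0 ltW.
  have -> : d%:R * (2 * b * n%:R * e + 2 * U * e ^+ 2) * (expR 1 * expR n%:R) =
      (2 * d%:R * expR 1 * b * n%:R) * (e * expR n%:R) +
      2 * d%:R * expR 1 * U * e * (e * expR n%:R) by ring.
  rewrite een !mulr1 lerD//; last by rewrite ler_piMr// !mulr_ge0// ltW.
  have -> : 2 * d%:R * expR 1 * b * n%:R = d%:R / d.+1%:R * (n%:R / 2).
    rewrite /b /small_rate; field.
    by rewrite [1 + _]addrC natr1 pnatr_eq0/= gt_eqF.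
  rewrite ler_piMl ?divr_ge0// ler_pdivrMr// mul1r ler_nat//.
apply: (@le_trans _ _ (a ^+ 2 * (h * K))).
  by rewrite ler_wpM2l ?sqr_ge0// /h /K -expRD ler_expR.
rewrite mulrA ler_wpM2r ?expR_ge0//.
apply: (@le_trans _ _ ((2 * b * n%:R * e + 2 * U * e ^+ 2) * h)).
  by rewrite ler_wpM2r ?expR_ge0.
have h0 : 1 <= h by apply: le_trans h1; rewrite lerDl divr_ge0.
have hp : 0 < h by exact: expR_gt0.
have q1 : e * h <= 1 by rewrite -ehh ler_peMr// ltW// mulr_gt0.
have q2 : n%:R * (e * h) <= 2.
  have : n%:R <= 2 * h by lra.
  move=> /(ler_wpM2r (mulr_ge0 (ltW e0) (ltW hp)))/le_trans; apply.
  by rewrite -mulrA [h * _]mulrC ehh mulr1.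
have q3 : e * (e * h) <= 1 by rewrite mulr_ile1// ltW// mulr_gt0.
have -> : (2 * b * n%:R * e + 2 * U * e ^+ 2) * h =
  2 * b * (n%:R * (e * h)) + 2 * U * (e * (e * h)) by ring.
apply: lerD; last by rewrite ler_piMr// mulr_ge0.
have -> : 4 * b = 2 * b * 2 by ring.
by rewrite ler_wpM2l// mulr_ge0// ltW.
Qed.

End small_time.

(** * The observation model *)

Section disintegration.
Local Open Scope ereal_scope.
Context {R : realType} {d1 d2} {S1 : measurableType d1} {S2 : measurableType d2}.
Variables (mu : probability S1 R) (k : R.-pker S1 ~> S2).
Variable m : probability (S1 * S2)%type R.
Hypothesis hm : forall A B, measurable A -> measurable B ->
  m (A `*` B) = \int[mu]_(x in A) k x B.

Let mpair (x : S1) : measurable_fun [set: S2] (pair x).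
Proof. exact: measurable_pair1. Qed.

Let eta (x : S1) : {measure set (S1 * S2) -> \bar R} := law (fiber k x) (mpair x).

Let meta A : measurable A -> measurable_fun setT (eta ^~ A).
Proof.
move=> mA; pose f (z : S1 * S2) := (\1_A z : R)%:E.
have mf : measurable_fun setT f by apply/measurable_EFinP; exact: measurable_indic.
have f0 z : 0 <= f z by rewrite lee_fin.
apply: (eq_measurable_fun (fun x => \int[fiber k x]_y f (x, y))).
  move=> x _; rewrite /eta /law /=.
  transitivity (\int[fiber k x]_y (\1_(pair x @^-1` A) y : R)%:E); first by [].
  by rewrite integral_indic ?setIT//; exact: (measurable_preimage (mpair x)).
exact: (measurable_fun_integral_fiber k (@measurable_id _ S1 setT) mf f0).
Qed.

Lemma integral_disintegration (f : S1 * S2 -> \bar R) :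
  measurable_fun setT f -> (forall z, 0 <= f z) ->
  \int[m]_z f z = \int[mu]_x \int[fiber k x]_y f (x, y).
Proof.
move=> mf f0.
transitivity (\int[mixture mu meta]_z f z); last first.
  transitivity (\int[mu]_x \int[eta x]_z f z); first exact: integral_mixture.
  by apply: eq_integral => x _; rewrite integral_law.
apply: eq_measure_integral => A mA _.
have [G1 G2 G3 G4] := @rectangles_pi _ _ S1 S2.
apply: (measure_eq_pi G1 G2 G3 G4) mA.
  by rewrite [X in X < _](_ : _ = 1) ?ltry//; exact: probability_setT.
move=> _ [C mC [D mD <-]]; transitivity (\int[mu]_(x in C) k x D); first exact: hm.
rewrite /mixture integral_mkcond; apply: eq_integral => x _.
rewrite patchE /eta /law /=; case: ifPn => [xC|xC].
  congr (k x _); apply/seteqP; split => w /= h; last by case: h.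
  by split => //; move: xC; rewrite inE.
rewrite (_ : _ @^-1` _ = set0) ?measure0//.
by apply/seteqP; split => w //= [h _]; move: xC; rewrite notin_setE.
Qed.

End disintegration.

Section observation_model.
Local Open Scope ereal_scope.
Context {R : realType} {d : nat}.
Local Notation V := 'rV[R]_d.
Local Notation Om := (paths d (`[0%R, +oo[ : set R)).
Variables (mu nu : probability V R).
Hypothesis hnu : finite_second_moment nu.
Variables (m : probability (V * V)%type R) (k : R.-pker V ~> V).
Hypothesis hm : martingale_coupling mu nu m k.
Context {disp} {T : measurableType disp} (P : probability T R) (X Y : T -> V).
Hypotheses (mX : measurable_fun setT X) (mY : measurable_fun setT Y).
Hypothesis hXY : forall A : set (V * V), measurable A -> P [set w | A (X w, Y w)] = m A.
Variable W : R -> T -> V.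
Hypothesis hW : wiener P W.
Hypothesis hindep : indep P (sigma_rv (fun w => (X w, Y w))) (sigma_process `[0%R, +oo[ W).

Let mXY : measurable_fun setT (fun w => (X w, Y w)). Proof. exact: measurable_fun_pair. Qed.
Let mWt t : (0 <= t)%R -> measurable_fun setT (W t). Proof. by have [h _ _ _] := hW; exact: h. Qed.
Hypothesis mW : measurable_fun setT (path_map W).
Let gam : probability Om R := law P mW.
Let hgam : wiener gam (fun t (w : Om) => w t). Proof. exact: wiener_law. Qed.
Let Q := observation X Y W.

Lemma observationE s w : Q s w = shift_path (Y w - X w) (W ^~ w) s.
Proof. by rewrite /Q /observation /shift_path addrC. Qed.

Lemma measurable_observation s : (0 <= s)%R -> measurable_fun setT (Q s).
Proof.
move=> s0; apply: measurable_rVD; last exact: mWt.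
by apply: measurable_rVZ => //; exact: measurable_rVB.
Qed.

(** Independence of the noise from (X, Y) gives a product integral; the coupling is then
    disintegrated along [k]. *)
Lemma observation_model (f : (V * V) * Om -> \bar R) :
  measurable_fun setT f -> (forall z, 0 <= f z) ->
  \int[P]_w f ((X w, Y w), path_map Q w) =
  \int[mu]_x \int[fiber k x]_y \int[gam]_w f ((x, y), shift_path (y - x) w).
Proof.
move=> mf f0; have [_ _ hm3 _] := hm.
pose F (z : (V * V) * Om) := f (z.1, (shift_path (z.1.2 - z.1.1) z.2 : Om)).
have mF : measurable_fun setT F.
  apply: (measurableT_comp mf); apply: measurable_fun_pair; first exact: measurable_fst.
  apply: measurable_shift_path2; last exact: measurable_snd.
  by apply: measurable_rVB; apply: measurableT_comp.
have F0 z : 0 <= F z by exact: f0.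
transitivity (\int[P]_w F ((X w, Y w), path_map W w)).
  apply: eq_integral => w _; rewrite /F /=; congr (f (_, _)).
  by apply/funext => s; rewrite -observationE.
transitivity (\int[m]_z \int[gam]_w F (z, w)).
  apply: (integral_law_pair mXY mW _ mF F0) => A B mA mB.
  transitivity (P ((fun w => (X w, Y w)) @^-1` A) * P (path_map W @^-1` B)).
    by apply: hindep; [apply/sigma_rvP; exists A | apply/sigma_processP; exists B].
  by congr (_ * _); exact: hXY.
have mG := @measurable_fun_fubini_tonelli_F _ _ _ _ _ gam F mF F0.
have G0 z : 0 <= \int[gam]_w F (z, w) by apply: integral_ge0.
exact: (integral_disintegration hm3 mG G0).
Qed.

Lemma integral_nu (f : V -> \bar R) : measurable_fun setT f -> (forall z, 0 <= f z) ->
  \int[mu]_x \int[fiber k x]_y f y = \int[nu]_y f y.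
Proof.
move=> mf f0; have [_ hm2 hm3 _] := hm.
have ms : measurable_fun [set: V * V] snd by exact: measurable_snd.
have := integral_disintegration hm3 (measurableT_comp mf ms) (fun z => f0 z.2).
move=> /= <-; transitivity (\int[law m ms]_y f y); first by rewrite integral_law.
apply: eq_measure_integral => A mA _; transitivity (m ([set: V] `*` A)); last exact: hm2.
by congr (m _); apply/seteqP; split => z //= [].
Qed.

Let mdot : measurable_fun [set: V] (fun y : V => (dot y y)%:E).
Proof. by apply/measurable_EFinP; exact: measurable_dot. Qed.

Let nu_dot : \int[nu]_y (dot y y)%:E < +oo.
Proof.
by rewrite (eq_integral (fun y : V => (\sum_(i < d) (y ord0 i) ^+ 2)%:E)).
Qed.

(** The second moments of the fibres integrate over [mu] to the second moment of [nu], which is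
    finite. *)
Lemma fiber_second_moment :
  {ae mu, forall x, (fiber k x).-integrable setT (fun y : V => (dot y y)%:E)}.
Proof.
have d0 (y : V) : 0 <= (dot y y)%:E by rewrite lee_fin dot_ge0.
pose f x := \int[fiber k x]_y (dot y y)%:E.
have f0 x : 0 <= f x by exact: integral_ge0.
have mf : measurable_fun setT f.
  exact: (measurable_fun_integral_fiber k (@measurable_id _ V setT)
    (measurableT_comp mdot (@measurable_snd _ _ V V)) (fun z => d0 z.2)).
have fi : mu.-integrable setT f.
  apply/integrableP; split => //; under eq_integral do rewrite gee0_abs//.
  by rewrite integral_nu.
apply: ae_imp (integrable_ae measurableT fi) => x /(_ Logic.I) hx.
apply/integrableP; split => //; under eq_integral do rewrite gee0_abs//.
by rewrite -ge0_fin_numE//; exact: f0.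
Qed.

Lemma fiber_first_moment :
  {ae mu, forall x i, (fiber k x).-integrable setT (fun y : V => (y ord0 i)%:E)}.
Proof. by apply: ae_imp fiber_second_moment => x h i; exact: integrable_coord. Qed.

End observation_model.

Lemma condexp_vec_tower {R : realType} {d : nat} {disp} {T : measurableType disp}
    (P : probability T R) (G H : set (set T)) (f g h : T -> 'rV[R]_d) :
  G `<=` H -> is_condexp_vec P G f g -> is_condexp_vec P H f h -> is_condexp_vec P G h g.
Proof.
move=> GH [mg hg] [_ hh]; split => // i.
have [_ mgi gi gE] := hg i; have [_ _ hi hE] := hh i.
split=> // A GA; transitivity (\int[P]_(w in A) (f w ord0 i)%:E)%E; first exact: gE.
by symmetry; apply: hE; exact: GH.
Qed.

Section observation_filtration_theory.
Context {R : realType} {d : nat} {disp} {T : measurableType disp}.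
Local Notation V := 'rV[R]_d.
Variables (X Y : T -> V) (W : R -> T -> V).
Local Notation F := (observation_filtration X Y W).
Local Notation Q := (observation X Y W).

Lemma sigma_algebra_observation s : sigma_algebra setT (F s).
Proof. exact: smallest_sigma_algebra. Qed.

Lemma observation_filtration_initial s (B : set V) : measurable B -> F s (X @^-1` B).
Proof. by move=> mB; apply: sub_gen_smallest; left; exists B => //; rewrite setTI. Qed.

Lemma observation_filtration_observation s r (B : set V) :
  0 <= r <= s -> measurable B -> F s (Q r @^-1` B).
Proof.
move=> rs mB; apply: sub_gen_smallest; right; exists r; first by rewrite /= in_itv.
by exists B => //; rewrite setTI.
Qed.

Lemma observation_filtration_le s t : s <= t -> F s `<=` F t.
Proof.
move=> st; apply: smallest_sub; first exact: sigma_algebra_observation.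
move=> A [[B mB <-]|[r rs [B mB <-]]]; rewrite setTI.
  exact: observation_filtration_initial.
apply: observation_filtration_observation => //.
by move: rs; rewrite /= in_itv/= => /andP[-> /le_trans]; apply.
Qed.

Lemma observation_filtration_paths s A : F s A ->
  exists2 A' : set (V * paths d `[0, s]), measurable A' & A = [set w | A' (X w, Q ^~ w)].
Proof.
pose Ph w : V * paths d `[0, s] := (X w, Q ^~ w).
suff : F s `<=` preimage_set_system setT Ph measurable.
  by move=> /[apply] -[A' mA' <-]; exists A' => //; rewrite setTI.
apply: smallest_sub.
  by apply: sigma_algebra_preimage; exact: sigma_algebra_measurable.
move=> _ [[B mB <-]|[r rs [B mB <-]]].
  exists (fst @^-1` B); last by [].
  by apply: (measurable_preimage _ mB); exact: measurable_fst.
exists ((fun z : V * paths d `[0, s] => z.2 r) @^-1` B); last by [].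
apply: (measurable_preimage _ mB).
by apply: (measurableT_comp (f := fun w : paths d `[0, s] => w r)) => //; exact: measurable_eval.
Qed.

End observation_filtration_theory.

Lemma continuous_shift_path {R : realType} {d : nat} (u : 'rV[R]_d) (w : R -> 'rV[R]_d) D :
  {within D, continuous w} -> {within D, continuous (shift_path u w)}.
Proof.
move=> /subspace_continuousP cw; apply/subspace_continuousP => s Ds.
apply: cvgD; first exact: cw.
by apply: cvgZr_tmp; exact: cvg_within.
Qed.

(* Z is Markov conditionally on its initial value Z_0 = X, i.e. (X, Z) is
   Markov.  Z alone is in general not: for X = +-1 with probability 1/2 and
   Y - X = +-2 an independent fair sign, the ranges (-3, 1) and (-1, 3) of Z_s
   given X overlap, and on the overlap the law of Z_t given the past still
   depends on X = Z_0. *)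
Theorem theorem5p1 (R : realType) (d : nat)
  (mu nu : probability 'rV[R]_d R)
  (hmu : finite_second_moment mu) (hnu : finite_second_moment nu)
  (hmunu : convex_order mu nu)
  (m : probability ('rV[R]_d * 'rV[R]_d)%type R)
  (k : R.-pker 'rV[R]_d ~> 'rV[R]_d)
  (hm : martingale_coupling mu nu m k)
  (disp : measure_display) (T : measurableType disp) (P : probability T R)
  (X Y : {RV P >-> 'rV[R]_d})
  (hXY : forall A : set ('rV[R]_d * 'rV[R]_d)%type, measurable A ->
    P [set w | A (X w, Y w)] = m A)
  (W : R -> T -> 'rV[R]_d) (hW : brownian_motion P W)
  (hindep : indep P (sigma_rv (fun w => (X w, Y w)))
                    (sigma_process `[0, +oo[ W))
  (Z : R -> T -> 'rV[R]_d)
  (hZ : forall s : R, 0 <= s ->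
    is_condexp_vec P (observation_filtration X Y W s) Y (Z s))
  (disp0 : measure_display) (T0 : measurableType disp0)
  (P0 : probability T0 R)
  (B : R -> T0 -> 'rV[R]_d) (hB : brownian_motion P0 B) :
  [/\ has_continuous_modification P Z,
      markov_process P (observation_filtration X Y W) (fun s w => (X w, Z s w)),
      martingale P (observation_filtration X Y W) Z,
      (forall sigma : R, 0 < sigma ->
        forall (disp1 : measure_display) (T1 : measurableType disp1)
          (P1 : probability T1 R) (M : R -> T1 -> 'rV[R]_d),
        foellmer_martingale P0 B sigma mu k P1 M ->
        same_law `[0, +oo[ P1 (fun s => M (tau sigma s)) P Z) &
      (forall sigma1 sigma2 : R, 0 < sigma1 -> 0 < sigma2 ->
        forall (disp1 : measure_display) (T1 : measurableType disp1)
          (P1 : probability T1 R) (M1 : R -> T1 -> 'rV[R]_d)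
          (disp2 : measure_display) (T2 : measurableType disp2)
          (P2 : probability T2 R) (M2 : R -> T2 -> 'rV[R]_d),
        foellmer_martingale P0 B sigma1 mu k P1 M1 ->
        foellmer_martingale P0 B sigma2 mu k P2 M2 ->
        same_law `[0, +oo[ P1 (fun s => M1 (tau sigma1 s))
                           P2 (fun s => M2 (tau sigma2 s)))].
Proof.
have mX : measurable_fun setT X by [].
have mY : measurable_fun setT Y by [].
have hW' := brownian_wiener hW; have hB' := brownian_wiener hB.
have [mWt W0 cW _ _] := hW.
have mW : measurable_fun setT (path_map W) by exact: measurable_path_map.
pose gam : probability (paths d (`[0, +oo[ : set R)) R := law P mW.
have hgam : wiener gam (fun t (w : paths d (`[0, +oo[ : set R)) => w t) by exact: wiener_law.
pose Q := observation X Y W; pose F := observation_filtration X Y W.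
have mQ s : 0 <= s -> measurable_fun setT (Q s) by exact: (measurable_observation mX mY hW').
have hmodel := observation_model hm mX mY hXY hindep mW.
have hk := fiber_first_moment hnu hm.
have Fpaths s (_ : 0 <= s) A (FA : F s A) := observation_filtration_paths FA.
have FQ s C (s0 : 0 <= s) (mC : measurable C) : F s (Q s @^-1` C).
  by apply: observation_filtration_observation => //; rewrite s0 lexx.
have Fmeas s : 0 <= s -> F s `<=` measurable by exact: (filtration_measurable mX mQ Fpaths).
have iY i : P.-integrable setT (fun w => (Y w ord0 i)%:E).
  by have [_ h] := hZ 0 (lexx 0); have [] := h i.
(* The given version [Z s] is an arbitrary one; for each fixed [s] it is the explicit posterior
   mean, up to a null set that may depend on [s]. *)
have hpost s : 0 <= s -> {ae P, forall w, Z s w = post_mean k s (X w, Q s w)}.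
  move=> s0; apply: (condexp_vec_unique _ (Fmeas s s0) (hZ s s0)).
    exact: sigma_algebra_observation.
  apply: (post_condexp hgam mX mY mQ hmodel s0 _ _ iY); first exact: Fpaths.
  apply: pair_events; [exact: sigma_algebra_observation | exact: observation_filtration_initial|].
  by move=> C mC; exact: FQ.
have mZ s : 0 <= s -> measurable_fun setT (Z s).
  move=> s0 _ C mC; rewrite setTI; apply: (Fmeas s s0).
  by have [h _] := hZ s s0; exact: h.
have law_eq sigma : 0 < sigma ->
    forall (disp1 : measure_display) (T1 : measurableType disp1)
      (P1 : probability T1 R) (M : R -> T1 -> 'rV[R]_d),
    foellmer_martingale P0 B sigma mu k P1 M ->
    same_law `[0, +oo[ P1 (fun s => M (tau sigma s)) P Z.
  move=> sigma0 disp1 T1 P1 M hM A mA.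
  rewrite (foellmer_martingale_law hgam hB' sigma0 hk hM mA).
  by rewrite (post_mean_law mX mQ hmodel mZ hpost mA).
split.
- have smallW : {ae P, forall w, forall i : 'I_d, exists N : nat, forall n m : nat, (N <= n)%N ->
      0 <= (rat_time m : R) <= expR (- n%:R) ->
      W (rat_time m) w ord0 i ^+ 2 <= small_rate (d := d) * n%:R * expR (- n%:R)}.
    exact: (law_ae (small_time_ae hgam (@small_rate_gt0 R d))).
  have [N [mN N0 good]] := ae_and (model_ae mX hmodel (fiber_second_moment hnu hm))
    (ae_and W0 (ae_and cW smallW)).
  (* On the null set [N] the modification is constantly 0, so that every path is continuous and not
     only almost every one. *)
  exists (fun s w => \1_(~` N) w *: post_mean k s (X w, Q s w)); split.
  + move=> s s0; apply: measurable_rVZ.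
      by apply: measurable_indic; exact: measurableC.
    apply: (measurableT_comp (measurable_post_mean k s0)).
    by apply: measurable_fun_pair => //; exact: mQ.
  + move=> s s0.
    have NC : {ae P, forall w, ~ N w} by exists N; split => // w /contrapT.
    apply: filterS2 NC (hpost s s0) => w Nw ->.
    by rewrite indicE mem_set// scale1r.
  move=> w; have [Nw|Nw] := pselect (N w).
    rewrite (_ : (fun _ => _) = cst 0); first exact: cst_continuous.
    by apply/funext => s; rewrite indicE memNset ?scale0r//= => h; exact: h.
  have [iS [w0 [cw hw]]] : (fiber k (X w)).-integrable setT (fun y => (dot y y)%:E) /\
      W 0 w = 0 /\ {within `[0, +oo[, continuous (fun t => W t w)} /\
      forall i : 'I_d, exists N : nat, forall n m : nat, (N <= n)%N ->
      0 <= (rat_time m : R) <= expR (- n%:R) ->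
      W (rat_time m) w ord0 i ^+ 2 <= small_rate (d := d) * n%:R * expR (- n%:R).
    by apply: contrapT => h; apply: Nw; apply: good.
  have [delta [C [delta0 C0 hC]]] := shift_small_time (Y w - X w) cw w0 hw.
  rewrite (_ : (fun _ => _) = fun s => post_mean k s (X w, shift_path (Y w - X w) (W ^~ w) s)).
    apply: (post_mean_continuous iS delta0 C0 _ _ hC).
    + by rewrite /shift_path w0 scale0r addr0.
    + exact: continuous_shift_path.
  by apply/funext => s; rewrite indicE mem_set// scale1r /Q observationE.
- apply: (posterior_mean_markov hgam mX mQ hmodel hk _ Fpaths _ _ _ hpost).
  + by move=> s _; exact: sigma_algebra_observation.
  + by move=> s _; exact: observation_filtration_initial.
  + by move=> s s0 C mC; exact: FQ.
  + by move=> s s0; have [] := hZ s s0.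
- move=> s t s0 st; have t0 := le_trans s0 st.
  exact: condexp_vec_tower (observation_filtration_le st) (hZ s s0) (hZ t t0).
- exact: law_eq.
move=> sigma1 sigma2 s1 s2 disp1 T1 P1 M1 disp2 T2 P2 M2 h1 h2 A mA.
by rewrite (law_eq _ s1 _ _ _ _ h1 A mA) (law_eq _ s2 _ _ _ _ h2 A mA).
Qed.
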